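(* Let $(X_t)_{t\in\mathbb{Z}}$ be stationary with $\alpha$-mixing coefficients $(\alpha(t))_{t\in\mathbb{Z}}$. Let furthermore $\sup_{x\in E}k(x,x)=c<\infty$. Then for every time lag $\eta\in\mathbb{N}$, $\epsilon>0$, $\nu\in\mathbb{N}$, $n\ge2$ as well as $q\in\{1,\dots,\lfloor n/2\rfloor\}$ and $\delta\in(0,1)$, we have $$\mathbb{P}\big[\|C_n(\eta)-C(\eta)\|_{S_2(\mathscr{H})}>\epsilon\big]\le4\nu\exp\left(-\frac{(1-\delta)\epsilon^2q}{32\nu c^2}\right)+22\nu q\left(1+\frac{8c\sqrt{\nu}}{\epsilon(1-\delta)^{1/2}}\right)^{1/2}\alpha\big(\lfloor n/(2q)\rfloor-\eta\big)+\frac{1}{\delta\epsilon^2}\sum_{j>\nu}\lambda_j,$$ where the nonnegative real numbers $(\lambda_j)_{j\ge1}$ are the nonincreasingly ordered eigenvalues of the covariance operator $\Gamma_\eta:S_2(\mathscr{H})\to S_2(\mathscr{H})$ defined by $$\Gamma_\eta:=\mathbb{E}\Big[\big(\varphi(X_\eta)\otimes\varphi(X_0)-C(\eta)\big)\otimes\big(\varphi(X_\eta)\otimes\varphi(X_0)-C(\eta)\big)\Big].$$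
   Context: Setting and standing assumptions: $(\Omega,\mathcal{F},\mathbb{P})$ is a probability space, $E$ is a Polish space with its Borel $\sigma$-field, and $(X_t)_{t\in\mathbb{Z}}$ is a (strictly) stationary $E$-valued process: all finite-dimensional laws are invariant under time shifts. $\mathscr{H}$ is a separable real reproducing kernel Hilbert space of functions $E\to\mathbb{R}$ with kernel $k$ and canonical feature map $\varphi(x)=k(x,\cdot)$, assumed Borel measurable $E\to\mathscr{H}$; $\varphi(X_0)$ is Bochner square-integrable, and the embedded process is centered, $\mathbb{E}[\varphi(X_0)]=0$. Notation: time lags range over $\mathbb{N}=\{0,1,2,\dots\}$; $\nu$ is a (positive) natural number. $S_2(H)$ denotes the Hilbert space of Hilbert--Schmidt operators on a Hilbert space $H$; for $u,v$ in a Hilbert space $H$, $u\otimes v$ is the rank-one operator $h\mapsto\langle h,v\rangle_H\,u$ (used for $H=\mathscr{H}$ and for $H=S_2(\mathscr{H})$). $C(\eta)=\mathbb{E}[\varphi(X_\eta)\otimes\varphi(X_0)]$ and $C_n(\eta)=\frac1n\sum_{t=1}^n\varphi(X_{t+\eta})\otimes\varphi(X_t)$. Eigenvalues are repeated according to multiplicity (and padded with zeros if there are only finitely many nonzero ones). Mixing coefficients: for $\sigma$-fields $\mathcal{F}_1,\mathcal{F}_2\subseteq\mathcal{F}$, $\alpha(\mathcal{F}_1,\mathcal{F}_2)=\sup_{A\in\mathcal{F}_1,B\in\mathcal{F}_2}|\mathbb{P}[A\cap B]-\mathbb{P}[A]\mathbb{P}[B]|$. The coefficients of the process are $\alpha(n)=\sup_{j\in\mathbb{Z}}\alpha(\sigma(X_t,t\le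 j),\sigma(X_t,t\ge j+n))$ for $n\ge1$ and $\alpha(n)=1/4$ for $n<1$. *)

(* Defs.v *)
From HB Require Import structures.
From mathcomp Require Import all_boot all_order all_algebra finmap.
From mathcomp Require Import all_classical all_reals all_analysis.
From mathcomp Require Import ring lra.

Set Implicit Arguments.
Unset Strict Implicit.
Unset Printing Implicit Defensive.

Import Order.TTheory GRing.Theory Num.Theory.
Import numFieldNormedType.Exports.

Local Open Scope classical_set_scope.
Local Open Scope ring_scope.

HB.mixin Record NormedModule_hasInner (R : realType) V & NormedModule R V := {
  inner : V -> V -> R;
  innerC : forall x y, inner x y = inner y x;
  innerDl : forall x y z, inner (x + y) z = inner x z + inner y z;
  innerZl : forall a x y, inner (a *: x) y = a * inner x y;
  inner_norm : forall x, inner x x = `|x| ^+ 2 }.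

#[short(type="hilbertType")]
HB.structure Definition Hilbert (R : realType) :=
  { V of CompleteNormedModule R V & NormedModule_hasInner R V }.

Section hilbert_theory.
Context {R : realType} {H : hilbertType R}.
Implicit Types (x y z u v : H) (a : R) (b : H) (B : set H) (S : {fset H}).

Lemma innerDr x y z : inner x (y + z) = inner x y + inner x z.
Proof. by rewrite innerC innerDl 2!(innerC x). Qed.

Lemma innerZr a x y : inner x (a *: y) = a * inner x y.
Proof. by rewrite innerC innerZl innerC. Qed.

Lemma innerNl x y : inner (- x) y = - inner x y.
Proof. by rewrite -scaleN1r innerZl mulN1r. Qed.

Lemma innerNr x y : inner x (- y) = - inner x y.
Proof. by rewrite innerC innerNl innerC. Qed.

Lemma inner0l x : inner 0 x = 0.
Proof. by rewrite -(scale0r 0) innerZl mul0r. Qed.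

Lemma inner_suml (I : Type) (r : seq I) (f : I -> H) y :
  inner (\sum_(i <- r) f i) y = \sum_(i <- r) inner (f i) y.
Proof.
elim: r => [|i r ih]; first by rewrite !big_nil inner0l.
by rewrite !big_cons innerDl ih.
Qed.

Lemma normD_inner x y : `|x + y| ^+ 2 = `|x| ^+ 2 + 2 * inner x y + `|y| ^+ 2.
Proof.
by rewrite -!inner_norm innerDl !innerDr (innerC y x); ring.
Qed.

Lemma normB_inner x y : `|x - y| ^+ 2 = `|x| ^+ 2 - 2 * inner x y + `|y| ^+ 2.
Proof. by rewrite normD_inner innerNr normrN; ring. Qed.

(* A nonnegative quadratic trinomial has nonpositive discriminant. *)
Lemma discr_le0 (p q r : R) : 0 <= p ->
  (forall t, 0 <= p * t ^+ 2 + 2 * q * t + r) -> q ^+ 2 <= p * r.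
Proof.
move=> p0 h; have [p_eq0|pn0] := eqVneq p 0.
  rewrite p_eq0 mul0r; have [->|qn0] := eqVneq q 0; first by rewrite expr0n.
  have := h (- (r + 1) / (2 * q)); rewrite p_eq0 mul0r add0r.
  rewrite mulrC divfK ?mulf_neq0 ?pnatr_eq0//; lra.
have := h (- q / p); have pgt0 : 0 < p by rewrite lt_def pn0.
have -> : p * (- q / p) ^+ 2 + 2 * q * (- q / p) + r = (p * r - q ^+ 2) / p.
  by field.
by rewrite pmulr_lge0 ?invr_gt0// subr_ge0.
Qed.

Lemma cauchy_schwarz x y : `|inner x y| <= `|x| * `|y|.
Proof.
rewrite -(@ler_pXn2r _ 2) ?nnegrE ?mulr_ge0// exprMn real_normK ?num_real//.
apply: discr_le0; first exact: sqr_ge0.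
move=> t; have := sqr_ge0 `|t *: x + y|.
by rewrite normD_inner normrZ exprMn real_normK ?num_real// innerZl; lra.
Qed.

Lemma finite_cauchy_schwarz (I : Type) (r : seq I) (f g : I -> R) :
  (\sum_(i <- r) f i * g i) ^+ 2 <=
  (\sum_(i <- r) f i ^+ 2) * (\sum_(i <- r) g i ^+ 2).
Proof.
apply: discr_le0; first by apply: sumr_ge0 => i _; exact: sqr_ge0.
move=> t; rewrite mulr_suml mulr_sumr mulr_suml -!big_split/=.
apply: sumr_ge0 => i _.
have -> : f i ^+ 2 * t ^+ 2 + 2 * (f i * g i) * t + g i ^+ 2 =
  (f i * t + g i) ^+ 2 by ring.
exact: sqr_ge0.
Qed.

Definition orthonormal B :=
  forall x y, B x -> B y -> inner x y = (x == y)%:R.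

(* Orthonormal basis in the Hilbert space sense (complete orthonormal         *)
(* system); [B] may be uncountable, and is finite or empty in small spaces.   *)
Definition orthonormal_basis B :=
  orthonormal B /\ forall x, (forall b, B b -> inner x b = 0) -> x = 0.

Lemma orthonormal_basis_exists : exists B, orthonormal_basis B.
Proof.
have [F FP totF|B [onB maxB]] := @Zorn_bigcup H orthonormal.
  move=> x y [X FX Xx] [Y FY Yy].
  by have [XY|YX] := totF _ _ FX FY;
    [apply: (FP Y FY) => //; exact: XY|apply: (FP X FX) => //; exact: YX].
exists B; split=> // x xB; apply: contrapT => /eqP x0.
pose e := `|x|^-1 *: x.
have e1 : inner e e = 1.
  have nx0 : `|x| != 0 by rewrite normr_eq0.
  by rewrite innerZl innerZr inner_norm; field.
have eB b : B b -> inner e b = 0 by move=> Bb; rewrite innerZl xB// mulr0.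
have eNB : ~ B e by move=> Be; have := eB _ Be; rewrite e1 => /eqP; rewrite oner_eq0.
apply: (maxB (B `|` [set e])).
  by split; [move=> y By; left|move=> /(_ e); apply/not_implyP; split=> //; right].
have neq b : B b -> (e == b) = false.
  by move=> Bb; apply/negP => /eqP eb; apply: eNB; rewrite eb.
move=> y z [By|->] [Bz|->]; first exact: onB.
- by rewrite innerC eB// eq_sym neq.
- by rewrite eB// neq.
- by rewrite e1 eqxx.
Qed.

Section expansion.
Variable B : set H.
Hypothesis onB : orthonormal B.

Lemma inner_orthonormal S (f : H -> R) b : [set` S] `<=` B -> B b ->
  inner (\sum_(i <- S) f i *: i) b = if b \in S then f b else 0.
Proof.
move=> SB Bb; rewrite inner_suml; case: ifPn => bS.
  rewrite (big_fsetD1 b)//= innerZl onB// eqxx mulr1 big_seq big1 ?addr0// => i.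
  rewrite !inE => /andP[/negbTE ib iS].
  by rewrite innerZl onB ?ib ?mulr0//; exact: SB.
rewrite big_seq big1// => i iS; rewrite innerZl onB//; last exact: SB.
by rewrite (negbTE (memPn bS _ iS)) mulr0.
Qed.

Lemma norm_orthonormal S (f : H -> R) : [set` S] `<=` B ->
  `|\sum_(i <- S) f i *: i| ^+ 2 = \sum_(i <- S) f i ^+ 2.
Proof.
move=> SB; rewrite -inner_norm inner_suml big_seq [RHS]big_seq.
apply: eq_bigr => b bS.
by rewrite innerZl innerC inner_orthonormal ?bS//; exact: SB.
Qed.

Lemma bessel S v : [set` S] `<=` B ->
  \sum_(b <- S) inner b v ^+ 2 <= `|v| ^+ 2.
Proof.
move=> SB; have := sqr_ge0 `|v - \sum_(b <- S) inner b v *: b|.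
rewrite normB_inner norm_orthonormal// innerC inner_suml.
have -> : \sum_(b <- S) inner (inner b v *: b) v = \sum_(b <- S) inner b v ^+ 2.
  by apply: eq_bigr => b _; rewrite innerZl expr2.
lra.
Qed.

End expansion.

End hilbert_theory.

Section hilbert_density.
Context {R : realType} {H : hilbertType R}.
Implicit Types (x y z u v : H) (a : R) (b : H) (B : set H) (S : {fset H}).

Definition finite_span B : set H := [set y | exists S (f : H -> R),
  [set` S] `<=` B /\ y = \sum_(b <- S) f b *: b].

Lemma finite_spanL B a u v :
  finite_span B u -> finite_span B v -> finite_span B (a *: u + v).
Proof.
move=> [S [f [SB ->]]] [S' [g [SB' ->]]].
pose f' b := if b \in S then f b else 0.
pose g' b := if b \in S' then g b else 0.
exists (S `|` S')%fset, (fun b => a * f' b + g' b); split.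
  by move=> b /=; rewrite inE => /orP[/SB|/SB'].
have -> : \sum_(b <- S) f b *: b = \sum_(b <- (S `|` S')%fset) f' b *: b.
  rewrite -(big_fset_incl _ (fsubsetUl S S'))/=; last first.
    by move=> b _ /negbTE bS; rewrite /f' bS scale0r.
  by rewrite big_seq [RHS]big_seq; apply: eq_bigr => b bS; rewrite /f' bS.
have -> : \sum_(b <- S') g b *: b = \sum_(b <- (S `|` S')%fset) g' b *: b.
  rewrite -(big_fset_incl _ (fsubsetUr S S'))/=; last first.
    by move=> b _ /negbTE bS; rewrite /g' bS scale0r.
  by rewrite big_seq [RHS]big_seq; apply: eq_bigr => b bS; rewrite /g' bS.
rewrite scaler_sumr -big_split/=; apply: eq_bigr => b _.
by rewrite scalerDl scalerA.
Qed.

Lemma finite_span0 B : finite_span B 0.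
Proof. by exists fset0, (cst 0); rewrite big_seq_fset0; split. Qed.

Lemma finite_span1 B b : B b -> finite_span B b.
Proof.
move=> Bb; exists [fset b]%fset, (cst 1); rewrite big_seq_fset1 scale1r.
by split=> // x /=; rewrite inE => /eqP ->.
Qed.

Lemma orthonormal_basis_dense B x : orthonormal_basis B ->
  exists2 y : nat -> H, (forall n, finite_span B (y n)) & y @ \oo --> x.
Proof.
move=> [onB totB].
have cvgsqr (w : nat -> R) (r : R) : w @ \oo --> r -> (fun n => w n ^+ 2) @ \oo --> r ^+ 2.
  by move=> wr; rewrite expr2; under eq_fun do rewrite expr2; exact: cvgM.
pose D : set R := [set `|x - y| ^+ 2 | y in finite_span B].
have D0 : has_inf D.
  split; first by exists (`|x - 0| ^+ 2), 0 => //; exact: finite_span0.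
  by exists 0 => _ [y _ <-]; exact: sqr_ge0.
pose d := inf D.
have dP y : finite_span B y -> d <= `|x - y| ^+ 2.
  by move=> By; apply: ge_inf; [exact: D0.2|exists y].
have /choice[y yP] n : exists y, finite_span B y /\
    `|x - y| ^+ 2 < d + n.+1%:R^-1.
  have /inf_adherent/(_ D0)[_ [y By <-] yd] : 0 < n.+1%:R^-1 :> R.
    by rewrite invr_gt0.
  by exists y.
have yB n : finite_span B (y n) by have [] := yP n.
have ydist n m : `|y n - y m| ^+ 2 <= 2 * n.+1%:R^-1 + 2 * m.+1%:R^-1.
  have := dP _ (finite_spanL (2^-1) (yB n)
    (finite_spanL (2^-1) (yB m) (finite_span0 B))).
  rewrite addr0.
  have := normB_inner (x - y m) (x - y n).
  have := normD_inner (x - y m) (x - y n).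
  have -> : x - y m - (x - y n) = y n - y m by rewrite opprB addrC addrA subrK.
  have -> : x - y m + (x - y n) =
      2 *: (x - (2^-1 *: y n + 2^-1 *: y m)).
    rewrite scalerBr scalerDr !scalerA mulfV ?pnatr_eq0// !scale1r.
    by rewrite scaler_nat mulr2n addrACA opprD (addrC (- y n)).
  rewrite normrZ exprMn real_normK ?num_real//.
  have := (yP n).2; have := (yP m).2.
  move: (n.+1%:R^-1) (m.+1%:R^-1) (inner _ _) => p q r.
  move: (`|x - y m| ^+ 2) (`|x - y n| ^+ 2) (`|x - _| ^+ 2) (`|_| ^+ 2) => *.
  lra.
have ycvg : cvg (y @ \oo).
  apply/cauchy_cvgP/cauchy_exP => e e0.
  have e2 : 0 < e ^+ 2 / 4 by rewrite divr_gt0// exprn_gt0.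
  have [N _ NP] := near_infty_natSinv_lt (PosNum e2).
  exists (y N); exists N => // n /= Nn; rewrite -ball_normE/=.
  rewrite -(@ltr_pXn2r _ 2) ?nnegrE ?(ltW e0)//.
  apply: le_lt_trans (ydist _ _) _.
  have /= := NP _ Nn; have /= := NP _ (leqnn N).
  by move: (n.+1%:R^-1) (N.+1%:R^-1) (e ^+ 2) => p r s; lra.
pose l := lim (y @ \oo); pose z := x - l.
have zd : `|z| ^+ 2 <= d.
  apply: (@ler_cvg_to _ \oo _ R (fun n => `|x - y n| ^+ 2)
      (fun n => d + n.+1%:R^-1) (`|z| ^+ 2) d).
  - by apply: cvgsqr; apply: cvg_norm; apply: cvgB => //; exact: cvg_cst.
  - by rewrite -[X in _ --> X]addr0; apply: cvgD;
      [exact: cvg_cst|exact: cvg_harmonic].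
  - by apply: nearW => n; rewrite ltW//; exact: (yP n).2.
have dz t b : B b -> d <= `|z - t *: b| ^+ 2.
  move=> Bb.
  have xy : (fun n => `|x - (t *: b + y n)|) @ \oo --> `|z - t *: b|.
    have -> : z - t *: b = x - (t *: b + l).
      by rewrite opprD addrA addrAC.
    apply: cvg_norm; apply: cvgB; first exact: cvg_cst.
    by apply: cvgD => //; exact: cvg_cst.
  move: xy => /cvgsqr/cvgr_to_ge; apply; apply: nearW => n; apply: dP.
  by apply: finite_spanL => //; exact: finite_span1.
have z0 : z = 0.
  apply: totB => b Bb; have := dz (inner z b) _ Bb.
  rewrite normB_inner normrZ innerZr exprMn real_normK ?num_real//.
  rewrite -(inner_norm b) (onB _ _ Bb Bb) eqxx mulr1 => h.
  have h2 : inner z b ^+ 2 = 0.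
    by apply/eqP; rewrite eq_le sqr_ge0 andbT; move: h zd; nra.
  by apply/eqP; rewrite -sqrf_eq0 h2.
exists y => //; have -> : x = l by apply/eqP; rewrite -subr_eq0; apply/eqP.
exact: ycvg.
Qed.

Lemma linear_fset_sum (A : H -> H) S (f : H -> R) : linear A ->
  A (\sum_(b <- S) f b *: b) = \sum_(b <- S) f b *: A b.
Proof.
move=> lA; have A0 : A 0 = 0.
  by have := lA (-1) 0 0; rewrite scaler0 add0r scaleN1r addNr.
elim/big_rec2 : _ => // b u v _ <-; exact: lA.
Qed.

Lemma orthonormal_basis_bound B (A : H -> H) (M : R) : orthonormal_basis B ->
  linear A -> continuous A -> 0 <= M ->
  (forall S, [set` S] `<=` B -> \sum_(b <- S) `|A b| ^+ 2 <= M ^+ 2) ->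
  forall x, `|A x| <= M * `|x|.
Proof.
move=> oB lA cA M0 AM x; have [y yB yx] := orthonormal_basis_dense x oB.
apply: (@ler_cvg_to _ \oo _ R (fun n => `|A (y n)|) (fun n => M * `|y n|)).
- by apply: cvg_norm; apply: continuous_cvg => //; exact: cA.
- by apply: cvgM; [exact: cvg_cst|exact: cvg_norm].
apply: nearW => n; have [S [f [SB ->]]] := yB n; rewrite linear_fset_sum//.
apply: le_trans (ler_norm_sum _ _ _) _.
rewrite -(@ler_pXn2r _ 2) ?nnegrE ?mulr_ge0 ?sumr_ge0//.
under eq_bigr do rewrite normrZ.
apply: le_trans (finite_cauchy_schwarz _ _ _) _.
rewrite exprMn (norm_orthonormal oB.1)// mulrC.
under [X in _ * X <= _]eq_bigr do rewrite real_normK ?num_real//.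
apply: ler_wpM2r; last exact: AM.
by apply: sumr_ge0 => i _; exact: sqr_ge0.
Qed.

End hilbert_density.

Section onb.
Context {R : realType}.

Definition onb (H : hilbertType R) : set H :=
  sval (cid (@orthonormal_basis_exists R H)).
Arguments onb H : clear implicits.

Lemma onbP (H : hilbertType R) : orthonormal_basis (onb H).
Proof. exact: svalP (cid _). Qed.

End onb.
Arguments onb {R} H.

Section real_esum.
Context {R : realType} {T : choiceType} (B : set T).
Implicit Types (f g : T -> R) (S : {fset T}).

Definition rsum f : R := fine (\esum_(b in B) (f b)%:E)%E.

Definition bounded_sums f :=
  exists M : R, forall S, [set` S] `<=` B -> \sum_(b <- S) f b <= M.

Lemma esum_leP f (M : R) :
  (\esum_(b in B) (f b)%:E <= M%:E)%E <->
  (forall S, [set` S] `<=` B -> \sum_(b <- S) f b <= M).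
Proof.
split=> [fM S SB|fM].
  rewrite -lee_fin; apply: le_trans fM; apply: ereal_sup_ubound.
  exists [set` S]; first by split.
  by rewrite fsbig_finite// set_fsetK sumEFin.
apply: ge_ereal_sup => _ [S [finS SB] <-].
rewrite fsbig_finite// sumEFin lee_fin; apply: fM.
by move=> b /=; rewrite in_fset_set// inE => /SB.
Qed.

Lemma bounded_sumsE f : (forall b, 0 <= f b) ->
  bounded_sums f <-> (\esum_(b in B) (f b)%:E < +oo)%E.
Proof.
move=> f0; split=> [[M /esum_leP fM]|]; first exact: le_lt_trans fM (ltry _).
move=> foo; exists (rsum f); apply: (esum_leP f _).1.
rewrite /rsum fineK// ge0_fin_numE//.
by apply: esum_ge0 => b _; rewrite lee_fin.
Qed.

Lemma rsumK f : (forall b, 0 <= f b) -> bounded_sums f ->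
  (\esum_(b in B) (f b)%:E)%E = (rsum f)%:E.
Proof.
move=> f0 /(bounded_sumsE f0) foo; rewrite /rsum fineK// ge0_fin_numE//.
by apply: esum_ge0 => b _; rewrite lee_fin.
Qed.

Lemma rsum_ge0 f : (forall b, 0 <= f b) -> 0 <= rsum f.
Proof.
by move=> f0; apply: fine_ge0; apply: esum_ge0 => b _; rewrite lee_fin.
Qed.

Lemma sum_le_rsum f S : (forall b, 0 <= f b) -> bounded_sums f ->
  [set` S] `<=` B -> \sum_(b <- S) f b <= rsum f.
Proof. by move=> f0 fb; apply: (esum_leP f _).1; rewrite rsumK. Qed.

Lemma rsum_le f M : (forall b, 0 <= f b) ->
  (forall S, [set` S] `<=` B -> \sum_(b <- S) f b <= M) -> rsum f <= M.
Proof.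
by move=> f0 fM; rewrite -lee_fin -rsumK//; [apply: (esum_leP f _).2|exists M].
Qed.

Lemma eq_rsum f g : (forall b, B b -> f b = g b) -> rsum f = rsum g.
Proof. by move=> fg; congr fine; apply: eq_esum => b /fg ->. Qed.

Lemma bounded_sumsD f g : bounded_sums f -> bounded_sums g ->
  bounded_sums (f \+ g).
Proof.
move=> [M fM] [N gN]; exists (M + N) => S SB.
by rewrite big_split/= lerD ?fM ?gN.
Qed.

Lemma bounded_sumsZ (a : R) f : 0 <= a -> bounded_sums f ->
  bounded_sums (a \*o f).
Proof.
move=> a0 [M fM]; exists (a * M) => S SB.
by rewrite -mulr_sumr ler_wpM2l ?fM.
Qed.

Lemma bounded_sums_le f g : (forall b, f b <= g b) ->
  bounded_sums g -> bounded_sums f.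
Proof.
move=> fg [M gM]; exists M => S SB; apply: le_trans (gM _ SB).
exact: ler_sum.
Qed.

Lemma rsumD f g : (forall b, 0 <= f b) -> (forall b, 0 <= g b) ->
  bounded_sums f -> bounded_sums g -> rsum (f \+ g) = rsum f + rsum g.
Proof.
move=> f0 g0 fb gb; apply: EFin_inj; rewrite EFinD -!rsumK//; last 2 first.
- by move=> b; rewrite addr_ge0.
- exact: bounded_sumsD.
under eq_esum do rewrite EFinD.
by apply: esumD => b _; rewrite lee_fin.
Qed.

Lemma rsumZ (a : R) f : 0 <= a -> (forall b, 0 <= f b) -> bounded_sums f ->
  rsum (a \*o f) = a * rsum f.
Proof.
move=> a0 f0 fb.
have le_aux r g : 0 <= r -> (forall b, 0 <= g b) -> bounded_sums g ->
    rsum (r \*o g) <= r * rsum g.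
  move=> r0 g0 gb; apply: rsum_le => [b|S SB]; first exact: mulr_ge0.
  by rewrite -mulr_sumr ler_wpM2l ?sum_le_rsum.
apply/eqP; rewrite eq_le le_aux//=; have [->|an0] := eqVneq a 0.
  by rewrite mul0r rsum_ge0// => b /=; rewrite mul0r.
have ap : 0 < a by rewrite lt_def an0.
have := le_aux a^-1 (a \*o f); rewrite invr_ge0.
have -> : rsum (a^-1 \*o (a \*o f)) = rsum f.
  by apply: eq_rsum => b _ /=; rewrite mulKf.
move=> /(_ a0); rewrite ler_pdivlMl//; apply; last exact: bounded_sumsZ.
by move=> b; exact: mulr_ge0.
Qed.

End real_esum.

Section HS.
Context {R : realType} (H : hilbertType R).
Implicit Types (A C Z : H -> H) (a : R).

(* Membership, and the inner product and norm below, do not depend on which   *)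
(* orthonormal basis [onb H] is.                                              *)
Definition hilbert_schmidt : {pred H -> H} := fun A =>
  `[< [/\ linear A, continuous A &
      (\esum_(b in onb H) (`|A b| ^+ 2)%:E < +oo)%E] >].

Let sqn A (b : H) : R := `|A b| ^+ 2.
Let sqn_ge0 A b : 0 <= sqn A b. Proof. exact: sqr_ge0. Qed.

Lemma hilbert_schmidtP A : reflect
  [/\ linear A, continuous A & bounded_sums (onb H) (fun b => `|A b| ^+ 2)]
  (A \in hilbert_schmidt).
Proof.
rewrite unfold_in /hilbert_schmidt.
apply: (iffP idP) => [/asboolP|h]; last apply/asboolP; last move: h.
all: move=> [lA cA bA]; split=> //.
- by apply/bounded_sumsE => // b; exact: sqr_ge0.
- by apply/(@bounded_sumsE _ _ _ (sqn A)).
Qed.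

Lemma normDB_le (x y : H) :
  `|x + y| ^+ 2 <= 2 * `|x| ^+ 2 + 2 * `|y| ^+ 2.
Proof.
have := sqr_ge0 `|x - y|; have := normD_inner x y; have := normB_inner x y; lra.
Qed.

Lemma hilbert_schmidt_submod_closed : submod_closed hilbert_schmidt.
Proof.
split=> [|a A C /hilbert_schmidtP[lA cA bA] /hilbert_schmidtP[lC cC bC]].
  apply/hilbert_schmidtP; split.
  - by move=> a x y /=; rewrite /GRing.zero/= /cst/= scaler0 addr0.
  - exact: cst_continuous.
  - exists 0 => S SB; rewrite big1// => b _.
    by rewrite /GRing.zero/= /cst/= normr0 expr0n.
apply/hilbert_schmidtP; split.
- move=> r x y; rewrite !fctE lA lC !scalerDr !scalerA (mulrC a r).
  by rewrite -!addrA; congr (_ + _); rewrite addrCA.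
- by move=> x; apply: continuousD; [apply: continuousZr|]; 
    [exact: cA|exact: cC].
- apply: (@bounded_sums_le _ _ _ _
    ((2 * a ^+ 2) \*o sqn A \+ 2 \*o sqn C)) => [b/=|].
    apply: le_trans (normDB_le _ _) _.
    by rewrite normrZ exprMn real_normK ?num_real// mulrA.
  by apply: bounded_sumsD; apply: bounded_sumsZ => //;
    rewrite mulr_ge0// sqr_ge0.
Qed.

HB.instance Definition _ := GRing.isSubmodClosed.Build _ _ hilbert_schmidt
  hilbert_schmidt_submod_closed.

Record HS := MkHS {
  HS_fun :> H -> H;
  HS_funP : HS_fun \in hilbert_schmidt }.

HB.instance Definition _ := [isSub for HS_fun].
HB.instance Definition _ := [Choice of HS by <:].
HB.instance Definition _ := [SubChoice_isSubLmodule of HS by <:].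

End HS.

Section HS_hilbert.
Context {R : realType} (H : hilbertType R).
Implicit Types (A C Z : HS H) (a : R) (x b : H).

Lemma HS_linear A : linear A.
Proof. by have /hilbert_schmidtP[] := HS_funP A. Qed.

Lemma HS_continuous A : continuous A.
Proof. by have /hilbert_schmidtP[] := HS_funP A. Qed.

Lemma HSD A C x : (A + C) x = A x + C x. Proof. by []. Qed.
Lemma HSN A x : (- A) x = - A x. Proof. by []. Qed.
Lemma HSZ a A x : (a *: A) x = a *: A x. Proof. by []. Qed.
Lemma HS0 x : (0 : HS H) x = 0. Proof. by []. Qed.

Lemma HS_eqP A C : A = C <-> A =1 C.
Proof. by split=> [->//|AC]; apply: val_inj; apply/funext. Qed.

(* The sum of the real numbers <A b, C b> over b in the basis; it converges   *)
(* absolutely, so it is the difference of the sums of the positive and of the *)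
(* negative parts.                                                            *)
Definition HS_inner A C : R :=
  rsum (onb H) (fun b => Num.max (inner (A b) (C b)) 0) -
  rsum (onb H) (fun b => Num.max (- inner (A b) (C b)) 0).

Definition HS_norm A : R := Num.sqrt (HS_inner A A).

Let sqn A b : R := `|A b| ^+ 2.
Let sq A := rsum (onb H) (sqn A).

Let sqn_ge0 A b : 0 <= sqn A b. Proof. exact: sqr_ge0. Qed.

Let sqn_bounded A : bounded_sums (onb H) (sqn A).
Proof. by have /hilbert_schmidtP[] := HS_funP A. Qed.

Let HS_inner_polar A C : 4 * HS_inner A C = sq (A + C) - sq (A - C).
Proof.
rewrite /HS_inner.
set p := (X in rsum _ X - _); set m := (X in _ - rsum _ X).
have p0 b : 0 <= p b by rewrite le_max lexx orbT.
have m0 b : 0 <= m b by rewrite le_max lexx orbT.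
have cs b : 4 * `|inner (A b) (C b)| <= 2 * sqn A b + 2 * sqn C b.
  have := cauchy_schwarz (A b) (C b); have := sqr_ge0 (`|A b| - `|C b|).
  rewrite /sqn; nra.
have mx (r : R) : Num.max r 0 <= `|r| by rewrite ge_max ler_norm normr_ge0.
have db : bounded_sums (onb H) (2^-1 \*o sqn A \+ 2^-1 \*o sqn C).
  by apply: bounded_sumsD; apply: bounded_sumsZ => //; rewrite invr_ge0.
have pb : bounded_sums (onb H) p.
  apply: bounded_sums_le db => b /=; apply: le_trans (mx _) _.
  by have := cs b; lra.
have mb : bounded_sums (onb H) m.
  apply: bounded_sums_le db => b /=; apply: le_trans (mx _) _.
  by rewrite normrN; have := cs b; lra.
suff : rsum (onb H) (4 \*o p \+ sqn (A - C)) =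
       rsum (onb H) (4 \*o m \+ sqn (A + C)).
  have p40 b : 0 <= (4 \*o p) b by rewrite mulr_ge0.
  have m40 b : 0 <= (4 \*o m) b by rewrite mulr_ge0.
  rewrite rsumD ?rsumZ//; last exact: bounded_sumsZ.
  rewrite rsumD ?rsumZ//; last exact: bounded_sumsZ.
  rewrite -/(sq _) -/(sq _); lra.
apply: eq_rsum => b _ /=; rewrite /sqn !HSD HSN normB_inner normD_inner /p /m.
by rewrite !maxEle; case: ifPn => ?; case: ifPn => ?; lra.
Qed.

Let sqN A : sq (- A) = sq A.
Proof. by apply: eq_rsum => b _; rewrite /sqn HSN normrN. Qed.

Let HS_innerC A C : HS_inner A C = HS_inner C A.
Proof.
by congr (_ - _); apply: eq_rsum => b _; rewrite innerC.
Qed.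

Let HS_innerNl A C : HS_inner (- A) C = - HS_inner A C.
Proof.
have := HS_inner_polar (- A) C; have := HS_inner_polar A C.
have -> : - A + C = - (A - C) by rewrite opprB addrC.
have -> : - A - C = - (A + C) by rewrite opprD.
rewrite !sqN; lra.
Qed.

Let HS_innerDl A C Z : HS_inner (A + C) Z = HS_inner A Z + HS_inner C Z.
Proof.
have := HS_inner_polar (A + C) Z; have := HS_inner_polar A Z.
have := HS_inner_polar C Z.
suff : sq (A + C + Z) + sq (A - Z) + sq (C - Z) =
       sq (A + C - Z) + sq (A + Z) + sq (C + Z) by lra.
rewrite -!rsumD//; try by [move=> b; rewrite addr_ge0 | exact: bounded_sumsD].
apply: eq_rsum => b _ /=; rewrite /sqn !HSD !HSN.
by rewrite !(normB_inner, normD_inner, innerDl); ring.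
Qed.

Let HS_innerZl a A C : HS_inner (a *: A) C = a * HS_inner A C.
Proof.
wlog a0 : a A / 0 <= a => [hw|].
  have [/hw->//|a0] := leP 0 a.
  rewrite -(opprK a) scaleNr -scalerN hw ?oppr_ge0 ?(ltW a0)//.
  by rewrite HS_innerNl mulrNN opprK.
have := HS_inner_polar (a *: A) C; have := HS_inner_polar A C.
suff : sq (a *: A + C) + a * sq (A - C) = sq (a *: A - C) + a * sq (A + C).
  by nra.
rewrite -!rsumZ// -!rsumD//; try by
  [exact: bounded_sumsZ | move=> b /=; rewrite mulr_ge0].
apply: eq_rsum => b _ /=; rewrite /sqn !HSD !HSN !HSZ.
by rewrite !(normB_inner, normD_inner, innerZl); ring.
Qed.

Let HS_innerxx A : HS_inner A A = sq A.
Proof.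
have := HS_inner_polar A A; rewrite subrr.
have -> : sq 0 = 0.
  apply/eqP; rewrite eq_le rsum_ge0// andbT; apply: rsum_le => // S _.
  by rewrite big1// => b _; rewrite /sqn HS0 normr0 expr0n.
have -> : sq (A + A) = 4 * sq A.
  rewrite -rsumZ//; apply: eq_rsum => b _ /=.
  by rewrite /sqn HSD -mulr2n -scaler_nat normrZ exprMn normr_nat -natrX.
lra.
Qed.

Let HS_inner_ge0 A : 0 <= HS_inner A A.
Proof. by rewrite HS_innerxx rsum_ge0. Qed.

Let HS_norm_sqr A : HS_norm A ^+ 2 = HS_inner A A.
Proof. by rewrite sqr_sqrtr ?HS_inner_ge0. Qed.

Let HS_norm_ge0 A : 0 <= HS_norm A. Proof. exact: sqrtr_ge0. Qed.

Lemma HS_sum_le A (S : {fset H}) : [set` S] `<=` onb H ->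
  \sum_(b <- S) `|A b| ^+ 2 <= HS_norm A ^+ 2.
Proof.
by move=> SB; rewrite HS_norm_sqr HS_innerxx; exact: (@sum_le_rsum _ _ _ (sqn A)).
Qed.

Lemma HS_norm_le A (M : R) : 0 <= M ->
  (forall S : {fset H}, [set` S] `<=` onb H ->
    \sum_(b <- S) `|A b| ^+ 2 <= M ^+ 2) ->
  HS_norm A <= M.
Proof.
move=> M0 AM; rewrite -(@ler_pXn2r _ 2) ?nnegrE// HS_norm_sqr HS_innerxx.
exact: (@rsum_le _ _ _ (sqn A)).
Qed.

Lemma HS_bound A x : `|A x| <= HS_norm A * `|x|.
Proof.
apply: (orthonormal_basis_bound (onbP H)) => //.
- exact: HS_linear.
- exact: HS_continuous.
- by move=> S; exact: HS_sum_le.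
Qed.

Let HS_cauchy_schwarz A C : HS_inner A C <= HS_norm A * HS_norm C.
Proof.
apply: le_trans (ler_norm _) _.
rewrite -(@ler_pXn2r _ 2) ?nnegrE ?mulr_ge0// real_normK ?num_real//.
rewrite exprMn !HS_norm_sqr; apply: discr_le0 => // t.
have := HS_inner_ge0 (t *: A + C); rewrite HS_innerDl !(HS_innerC _ (_ + _)).
rewrite !HS_innerDl !HS_innerZl (HS_innerC C) !(HS_innerC _ (t *: _)).
rewrite !HS_innerZl; lra.
Qed.

Let HS_normD A C : HS_norm (A + C) <= HS_norm A + HS_norm C.
Proof.
rewrite -(@ler_pXn2r _ 2) ?nnegrE ?addr_ge0// sqrrD !HS_norm_sqr.
rewrite HS_innerDl !(HS_innerC _ (_ + _)) !HS_innerDl (HS_innerC C A).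
have := HS_cauchy_schwarz A C; lra.
Qed.

Let HS_normZ a A : HS_norm (a *: A) = `|a| * HS_norm A.
Proof.
rewrite /HS_norm HS_innerZl HS_innerC HS_innerZl mulrA -expr2.
by rewrite sqrtrM ?sqr_ge0// sqrtr_sqr.
Qed.

Let HS_norm0_eq0 A : HS_norm A = 0 -> A = 0.
Proof.
move=> A0; apply/HS_eqP => x; apply/eqP; rewrite HS0 -normr_le0.
by have := HS_bound A x; rewrite A0 mul0r.
Qed.

HB.instance Definition _ := Lmodule_isNormed.Build R (HS H)
  HS_normD HS_normZ HS_norm0_eq0.

Let HS_inner_norm A : HS_inner A A = `|A| ^+ 2.
Proof. by rewrite -HS_norm_sqr. Qed.

Lemma HS_normE A : `|A| = HS_norm A. Proof. by []. Qed.

Lemma HS_complete (F : set_system (HS H)) :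
  ProperFilter F -> cauchy F -> cvg F.
Proof.
move=> FF cF.
have Fx x : cvg ((fun A : HS H => A x) @ F).
  apply/cauchy_cvgP/cauchy_exP => e e0; pose r := e / (`|x| + 1).
  have r0 : 0 < r by rewrite divr_gt0// ltr_wpDl.
  have /cauchyP/(_ _ r0)[A FA] := cF; exists (A x).
  suff h : F [set C : HS H | ball ((A : HS H) x) e (C x)] by exact: h.
  apply: filterS FA => C; rewrite -!ball_normE/= => AC.
  have -> : A x - C x = (A - C) x by [].
  apply: le_lt_trans (HS_bound _ _) _.
  apply: (@le_lt_trans _ _ (r * `|x|)).
    by apply: ler_wpM2r => //; rewrite -HS_normE ltW.
  by rewrite /r -mulrA gtr_pMr// ltr_pdivrMl ?ltr_wpDl// mulr1 ltrDl.
pose L x := lim ((fun A : HS H => A x) @ F).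
have LP x : (fun A : HS H => A x) @ F --> L x by exact: Fx.
have lL : linear L.
  move=> a x y; apply: cvg_lim => //.
  under eq_fun do rewrite HS_linear.
  by apply: cvgD; [apply: cvgZr|]; exact: LP.
have cF' e : 0 < e -> exists A : HS H, \forall C \near F, `|A - C| <= e.
  move=> e0; have /cauchyP/(_ _ e0)[A FA] := cF; exists A.
  by apply: filterS FA => C; rewrite -ball_normE/= => /ltW.
have dB A e : 0 <= e -> (\forall C \near F, `|A - C| <= e) ->
    forall x, `|A x - L x| <= e * `|x|.
  move=> e0 AC x.
  have : (fun C : HS H => `|A x - C x|) @ F --> `|A x - L x|.
    by apply: cvg_norm; apply: cvgB; [exact: cvg_cst|exact: LP].
  move=> /cvgr_to_le; apply; apply: filterS AC => C AC.
  have -> : A x - C x = (A - C) x by [].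
  by apply: le_trans (HS_bound _ _) _; apply: ler_wpM2r.
have dS A e (S : {fset H}) : 0 <= e -> (\forall C \near F, `|A - C| <= e) ->
    [set` S] `<=` onb H -> \sum_(b <- S) `|A b - L b| ^+ 2 <= e ^+ 2.
  move=> e0 AC SB.
  have : (fun C : HS H => \sum_(b <- S) `|A b - C b| ^+ 2) @ F -->
      \sum_(b <- S) `|A b - L b| ^+ 2.
    apply: cvg_big => [|b _]; first exact: add_continuous.
    have h : (fun C : HS H => `|A b - C b|) @ F --> `|A b - L b|.
      by apply: cvg_norm; apply: cvgB; [exact: cvg_cst|exact: LP].
    by rewrite expr2; under eq_fun do rewrite expr2; exact: cvgM.
  move=> /cvgr_to_le; apply; apply: filterS AC => C AC.
  apply: le_trans (HS_sum_le (A - C) SB) _.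
  by rewrite ler_pXn2r ?nnegrE.
have [A FA] := cF' 1 ltr01.
have cL : continuous (A \- L).
  pose G : H -> H := A \- L.
  have lG : linear G.
    move=> a x y; rewrite /G/= HS_linear lL scalerBr opprD addrACA.
    by [].
  pose Gl : {linear H -> H} := HB.pack G (GRing.isLinear.Build _ _ _ _ G lG).
  apply: (@bounded_linear_continuous _ _ _ Gl).
  apply/linear_boundedP; exists 1; split=> // r r1 x /=.
  apply: le_trans (dB _ _ ler01 FA x) _.
  by rewrite ler_wpM2r// ltW.
have AL : (A \- L : H -> H) \in @hilbert_schmidt R H.
  apply/hilbert_schmidtP; split=> //.
  - by move=> a x y; rewrite /= HS_linear lL scalerBr opprD addrACA.
  - by exists (1 ^+ 2) => S SB; exact: dS.
pose K : HS H := A - MkHS AL.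
have KL x : K x = L x.
  have -> : K x = A x - (A x - L x) by [].
  by rewrite opprB addrC subrK.
apply/cvg_ex; exists K; apply/cvgrPdist_le => e e0.
have e2 : 0 < e / 2 by rewrite divr_gt0.
have [C FC] := cF' _ e2.
have CK : `|C - K| <= e / 2.
  rewrite HS_normE; apply: HS_norm_le; first exact: ltW.
  move=> S SB; under eq_bigr do rewrite HSD HSN KL.
  by apply: dS => //; exact: ltW.
apply: filterS FC => D CD; rewrite (splitr e).
have -> : K - D = (C - D) - (C - K) by rewrite opprB [RHS]addrC addrA subrK.
by apply: le_trans (ler_normB _ _) _; exact: lerD.
Qed.

HB.instance Definition _ := Uniform_isComplete.Build (HS H) HS_complete.

HB.instance Definition _ := NormedModule_hasInner.Build R (HS H)
  HS_innerC HS_innerDl HS_innerZl HS_inner_norm.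

End HS_hilbert.

Section rank_one.
Context {R : realType} {H : hilbertType R}.

Lemma rank_one_subproof (u v : H) :
  (fun h => inner h v *: u) \in @hilbert_schmidt R H.
Proof.
have lA : linear (fun h => inner h v *: u).
  by move=> a x y; rewrite innerDl innerZl scalerDl scalerA.
pose Al : {linear H -> H} := HB.pack (fun h => inner h v *: u)
  (GRing.isLinear.Build _ _ _ _ (fun h => inner h v *: u) lA).
apply/hilbert_schmidtP; split=> //.
  apply: (@bounded_linear_continuous _ _ _ Al).
  apply/linear_boundedP; exists (`|u| * `|v|); split=> // r r1 x /=.
  rewrite normrZ; apply: (@le_trans _ _ (`|x| * `|v| * `|u|)).
    by rewrite ler_wpM2r// cauchy_schwarz.
  by rewrite -mulrA mulrC (mulrC `|v|) ler_wpM2r// ltW.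
exists (`|u| ^+ 2 * `|v| ^+ 2) => S SB.
under eq_bigr do rewrite normrZ exprMn real_normK ?num_real// mulrC.
by rewrite -mulr_sumr ler_wpM2l ?sqr_ge0// (bessel (onbP H).1).
Qed.

(* h |-> <h, v> u, usually written u (x) v.                                   *)
Definition rank_one (u v : H) : HS H := MkHS (rank_one_subproof u v).

End rank_one.

Section bochner.
Context {d : measure_display} {T : measurableType d} {R : realType}.
Variable P : probability T R.
Context {V : normedModType R}.
Implicit Types (f : T -> V) (s : T -> V).

Definition vsimple s :=
  finite_set (range s) /\ forall v, measurable (s @^-1` [set v]).

Definition vsimple_integral s : V :=
  \sum_(v \in range s) fine (P (s @^-1` [set v])) *: v.

Definition strongly_measurable f := exists s : nat -> T -> V,
  (forall n, vsimple (s n)) /\ {ae P, forall w, (s n w @[n --> \oo] --> f w)}.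

Definition bochner_square_integrable f :=
  strongly_measurable f /\ (\int[P]_w (`|f w| ^+ 2)%:E < +oo)%E.

Definition is_bochner_integral f (v : V) := exists s : nat -> T -> V,
  [/\ forall n, vsimple (s n),
      {ae P, forall w, (s n w @[n --> \oo] --> f w)},
      (\int[P]_w (`|f w - s n w|)%:E)%E @[n --> \oo] --> 0%E &
      vsimple_integral (s n) @[n --> \oo] --> v].

(* The Bochner integral when it exists (it is then unique), and 0 otherwise.  *)
Definition bochner_expectation f : V := xget 0 (is_bochner_integral f).

End bochner.

Definition separable (T : topologicalType) :=
  exists D : set T, countable D /\ dense D.

(* The metric is only required to exist: it is not part of the structure, and *)
(* the choice of the copy [R] of the real numbers is immaterial.              *)
Definition polish_space (R : realType) (T : topologicalType) :=
  separable T /\ exists m : T -> T -> R,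
  [/\ [/\ forall x y, m x y = 0 <-> x = y,
          forall x y, m x y = m y x &
          forall x y z, m x z <= m x y + m y z],
      forall (x : T) (U : set T),
        nbhs x U <-> exists2 e : R, 0 < e & [set y | m x y < e] `<=` U &
      forall u : nat -> T,
        (forall e : R, 0 < e -> exists N : nat,
          forall i j, (N <= i)%N -> (N <= j)%N -> m (u i) (u j) < e) ->
        exists l : T, u @ \oo --> l].

Notation borel T := (g_sigma_algebraType (@open T)).

Section processes.
Context {d d' : measure_display} {Omega : measurableType d}
  {T : measurableType d'} {R : realType}.
Variable P : probability Omega R.
Implicit Types (X : int -> Omega -> T) (F G : set (set Omega)) (n : int).

(* Equality of laws is equality on the product sigma-algebra of T^m.          *)
Definition strictly_stationary X := forall (m : nat) (t : 'I_m -> int) (s : int)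
    (B : set (m.-tuple T)), measurable B ->
  P [set w | B [tuple X (t i) w | i < m]] =
  P [set w | B [tuple X (t i + s) w | i < m]].

Definition process_sigma X (I : set int) : set (set Omega) :=
  <<s \bigcup_(t in I) preimage_set_system setT (X t) measurable >>.

Definition alpha_coef F G : R :=
  sup [set x | exists A B, [/\ F A, G B &
    x = `|fine (P (A `&` B)) - fine (P A) * fine (P B)|]].

Definition alpha_mixing X n : R :=
  if n < 1 then 4^-1 else
  sup (range (fun j : int =>
    alpha_coef (process_sigma X [set t | t <= j])
               (process_sigma X [set t | j + n <= t]))).

End processes.

Section eigenvalues.
Context {R : realType} {V : lmodType R}.

Definition op_eigenspace (A : V -> V) (mu : R) : set V := [set x | A x = mu *: x].

Definition has_dimension (W : set V) (m : nat) := exists e : 'I_m -> V,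
  W = [set x | exists a : 'I_m -> R, x = \sum_i a i *: e i] /\
  forall a : 'I_m -> R, \sum_i a i *: e i = 0 -> forall i, a i = 0.

(* Every nonzero [mu] occurs in [lam] as often as the dimension of its        *)
(* eigenspace; so a [lam] with finitely many nonzero terms is padded with     *)
(* zeros. The numbering starts at 0: [lam j] is the (j + 1)-st eigenvalue.    *)
Definition ordered_eigenvalues (A : V -> V) (lam : nat -> R) :=
  [/\ forall j, 0 <= lam j,
      forall i j, (i <= j)%N -> lam j <= lam i &
      forall mu, mu != 0 -> exists m, has_dimension (op_eigenspace A mu) m /\
        ([set j | lam j = mu] #= `I_m)%card].

End eigenvalues.

(* A reproducing kernel Hilbert space of functions on [E]: the elements are   *)
(* identified with functions through the linear injection [rkhs_eval], and    *)
(* [rkhs_feature x] is the element whose function is [k(x, .)].               *)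
Record rkhs (R : realType) (E : Type) := RKHS {
  rkhs_space :> hilbertType R;
  rkhs_eval : rkhs_space -> E -> R;
  rkhs_kernel : E -> E -> R;
  rkhs_feature : E -> rkhs_space;
  rkhs_eval_linear : forall a f g x,
    rkhs_eval (a *: f + g) x = a * rkhs_eval f x + rkhs_eval g x;
  rkhs_eval_inj : injective rkhs_eval;
  rkhs_eval_feature : forall x, rkhs_eval (rkhs_feature x) = rkhs_kernel x;
  rkhs_reproducing : forall f x, rkhs_eval f x = inner f (rkhs_feature x) }.

Section autocovariance.
Context {d : measure_display} {Omega : measurableType d} {R : realType}.
Variable P : probability Omega R.
Context {E : Type} (H : rkhs R E).
Implicit Types (X : int -> Omega -> E) (eta n : nat).

Definition lagged_product X eta (t : int) (w : Omega) : HS H :=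
  rank_one (rkhs_feature H (X (t + eta%:Z) w)) (rkhs_feature H (X t w)).

Definition autocovariance X eta : HS H :=
  bochner_expectation P (lagged_product X eta 0).

Definition empirical_autocovariance X eta n (w : Omega) : HS H :=
  n%:R^-1 *: \sum_(1 <= t < n.+1) lagged_product X eta t%:Z w.

Definition covariance_operator X eta : HS (HS H) :=
  bochner_expectation P (fun w =>
    rank_one (lagged_product X eta 0 w - autocovariance X eta)
             (lagged_product X eta 0 w - autocovariance X eta)).

End autocovariance.

(* Main.v *)
Require Import Defs.
From HB Require Import structures.
From mathcomp Require Import all_boot all_order all_algebra finmap.
From mathcomp Require Import all_classical all_reals all_analysis.
From mathcomp Require Import measurable_realfun zify ring lra.

(** Let [Z t] be the lagged product at time [t] minus its mean, an element of
    the Hilbert space of Hilbert-Schmidt operators, and let [e 0], [e 1], and so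
    on be orthonormal eigenvectors of the covariance operator of [Z 0], in the
    order of the eigenvalues. The deviation of the empirical autocovariance is
    the average of [Z 1], ..., [Z n]; its squared norm is the sum of the squares
    of its first [nu] coordinates and of the squared norm of its residual. If it
    exceeds [eps ^ 2], then either a coordinate exceeds
    [eps * sqrt ((1 - delta) / nu)] in absolute value or the squared norm of the
    residual exceeds [delta * eps ^ 2].

    A coordinate of [Z] is a centered real sequence bounded by [2 * c] whose
    mixing coefficients are those of the process at a lag shortened by [eta], so
    [bosq_inequality] and a union bound yield the first two terms. The third one
    is Markov's inequality ([residual_average_deviation]): by convexity and
    stationarity the mean square of the residual of the average is at most that
    of the residual of [Z 0], and the latter is at most the sum of the remaining
    eigenvalues ([residual_le_eigenvalues]).

    Bosq's inequality cuts the sum into [2 q] blocks and treats the even and the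
    odd ones separately, so that consecutive blocks are far apart in time. The
    usual proof makes the blocks independent by means of Bradley's coupling
    lemma. Here the blocks are first replaced by their conditional means on a
    grid with at most [1 + 4 b / eps] cells; the resulting finitely valued
    variables are made independent one at a time, at a cost equal to the total
    variation between a joint law and a product law ([past_mean_step]). By
    Khinchine's inequality this total variation is at most a constant times
    the mixing coefficient times the square root of the number of cells
    ([sum_norm_le_rectangles]), which is where the square root in the second
    term of the bound comes from. Hoeffding's inequality concludes
    ([mixing_deviation]).

    That the residuals are controlled by the remaining eigenvalues says that the
    eigenvectors exhaust the range of the covariance operator. Subtracting from
    that operator its part along the first [N] eigenvectors leaves a positive
    Hilbert-Schmidt operator, and the norm of such an operator, if not zero, is
    an eigenvalue; this is proved by power iteration in the space of
    Hilbert-Schmidt operators ([top_eigenvalue]). That eigenvalue is at most the [N]-th one, counted from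
    zero ([inner_residual_le]), so these norms vanish in the limit when the
    eigenvalues are summable, and then the mean square of the residual of a
    simple approximation of [Z 0] vanishes as well ([trace_le_eigenvalues]). *)

Set Implicit Arguments.
Unset Strict Implicit.
Unset Printing Implicit Defensive.

Import Order.TTheory GRing.Theory Num.Theory.
Import numFieldNormedType.Exports.

Local Open Scope classical_set_scope.
Local Open Scope ring_scope.

(** * Random signs and rectangle sums of a matrix *)

Section sign_averages.
Context {R : realType}.
Implicit Types (n : nat) (f g : seq bool -> R) (m : nat -> R) (a : R).

(** The mean over all lists of [n] signs, taken one sign at a time so that
    moments can be computed by induction. *)
Fixpoint sign_avg n f : R :=
  if n is n'.+1 then
    (sign_avg n' (fun y => f (false :: y)) +
     sign_avg n' (fun y => f (true :: y))) / 2
  else f [::].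

Definition signed_sum n m (y : seq bool) : R :=
  \sum_(j < n) (-1) ^+ nth false y j * m j.

Lemma sign_avg_le n f g : (forall y, f y <= g y) -> sign_avg n f <= sign_avg n g.
Proof.
elim: n f g => [|n ih] f g fg //=.
by rewrite ler_pM2r ?invr_gt0// lerD// ih.
Qed.

Lemma sign_avg_cst n a : sign_avg n (fun=> a) = a.
Proof. by elim: n => //= n ->; lra. Qed.

Lemma sign_avgD n f g :
  sign_avg n (fun y => f y + g y) = sign_avg n f + sign_avg n g.
Proof. by elim: n f g => //= n ih f g; rewrite !ih; lra. Qed.

Lemma sign_avgZ n a f : sign_avg n (fun y => a * f y) = a * sign_avg n f.
Proof. by elim: n f => //= n ih f; rewrite !ih; lra. Qed.

Lemma sign_avg_sum n (I : Type) (r : seq I) (F : I -> seq bool -> R) :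
  sign_avg n (fun y => \sum_(i <- r) F i y) = \sum_(i <- r) sign_avg n (F i).
Proof.
elim: r => [|i r ih].
  under [in LHS]eq_fun do rewrite big_nil.
  by rewrite sign_avg_cst big_nil.
under [in LHS]eq_fun do rewrite big_cons.
by rewrite sign_avgD ih big_cons.
Qed.

Lemma signed_sum_cons n m b y :
  signed_sum n.+1 m (b :: y) =
  (-1) ^+ b * m 0 + signed_sum n (fun j => m j.+1) y.
Proof. by rewrite /signed_sum big_ord_recl. Qed.

Lemma sign_avg_sqr n m a :
  sign_avg n (fun y => (a + signed_sum n m y) ^+ 2) =
  a ^+ 2 + \sum_(j < n) m j ^+ 2.
Proof.
elim: n m a => [|n ih] m a /=; first by rewrite /signed_sum !big_ord0 !addr0.
have shift b : (fun y => (a + signed_sum n.+1 m (b :: y)) ^+ 2) = (fun y =>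
    (a + (-1) ^+ b * m 0 + signed_sum n (fun j => m j.+1) y) ^+ 2).
  by apply/funext => y; rewrite signed_sum_cons addrA.
by rewrite !shift !ih big_ord_recl/= expr0 expr1; lra.
Qed.

(** Averaging over one sign cancels the odd powers of its term; the constants 6
    and 3 are those of a Gaussian variable with mean [a]. *)
Lemma sign_avg_pow4 n m a :
  sign_avg n (fun y => (a + signed_sum n m y) ^+ 4) <=
  a ^+ 4 + 6 * a ^+ 2 * (\sum_(j < n) m j ^+ 2)
    + 3 * (\sum_(j < n) m j ^+ 2) ^+ 2.
Proof.
elim: n m a => [|n ih] m a /=.
  by rewrite /signed_sum !big_ord0 addr0; lra.
have shift b : (fun y => (a + signed_sum n.+1 m (b :: y)) ^+ 4) = (fun y =>
    (a + (-1) ^+ b * m 0 + signed_sum n (fun j => m j.+1) y) ^+ 4).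
  by apply/funext => y; rewrite signed_sum_cons addrA.
rewrite !shift.
have h1 := ih (fun j => m j.+1) (a + (-1) ^+ false * m 0).
have h2 := ih (fun j => m j.+1) (a + (-1) ^+ true * m 0).
rewrite big_ord_recl/=.
move: h1 h2; rewrite /= expr0 expr1.
move: (sign_avg _ _) (sign_avg _ _) => u v.
set s := \sum_(i < n) _; set m0 := m 0.
have : 0 <= (m0 ^+ 2) ^+ 2 by exact: sqr_ge0.
rewrite ler_pdivrMr//; nra.
Qed.

(** Khinchine's inequality with the constant 5/9: the tangent bound
    [t >= t^2 - (4/27) t^4] turns it into a comparison of the second and the
    fourth moment of a sum of random signs. *)
Lemma khinchine n m :
  5 / 9 * Num.sqrt (\sum_(j < n) m j ^+ 2) <=
  sign_avg n (fun y => `|signed_sum n m y|).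
Proof.
set v := \sum_(j < n) _.
have v0 : 0 <= v by apply: sumr_ge0 => i _; exact: sqr_ge0.
have sv : Num.sqrt v ^+ 2 = v by rewrite sqr_sqrtr.
have := sqrtr_ge0 v; rewrite le_eqVlt => /orP[/eqP <-|s0].
  rewrite mulr0; apply: le_trans (sign_avg_le _ (f := fun=> 0) _) => [|y//].
  by rewrite sign_avg_cst.
set s := Num.sqrt v in sv s0 *.
have tangent (x : R) : s^-1 * x ^+ 2 + - (4 / 27 * s^-1 ^+ 3) * x ^+ 4 <= `|x|.
  have [t t0 xE] : exists2 t, 0 <= t & `|x| = t * s.
    by exists (`|x| / s); [rewrite divr_ge0// ltW|rewrite divfK ?gt_eqF].
  have x2 : x ^+ 2 = t ^+ 2 * s ^+ 2 by rewrite -exprMn -xE real_normK ?num_real.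
  have -> : x ^+ 4 = (x ^+ 2) ^+ 2 by rewrite -exprM.
  rewrite x2 xE.
  have -> : s^-1 * (t ^+ 2 * s ^+ 2) +
      - (4 / 27 * s^-1 ^+ 3) * (t ^+ 2 * s ^+ 2) ^+ 2 =
      (t ^+ 2 - 4 / 27 * t ^+ 4) * s by field; rewrite gt_eqF.
  rewrite ler_pM2r//.
  have : 0 <= t * ((t - 3 / 2) ^+ 2 * (t + 3)).
    by rewrite mulr_ge0// mulr_ge0 ?sqr_ge0//; lra.
  nra.
apply: le_trans (sign_avg_le _ (fun y => tangent (signed_sum n m y))).
rewrite sign_avgD !sign_avgZ.
have := sign_avg_sqr n m 0; have := sign_avg_pow4 n m 0.
under eq_fun do rewrite add0r; under [in X in _ -> X]eq_fun do rewrite add0r.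
rewrite !expr0n/= mulr0 mul0r !add0r -/v => h4 ->; rewrite -sv in h4 *.
set x4 := sign_avg _ _ in h4 *.
have -> : s^-1 * s ^+ 2 = s by rewrite expr2 mulKf ?gt_eqF.
have : s^-1 ^+ 3 * x4 <= 3 * s.
  have -> : 3 * s = s^-1 ^+ 3 * (3 * (s ^+ 2) ^+ 2) by field; rewrite gt_eqF.
  by apply: ler_wpM2l => //; rewrite exprn_ge0// invr_ge0 ltW.
nra.
Qed.

(** Choosing the signs of the columns at random and then those of the rows
    optimally bounds the entrywise norm of a matrix by its rectangle sums; by
    Khinchine's inequality the loss is only the square root of the number of
    columns. *)
Lemma sum_norm_le_rectangles (I : finType) (N : nat) (M : I -> 'I_N -> R) a :
  (forall (U : {set I}) (Y : {set 'I_N}),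
    `|\sum_(i in U) \sum_(j in Y) M i j| <= a) ->
  \sum_i \sum_j `|M i j| <= 36 / 5 * Num.sqrt N%:R * a.
Proof.
move=> Ma.
pose m i k := if insub k is Some j then M i j else 0.
have mE i (j : 'I_N) : m i j = M i j by rewrite /m valK.
have row i : \sum_j `|M i j| <=
    9 / 5 * Num.sqrt N%:R * sign_avg N (fun y => `|signed_sum N (m i) y|).
  have s0 : 0 <= \sum_(j < N) m i j ^+ 2 by apply: sumr_ge0 => j _; exact: sqr_ge0.
  apply: (@le_trans _ _ (Num.sqrt N%:R * Num.sqrt (\sum_(j < N) m i j ^+ 2))).
    rewrite -sqrtrM ?ler0n// -(@ler_pXn2r _ 2) ?nnegrE ?sqrtr_ge0 ?sumr_ge0//.
    rewrite sqr_sqrtr ?mulr_ge0 ?ler0n//.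
    have := finite_cauchy_schwarz (index_enum 'I_N) (fun=> 1) (fun j => `|M i j|).
    under eq_bigr do rewrite mul1r.
    under [X in _ <= X * _ -> _]eq_bigr do rewrite expr1n.
    rewrite sumr_const card_ord; congr (_ <= _ * _).
    by apply: eq_bigr => j _; rewrite mE real_normK ?num_real.
  have := khinchine N (m i); have := sqrtr_ge0 (N%:R : R).
  set k := sign_avg _ _; set sN := Num.sqrt N%:R; set sm := Num.sqrt _.
  move=> sN0 h; have -> : 9 / 5 * sN * k = sN * (9 / 5 * k) by ring.
  by rewrite ler_wpM2l//; lra.
apply: le_trans (ler_sum _ (fun i _ => row i)) _.
rewrite -mulr_sumr -sign_avg_sum.
have -> : 36 / 5 * Num.sqrt N%:R * a = 9 / 5 * Num.sqrt N%:R * (4 * a) by lra.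
rewrite ler_wpM2l ?mulr_ge0 ?sqrtr_ge0//.
rewrite -[leRHS](sign_avg_cst N); apply: sign_avg_le => y.
pose Yp := [set j : 'I_N | ~~ nth false y j]%SET; pose Ym := [set j : 'I_N | nth false y j]%SET.
pose Up := [set i : I | 0 <= signed_sum N (m i) y]%SET.
pose Um := [set i : I | ~~ (0 <= signed_sum N (m i) y)]%SET.
have rowE i : signed_sum N (m i) y = \sum_(j in Yp) M i j - \sum_(j in Ym) M i j.
  rewrite /signed_sum (bigID (mem Yp))/= -sumrN; congr (_ + _).
    by apply: eq_bigr => j; rewrite inE => /negbTE ->; rewrite mul1r mE.
  apply: eq_big => [j|j]; first by rewrite !inE negbK.
  by rewrite inE negbK => ->; rewrite expr1 mulN1r mE.
rewrite (bigID (mem Up))/=.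
have -> : \sum_(i in Up) `|signed_sum N (m i) y| =
    \sum_(i in Up) \sum_(j in Yp) M i j - \sum_(i in Up) \sum_(j in Ym) M i j.
  rewrite -sumrB; apply: eq_bigr => i; rewrite inE => h.
  by rewrite ger0_norm// rowE.
have -> : \sum_(i | i \notin Up) `|signed_sum N (m i) y| =
    \sum_(i in Um) \sum_(j in Ym) M i j - \sum_(i in Um) \sum_(j in Yp) M i j.
  rewrite -sumrB; apply: eq_big => [i|i]; first by rewrite !inE.
  rewrite inE -ltNge => h.
  by rewrite ltr0_norm// rowE opprB.
have := Ma Up Yp; have := Ma Up Ym; have := Ma Um Yp; have := Ma Um Ym.
by rewrite !ler_norml => /andP[? ?] /andP[? ?] /andP[? ?] /andP[? ?]; lra.
Qed.

End sign_averages.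

(** * Bounded random variables *)

Section bounded_random_variables.
Context {d : measure_display} {T : measurableType d} {R : realType}.
Implicit Types (f g : T -> R) (a : R) (A : set T).

Definition bounded_rv f :=
  measurable_fun setT f /\ exists M : R, forall w, `|f w| <= M.

Lemma bounded_rv_cst a : bounded_rv (fun=> a).
Proof. by split; [exact: measurable_cst|exists `|a|]. Qed.

Lemma bounded_rvD f g :
  bounded_rv f -> bounded_rv g -> bounded_rv (fun w => f w + g w).
Proof.
move=> [mf [M fM]] [mg [N gN]]; split; first exact: measurable_funD.
by exists (M + N) => w; rewrite (le_trans (ler_normD _ _))// lerD.
Qed.

Lemma bounded_rvM f g :
  bounded_rv f -> bounded_rv g -> bounded_rv (fun w => f w * g w).
Proof.
move=> [mf [M fM]] [mg [N gN]]; split; first exact: measurable_funM.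
by exists (M * N) => w; rewrite normrM ler_pM.
Qed.

Lemma bounded_rvZ a f : bounded_rv f -> bounded_rv (fun w => a * f w).
Proof. exact/bounded_rvM/bounded_rv_cst. Qed.

Lemma bounded_rvB f g :
  bounded_rv f -> bounded_rv g -> bounded_rv (fun w => f w - g w).
Proof.
move=> bf bg; under eq_fun do rewrite -mulN1r.
by apply: bounded_rvD => //; exact: bounded_rvZ.
Qed.

Lemma bounded_rv_norm f : bounded_rv f -> bounded_rv (fun w => `|f w|).
Proof.
move=> [mf [M fM]]; split; first exact: measurableT_comp.
by exists M => w; rewrite normr_id.
Qed.

Lemma bounded_rvX f n : bounded_rv f -> bounded_rv (fun w => f w ^+ n).
Proof.
move=> bf; elim: n => [|n ih].
  by under eq_fun do rewrite expr0; exact: bounded_rv_cst.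
by under eq_fun do rewrite exprS; exact: bounded_rvM.
Qed.

Lemma bounded_rv_sum (I : Type) (r : seq I) (F : I -> T -> R) :
  (forall i, bounded_rv (F i)) -> bounded_rv (fun w => \sum_(i <- r) F i w).
Proof.
move=> bF; elim: r => [|i r ih].
  by under eq_fun do rewrite big_nil; exact: bounded_rv_cst.
by under eq_fun do rewrite big_cons; exact: bounded_rvD.
Qed.

Lemma bounded_rv_indic A : measurable A -> bounded_rv (\1_A : T -> R).
Proof.
move=> mA; split; first exact: measurable_indic.
by exists 1 => w; rewrite indicE; case: (_ \in _); rewrite ?normr0 ?normr1.
Qed.

Variable P : probability T R.

Definition prob A : R := fine (P A).

Lemma probE A : measurable A -> P A = (prob A)%:E.
Proof.
move=> mA; rewrite /prob fineK// ge0_fin_numE//.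
by rewrite (le_lt_trans (probability_le1 P mA)) ?ltry.
Qed.

Lemma prob_ge0 A : 0 <= prob A.
Proof. exact: fine_ge0. Qed.

Lemma prob_le1 A : measurable A -> prob A <= 1.
Proof. by move=> mA; rewrite -lee_fin -probE ?probability_le1. Qed.

Lemma le_prob A C : measurable A -> measurable C -> A `<=` C -> prob A <= prob C.
Proof. by move=> mA mC AC; rewrite -lee_fin -!probE// le_measure// inE. Qed.

Lemma probU_le A C : measurable A -> measurable C ->
  prob (A `|` C) <= prob A + prob C.
Proof.
move=> mA mC; rewrite -lee_fin EFinD -!probE//; last exact: measurableU.
exact: measureU2.
Qed.

Lemma bounded_rv_integrable f : bounded_rv f -> P.-integrable setT (EFin \o f).
Proof.
move=> [mf [M fM]]; apply: measurable_bounded_integrable => //.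
  by rewrite (le_lt_trans (probability_le1 P _)) ?ltry.
exists M; split; first exact: num_real.
by move=> r Mr w _; exact: le_trans (fM w) (ltW Mr).
Qed.

Lemma meanD f g : bounded_rv f -> bounded_rv g ->
  \int[P]_w (f w + g w) = \int[P]_w f w + \int[P]_w g w.
Proof. by move=> bf bg; rewrite RintegralD//; exact: bounded_rv_integrable. Qed.

Lemma meanB f g : bounded_rv f -> bounded_rv g ->
  \int[P]_w (f w - g w) = \int[P]_w f w - \int[P]_w g w.
Proof. by move=> bf bg; rewrite RintegralB//; exact: bounded_rv_integrable. Qed.

Lemma meanZ a f : bounded_rv f -> \int[P]_w (a * f w) = a * \int[P]_w f w.
Proof. by move=> bf; rewrite RintegralZl//; exact: bounded_rv_integrable. Qed.

Lemma mean_cst a : \int[P]_w (fun=> a) w = a.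
Proof.
have P1 : fine (P setT) = 1 by rewrite probability_setT.
by rewrite Rintegral_cst// P1 mulr1.
Qed.

Lemma mean_le f g : bounded_rv f -> bounded_rv g -> (forall w, f w <= g w) ->
  \int[P]_w f w <= \int[P]_w g w.
Proof.
by move=> bf bg fg; apply: le_Rintegral => //; exact: bounded_rv_integrable.
Qed.

Lemma norm_mean_le f : bounded_rv f ->
  `|\int[P]_w f w| <= \int[P]_w `|f w|.
Proof. by move=> bf; apply: le_normr_Rintegral => //; exact: bounded_rv_integrable. Qed.

Lemma mean_sum (I : Type) (r : seq I) (F : I -> T -> R) :
  (forall i, bounded_rv (F i)) ->
  \int[P]_w (\sum_(i <- r) F i w) = \sum_(i <- r) \int[P]_w F i w.
Proof.
move=> bF; elim: r => [|i r ih].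
  by rewrite big_nil; under eq_Rintegral do rewrite big_nil; exact: mean_cst.
rewrite big_cons -ih -meanD//; last exact: bounded_rv_sum.
by apply: eq_Rintegral => w _; rewrite big_cons.
Qed.

Lemma mean_indic A : measurable A -> \int[P]_w (\1_A w) = prob A.
Proof. by move=> mA; rewrite /Rintegral integral_indic// setIT. Qed.

Lemma ge0_meanE f : bounded_rv f -> (forall w, 0 <= f w) ->
  (\int[P]_w (f w)%:E)%E = (\int[P]_w f w)%:E.
Proof.
move=> bf f0; rewrite /Rintegral fineK//.
exact/integrable_fin_num/bounded_rv_integrable.
Qed.

Section finite_valued.
Context {I : finType} {Y : T -> I}.
Hypothesis mY : forall i, measurable (Y @^-1` [set i]).

Lemma measurable_finite_valued (U : pred I) : measurable [set w | U (Y w)].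
Proof.
have -> : [set w | U (Y w)] = \big[setU/set0]_(i | U i) (Y @^-1` [set i]).
  apply/seteqP; split => [w Uw|w].
    by rewrite (bigD1 (Y w))//; left.
  by rewrite -bigcup_seq_cond => -[i /= /andP[_ Ui] ->].
exact: bigsetU_measurable.
Qed.

Lemma prob_finite_valued (A : set T) (U : pred I) : measurable A ->
  prob (A `&` [set w | U (Y w)]) =
  \sum_(i | U i) prob (A `&` (Y @^-1` [set i])).
Proof.
move=> mA; have mU := measurable_finite_valued U.
rewrite -mean_indic; last exact: measurableI.
rewrite [LHS](_ : _ = \int[P]_w
    (\sum_(i <- enum U) \1_(A `&` (Y @^-1` [set i])) w)).
  rewrite mean_sum; last by move=> i; exact/bounded_rv_indic/measurableI.
  rewrite big_enum_cond/=; apply: eq_big => [i|i _]; first by rewrite andbT.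
  by rewrite mean_indic//; exact: measurableI.
apply: eq_Rintegral => w _; rewrite !indicE in_setI.
have [Aw|Aw] := boolP (w \in A); last first.
  by rewrite /= big1// => i _; rewrite indicE in_setI (negbTE Aw).
have UE : (w \in [set w | U (Y w)]) = U (Y w).
  by apply/idP/idP; rewrite inE.
have iE i : \1_(A `&` (Y @^-1` [set i])) w = (Y w == i)%:R :> R.
  rewrite indicE in_setI Aw/=; congr (_%:R); congr nat_of_bool.
  by apply/idP/eqP; rewrite inE.
rewrite /= UE; under eq_bigr do rewrite iE.
rewrite big_enum_cond/=; have [Uw|Uw] := boolP (U (Y w)).
  rewrite (bigD1 (Y w)) ?andbT//= eqxx big1 ?addr0// => i /andP[_].
  by rewrite eq_sym => /negbTE ->.
rewrite big1// => i /andP[Ui _]; case: eqP => // Yi.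
by case/negP: Uw; rewrite Yi; exact: Ui.
Qed.

End finite_valued.

End bounded_random_variables.

(** * Decoupling finitely valued variables *)

Section past_values.
Context {T : Type} {N : nat}.
Variable x : nat -> T -> 'I_N.

(** The most recent value comes first, so that time is the index of the
    recursion. *)
Fixpoint past k (w : T) : k.-tuple 'I_N :=
  if k is k'.+1 then [tuple of x k' w :: past k' w] else [tuple].

Lemma past_cons k i (s : k.-tuple 'I_N) :
  past k.+1 @^-1` [set [tuple of i :: s]] =
  (past k @^-1` [set s]) `&` (x k @^-1` [set i]).
Proof.
apply/seteqP; split => [w /= /(congr1 val)/= [-> e]|w [/= -> ->]//].
by split=> //=; exact: val_inj.
Qed.

End past_values.

Lemma measurable_past (d : measure_display) (T : measurableType d) (N : nat)
    (x : nat -> T -> 'I_N) k s :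
  (forall j i, (j < k)%N -> measurable (x j @^-1` [set i])) ->
  measurable (past x k @^-1` [set s]).
Proof.
elim: k s => [|k ih] s mx.
  rewrite [X in measurable X](_ : _ = setT)//.
  by apply/seteqP; split => // w _ /=; rewrite [RHS]tuple0.
rewrite (tuple_eta s) past_cons; apply: measurableI; last exact: mx.
by apply: ih => j i jk; apply: mx; exact: ltnW.
Qed.

Section decoupling.
Context {d : measure_display} {T : measurableType d} {R : realType}.
Variables (P : probability T R) (N : nat) (x : nat -> T -> 'I_N).
Implicit Types (k : nat) (g : seq 'I_N -> R).

Hypothesis mx : forall k i, measurable (x k @^-1` [set i]).

Let measurable_past_x k s : measurable (past x k @^-1` [set s]).
Proof. by apply: measurable_past => j i _; exact: mx. Qed.

(** The mean of [g] over independent values with the laws of [x 0], ...,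
    [x (k - 1)], where the most recent value is integrated out first. *)
Fixpoint indep_mean k g : R :=
  if k is k'.+1 then
    indep_mean k' (fun s => \sum_i prob P (x k' @^-1` [set i]) * g (i :: s))
  else g [::].

Definition past_mean k g : R :=
  \sum_(s : k.-tuple 'I_N) prob P (past x k @^-1` [set s]) * g s.

Lemma sum_prob_cell k : \sum_i prob P (x k @^-1` [set i]) = 1.
Proof.
have := prob_finite_valued P (mx k) xpredT measurableT.
rewrite (_ : [set w | _] = setT); last by apply/seteqP.
rewrite setTI {1}/prob probability_setT => /= ->.
by apply: eq_bigr => i _; rewrite setTI.
Qed.

Variable a : R.

(** Replacing the last of [k + 1] dependent values by an independent copy
    changes the mean of a function with values in the unit interval by at most
    the total variation between a joint law and a product law, which the
    rectangle sums control. *)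
Lemma past_mean_step k g :
  (forall s, 0 <= g s <= 1) ->
  (forall (U : {set k.-tuple 'I_N}) (Y : {set 'I_N}),
    `|prob P ([set w | past x k w \in U] `&` [set w | x k w \in Y]) -
      prob P [set w | past x k w \in U] * prob P [set w | x k w \in Y]| <= a) ->
  past_mean k.+1 g <=
  past_mean k (fun s => \sum_i prob P (x k @^-1` [set i]) * g (i :: s)) +
  36 / 5 * Num.sqrt N%:R * a.
Proof.
move=> g01 mixing.
pose M (s : k.-tuple 'I_N) i :=
  prob P ((past x k @^-1` [set s]) `&` (x k @^-1` [set i])) -
  prob P (past x k @^-1` [set s]) * prob P (x k @^-1` [set i]).
rewrite -lerBlDl.
have -> : past_mean k.+1 g = \sum_(s : k.-tuple 'I_N) \sum_i
    prob P ((past x k @^-1` [set s]) `&` (x k @^-1` [set i])) * g (i :: s).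
  rewrite /past_mean pair_big/=.
  rewrite (reindex (fun p : k.-tuple 'I_N * 'I_N => [tuple of p.2 :: p.1]))/=.
    by apply: eq_bigr => -[s i] _ /=; rewrite past_cons.
  exists (fun s : k.+1.-tuple 'I_N => ([tuple of behead s], thead s)).
    by move=> [s i] _ /=; congr pair; apply: val_inj.
  by move=> s _ /=; rewrite -tuple_eta.
rewrite /past_mean -sumrB.
apply: le_trans (sum_norm_le_rectangles (M := M) _) => [|U Y].
  apply: ler_sum => s _; rewrite mulr_sumr -sumrB; apply: ler_sum => i _.
  rewrite mulrA -mulrBl -/(M s i).
  apply: le_trans (ler_norm _) _; rewrite normrM.
  by have /andP[g0 g1] := g01 (i :: s); rewrite (ger0_norm g0) ler_piMr.
rewrite -[X in `|X| <= _](_ : prob P ([set w | past x k w \in U] `&`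
    [set w | x k w \in Y]) - prob P [set w | past x k w \in U] *
    prob P [set w | x k w \in Y] = _); first exact: mixing.
have mp := @measurable_past_x k.
have mU := measurable_finite_valued mp (mem U).
have mY := measurable_finite_valued (mx k) (mem Y).
rewrite [X in prob P X - _](_ : _ = [set w | x k w \in Y] `&` [set w | past x k w \in U]);
  last by rewrite setIC.
rewrite (prob_finite_valued P mp (mem U))//.
have := prob_finite_valued P mp (mem U) measurableT; rewrite setTI => ->.
have := prob_finite_valued P (mx k) (mem Y) measurableT; rewrite setTI => ->.
rewrite mulr_suml -sumrB; apply: eq_bigr => s _.
rewrite setIC (prob_finite_valued P (mx k) (mem Y))// mulr_sumr -sumrB.
by apply: eq_bigr => i _; rewrite /M !setTI.
Qed.

Lemma past_mean_le q g :
  (forall s, 0 <= g s <= 1) ->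
  (forall k, (k < q)%N -> forall (U : {set k.-tuple 'I_N}) (Y : {set 'I_N}),
    `|prob P ([set w | past x k w \in U] `&` [set w | x k w \in Y]) -
      prob P [set w | past x k w \in U] * prob P [set w | x k w \in Y]| <= a) ->
  past_mean q g <= indep_mean q g + q%:R * (36 / 5 * Num.sqrt N%:R * a).
Proof.
elim: q g => [|k ih] g g01 mixing.
  rewrite mul0r addr0 /past_mean (eq_bigl (pred1 [tuple])); last first.
    by move=> s; rewrite /= [s]tuple0; apply/esym/eqP.
  rewrite big_pred1_eq (_ : _ @^-1` _ = setT); last by apply/seteqP.
  by rewrite /prob probability_setT mul1r.
apply: le_trans (past_mean_step g01 (mixing k (ltnSn k))) _.
set b := 36 / 5 * _ * a in ih *.
rewrite -[k.+1%:R]natr1 mulrDl mul1r addrA lerD2r /=.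
apply: ih => [s|j jk]; last by apply: mixing; exact: ltnW.
apply/andP; split.
  by apply: sumr_ge0 => i _; rewrite mulr_ge0 ?prob_ge0//; case/andP: (g01 (i :: s)).
rewrite -(sum_prob_cell k); apply: ler_sum => i _.
by rewrite ler_piMr ?prob_ge0//; case/andP: (g01 (i :: s)).
Qed.

Lemma past_mean_indicator q (g : seq 'I_N -> bool) :
  past_mean q (fun s => (g s)%:R) = prob P [set w | g (past x q w)].
Proof.
have mp := @measurable_past_x q.
have := prob_finite_valued P mp (fun s => g (val s)) measurableT.
rewrite setTI => ->; rewrite big_mkcond/=; apply: eq_bigr => s _.
by rewrite setTI; case: (g s); rewrite ?mulr1 ?mulr0.
Qed.

Lemma indep_mean_le k g g' : (forall s, g s <= g' s) ->
  indep_mean k g <= indep_mean k g'.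
Proof.
elim: k g g' => [|k ih] g g' gg' /=; first exact: gg'.
by apply: ih => s; apply: ler_sum => i _; rewrite ler_wpM2l ?prob_ge0.
Qed.

Lemma indep_meanZ k c g : indep_mean k (fun s => c * g s) = c * indep_mean k g.
Proof.
elim: k g => //= k ih g; rewrite -ih; congr (indep_mean k _); apply/funext => s.
by rewrite mulr_sumr; apply: eq_bigr => i _; rewrite mulrCA.
Qed.

Lemma indep_meanD k g g' :
  indep_mean k (fun s => g s + g' s) = indep_mean k g + indep_mean k g'.
Proof.
elim: k g g' => //= k ih g g'; rewrite -ih; congr (indep_mean k _).
apply/funext => s; rewrite -big_split/=.
by apply: eq_bigr => i _; rewrite mulrDr.
Qed.

End decoupling.

Section hoeffding.
Context {R : realType}.
Implicit Types (z t : R).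

Lemma double_factorial_le n : (2 ^ n * n`! <= (n.*2)`!)%N.
Proof.
elim: n => //= n ih; rewrite doubleS !factS expnS.
rewrite [X in (X <= _)%N](_ : _ = n.+1.*2 * (2 ^ n * n`!))%N; last first.
  by rewrite -muln2; ring.
rewrite doubleS; apply: leq_mul => //; apply: (leq_trans ih).
by rewrite leq_pmull.
Qed.

(** Compare the power series term by term: [(2n)! >= 2^n n!]. *)
Lemma cosh_le z : (expR z + expR (- z)) / 2 <= expR (z ^+ 2 / 2).
Proof.
pose s y n := series (exp_coeff y) n : R.
have scvg y : s y n.*2 @[n --> \oo] --> expR y.
  have dbl : n.*2 @[n --> \oo] --> \oo.
    by under eq_fun do rewrite -mul2n; exact: cvg_mulnl.
  exact: (cvg_comp _ _ dbl (is_cvg_series_exp_coeff y)).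
have c1 : (s z n.*2 + s (- z) n.*2) / 2 @[n --> \oo] -->
    (expR z + expR (- z)) / 2.
  by apply: cvgMr_tmp; apply: cvgD.
apply: (cvgr_to_le c1); apply: nearW => n.
have -> : (s z n.*2 + s (- z) n.*2) / 2 =
    \sum_(0 <= k < n) z ^+ k.*2 / (k.*2)`!%:R.
  rewrite /s /series/=; elim: n => [|n ih].
    by rewrite !big_geq// addr0 mul0r.
  rewrite doubleS !big_nat_recr//= -ih /exp_coeff/= !exprS.
  rewrite -mul2n exprM exprM sqrrN.
  by lra.
apply: le_trans (_ : series (exp_coeff (z ^+ 2 / 2)) n <= _); last first.
  apply: (@nondecreasing_cvgn_le _ (series (exp_coeff (z ^+ 2 / 2)))).
    apply: nondecreasing_series => k _ _ /=; rewrite /exp_coeff.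
    by rewrite mulr_ge0 ?invr_ge0// exprn_ge0// divr_ge0 ?sqr_ge0.
  exact: is_cvg_series_exp_coeff.
rewrite /series/=; apply: ler_sum => k _; rewrite /exp_coeff/=.
rewrite expr_div_n -exprM mul2n -mulrA ler_wpM2l//.
  by rewrite -mul2n exprM exprn_ge0// sqr_ge0.
rewrite -invfM lef_pV2 ?posrE ?mulr_gt0 ?exprn_gt0 ?ltr0n ?fact_gt0//.
by rewrite -natrX -natrM ler_nat double_factorial_le.
Qed.

Lemma expR_chord (B z t : R) : 0 < B -> `|z| <= B ->
  expR (t * z) <= (B + z) / (2 * B) * expR (t * B)
                + (B - z) / (2 * B) * expR (- (t * B)).
Proof.
move=> B0; rewrite ler_norml => /andP[zl zu].
have l0 : 0 <= (B + z) / (2 * B) by rewrite divr_ge0; lra.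
have l1 : (B + z) / (2 * B) <= 1 by rewrite ler_pdivrMr; lra.
have := convex_expR (Itv01 l0 l1) (t * B) (- (t * B)).
rewrite !convRE/= /unstable.onem.
have -> : 1 - (B + z) / (2 * B) = (B - z) / (2 * B) by field; rewrite gt_eqF.
have -> // : (B + z) / (2 * B) * (t * B) + (B - z) / (2 * B) * - (t * B) = t * z.
by field; rewrite gt_eqF.
Qed.

(** The exponential lies below its chord on [-B, B], and as the law is centered
    the mean of the chord is a hyperbolic cosine. *)
Lemma hoeffding_lemma (I : finType) (p v : I -> R) (B t : R) : 0 < B ->
  (forall i, 0 <= p i) -> \sum_i p i = 1 -> \sum_i p i * v i = 0 ->
  (forall i, `|v i| <= B) ->
  \sum_i p i * expR (t * v i) <= expR ((t * B) ^+ 2 / 2).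
Proof.
move=> B0 p0 p1 pv vB; apply: le_trans (cosh_le (t * B)).
apply: (@le_trans _ _ (\sum_i (expR (t * B) * (2^-1 * p i + (2 * B)^-1 * (p i * v i))
    + expR (- (t * B)) * (2^-1 * p i - (2 * B)^-1 * (p i * v i))))).
  apply: ler_sum => i _.
  have := ler_wpM2l (p0 i) (expR_chord t B0 (vB i)).
  move/le_trans; apply; rewrite le_eqVlt; apply/orP; left.
  by apply/eqP; field; rewrite gt_eqF.
rewrite big_split/= -!mulr_sumr big_split/= sumrB -!mulr_sumr p1 pv.
by lra.
Qed.

End hoeffding.

(** * A deviation inequality for mixing variables *)

Section tail_of_independent_mean.
Context {d : measure_display} {T : measurableType d} {R : realType}.
Variables (P : probability T R) (N : nat) (x : nat -> T -> 'I_N).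
Hypothesis mx : forall k i, measurable (x k @^-1` [set i]).
Variable v : nat -> 'I_N -> R.

Fixpoint value_sum k (s : seq 'I_N) : R :=
  match k, s with
  | k'.+1, i :: s' => v k' i + value_sum k' s'
  | _, _ => 0
  end.

Lemma value_sum_past k w : value_sum k (past x k w) = \sum_(j < k) v j (x j w).
Proof.
by elim: k => [|k ih]; rewrite ?big_ord0// big_ord_recr/= addrC; congr (_ + _).
Qed.

Variables (B : R) (q : nat).
Hypothesis B_gt0 : 0 < B.
Hypothesis vB : forall k i, `|v k i| <= B.
Hypothesis v_centered :
  forall k, (k < q)%N -> \sum_i prob P (x k @^-1` [set i]) * v k i = 0.

Lemma indep_mean_expR k t : (k <= q)%N ->
  indep_mean P x k (fun s => expR (t * value_sum k s)) <=
  expR (k%:R * ((t * B) ^+ 2 / 2)).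
Proof.
elim: k => [|k ih] kq /=; first by rewrite mulr0 mul0r.
apply: (@le_trans _ _ (indep_mean P x k
    (fun s => expR ((t * B) ^+ 2 / 2) * expR (t * value_sum k s)))).
  apply: indep_mean_le => s.
  under eq_bigr do rewrite mulrDr expRD mulrA.
  rewrite -mulr_suml ler_wpM2r ?expR_ge0//.
  apply: hoeffding_lemma => //; last exact: v_centered.
  - by move=> i; exact: prob_ge0.
  - exact: sum_prob_cell.
rewrite indep_meanZ -[k.+1%:R]natr1 mulrDl mul1r addrC expRD.
by rewrite ler_wpM2l ?expR_ge0// ih// ltnW.
Qed.

Lemma indep_mean_tail (lambda : R) : (0 < q)%N -> 0 <= lambda ->
  indep_mean P x q (fun s => (lambda <= `|value_sum q s|)%R%:R) <=
  2 * expR (- (lambda ^+ 2 / (2 * q%:R * B ^+ 2))).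
Proof.
move=> q0 l0.
have qR : 0 < q%:R :> R by rewrite ltr0n.
(* The exponent that minimizes the Chernoff bound. *)
pose t := lambda / (q%:R * B ^+ 2).
have t0 : 0 <= t by rewrite divr_ge0// mulr_ge0 ?sqr_ge0.
apply: (@le_trans _ _ (indep_mean P x q (fun s =>
    expR (- (t * lambda)) * expR (t * value_sum q s) +
    expR (- (t * lambda)) * expR (- t * value_sum q s)))).
  apply: indep_mean_le => s; case: (boolP (lambda <= _)) => [|_]; last first.
    by rewrite addr_ge0// mulr_ge0 ?expR_ge0.
  have [h|h] := leP 0 (value_sum q s) => lv.
    rewrite ger0_norm// in lv.
    rewrite -[leLHS]addr0 lerD ?mulr_ge0 ?expR_ge0// -expRD.
    by rewrite -[leLHS]expR0 ler_expR; nra.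
  rewrite ltr0_norm// in lv.
  rewrite -[leLHS]add0r lerD ?mulr_ge0 ?expR_ge0// -expRD.
  by rewrite -[leLHS]expR0 ler_expR; nra.
rewrite indep_meanD !indep_meanZ -mulrDr.
have := indep_mean_expR t (leqnn q); have := indep_mean_expR (- t) (leqnn q).
rewrite mulNr sqrrN => h1 h2.
apply: (@le_trans _ _ (expR (- (t * lambda)) *
    (expR (q%:R * ((t * B) ^+ 2 / 2)) + expR (q%:R * ((t * B) ^+ 2 / 2))))).
  by rewrite ler_wpM2l ?expR_ge0// lerD.
rewrite -mulr2n -(mulr_natl (expR _)) mulrCA -expRD.
have -> // : - (t * lambda) + q%:R * ((t * B) ^+ 2 / 2) =
  - (lambda ^+ 2 / (2 * q%:R * B ^+ 2)).
by rewrite /t; field; rewrite (gt_eqF B_gt0) (gt_eqF qR).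
Qed.

End tail_of_independent_mean.

Section bins.
Context {R : realType}.
Variables (B om : R).
Hypotheses (B_gt0 : 0 < B) (om_gt0 : 0 < om).

Definition bins := (Num.truncn (2 * B / om)).+1.

(** Only the values between [- B] and [B] matter; the others fall into bins that
    do not contain them. *)
Definition bin (y : R) : 'I_bins := inord (Num.truncn ((y + B) / om)).

Lemma bins_le : bins%:R <= 1 + 2 * B / om.
Proof.
rewrite /bins -natr1 addrC lerD2l truncn_le.
by rewrite divr_ge0 ?mulr_ge0 ?ltW.
Qed.

Lemma binP y : `|y| <= B ->
  (bin y)%:R * om - B <= y < (bin y)%:R * om - B + om.
Proof.
rewrite ler_norml => /andP[yl yu].
have y0 : 0 <= (y + B) / om by rewrite divr_ge0 ?(ltW om_gt0)//; lra.
rewrite inordK; last first.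
  by rewrite ltnS le_truncn// ler_pM2r ?invr_gt0//; lra.
have := truncn_itv y0; rewrite ler_pdivlMr// ltr_pdivrMr//.
move: (Num.truncn _) => m; rewrite -[m.+1%:R]natr1 mulrDl mul1r.
by move=> /andP[? ?]; apply/andP; split; lra.
Qed.

Lemma bin_left (i : 'I_bins) : `|i%:R * om - B| <= B.
Proof.
have i0 : 0 <= i%:R * om by rewrite mulr_ge0// ltW.
have : i%:R * om <= 2 * B.
  rewrite -ler_pdivlMr// -truncn_ge_nat ?divr_ge0 ?mulr_ge0 ?ltW//.
  by rewrite -ltnS.
by rewrite ler_norml; lra.
Qed.

Lemma measurable_bin i : measurable (bin @^-1` [set i]).
Proof.
pose g (y : R) := (y + B) / om.
have mg : measurable_fun setT g.
  by apply: measurable_funM => //; exact: measurable_funD.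
have mle m : measurable [set y | (Num.truncn (g y) <= m)%N].
  have -> : [set y | (Num.truncn (g y) <= m)%N] = g @^-1` `]-oo, m.+1%:R[.
    by apply/seteqP; split => y /=; rewrite truncn_le_nat in_itv.
  by rewrite -[_ @^-1` _]setTI; exact: mg.
have meq m : measurable [set y | Num.truncn (g y) = m].
  case: m => [|m].
    rewrite (_ : [set _ | _] = [set y | (Num.truncn (g y) <= 0)%N])//.
    by apply/seteqP; split => y /=; rewrite leqn0 => /eqP.
  rewrite (_ : [set _ | _] = [set y | (Num.truncn (g y) <= m.+1)%N] `\`
        [set y | (Num.truncn (g y) <= m)%N]); first exact: measurableD.
  apply/seteqP; split => [y /= ->|y /= [h1 /negP h2]]; first by rewrite leqnn ltnn.
  by apply/eqP; rewrite eqn_leq h1 ltnNge.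
have -> : bin @^-1` [set i] =
    \bigcup_(m in [set m | inord m = i :> 'I_bins]) [set y | Num.truncn (g y) = m].
  apply/seteqP; split => [y /= yi|y [m /= mi ym]]; first by exists (Num.truncn (g y)).
  by rewrite /bin -[X in inord X]/(Num.truncn (g y)) ym.
exact: bigcup_measurable.
Qed.

End bins.

Section mixing_deviation.
Context {d : measure_display} {T : measurableType d} {R : realType}.
Variables (P : probability T R) (V : nat -> T -> R) (q : nat) (B om a : R).
Variables (past_sets future_sets : nat -> set (set T)).
Hypotheses (B_gt0 : 0 < B) (om_gt0 : 0 < om).
Hypothesis mV : forall k, measurable_fun setT (V k).
Hypothesis VB : forall k w, `|V k w| <= B.
Hypothesis V_centered : forall k, \int[P]_w V k w = 0.
Hypothesis past_V : forall j k, (j < k)%N ->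
  measurable_fun setT (V j : g_sigma_algebraType (past_sets k) -> R).
Hypothesis future_V : forall k,
  measurable_fun setT (V k : g_sigma_algebraType (future_sets k) -> R).
Hypothesis mixing : forall k A C, (k < q)%N ->
  <<s past_sets k >> A -> <<s future_sets k >> C ->
  `|prob P (A `&` C) - prob P A * prob P C| <= a.

Let x k w := bin B om (V k w).

Let measurable_x k i : measurable (x k @^-1` [set i]).
Proof.
rewrite -[_ @^-1` _]setTI; apply: (mV k measurableT (Y := bin B om @^-1` [set i])).
exact: measurable_bin.
Qed.

Let bV k : bounded_rv (V k).
Proof. by split=> //; exists B. Qed.

Let cell_sum k i : R := \int[P]_w (V k w * \1_(x k @^-1` [set i]) w).

(** The mean of [V k] conditionally on its bin; a bin of probability zero gets
    its left end, so that [v k i] always lies within the bin. *)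
Let v k i : R :=
  if prob P (x k @^-1` [set i]) == 0 then i%:R * om - B
  else cell_sum k i / prob P (x k @^-1` [set i]).

Let cell_bounds k i (lo hi : R) :
  (forall w, x k w = i -> lo <= V k w <= hi) ->
  lo * prob P (x k @^-1` [set i]) <= cell_sum k i <=
    hi * prob P (x k @^-1` [set i]).
Proof.
move=> lohi; have b1 := bounded_rv_indic (R := R) (measurable_x k i).
have bV1 : bounded_rv (fun w => V k w * \1_(x k @^-1` [set i]) w).
  exact: bounded_rvM.
rewrite -mean_indic// -!meanZ//.
apply/andP; split; apply: mean_le => //; try exact: bounded_rvZ.
all: move=> w; rewrite indicE; case: (boolP (w \in _)); rewrite ?mulr0//.
all: by rewrite inE/= !mulr1 => /lohi /andP[].
Qed.

Let v_bounds k (i : 'I_(bins B om)) (lo hi : R) : lo <= i%:R * om - B <= hi ->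
  (forall w, x k w = i -> lo <= V k w <= hi) -> lo <= v k i <= hi.
Proof.
rewrite /v; case: ifPn => // p0 _ /cell_bounds.
have pp : 0 < prob P (x k @^-1` [set i]) by rewrite lt_def p0 prob_ge0.
by rewrite ler_pdivlMr// ler_pdivrMr.
Qed.

Let vB k i : `|v k i| <= B.
Proof.
rewrite ler_norml; apply: v_bounds; first by rewrite -ler_norml bin_left.
by move=> w _; rewrite -ler_norml.
Qed.

Let v_close k w : `|V k w - v k (x k w)| <= om.
Proof.
have := binP om_gt0 (VB k w).
have : (x k w)%:R * om - B <= v k (x k w) <= (x k w)%:R * om - B + om.
  apply: v_bounds => [|w' <-]; first by rewrite lexx/= lerDl ltW.
  by have /andP[-> /ltW] := binP om_gt0 (VB k w').
by rewrite ler_norml -/(x k w) => /andP[? ?] /andP[? ?]; apply/andP; split; lra.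
Qed.

Let v_centered k : \sum_i prob P (x k @^-1` [set i]) * v k i = 0.
Proof.
rewrite (eq_bigr (cell_sum k)) => [|i _]; last first.
  rewrite /v; case: eqP => [p0|/eqP p0]; last by rewrite mulrC divfK.
  rewrite p0 mul0r.
  have := cell_bounds (k := k) (i := i) (lo := - B) (hi := B); rewrite p0 !mulr0.
  have h w : x k w = i -> - B <= V k w <= B by rewrite -ler_norml.
  by move=> /(_ h) h0; apply/eqP; rewrite eq_le.
have bF i : bounded_rv (fun w => V k w * \1_(x k @^-1` [set i]) w).
  by apply: bounded_rvM => //; exact: bounded_rv_indic.
rewrite -[RHS](V_centered k); apply: etrans (esym (mean_sum P _ bF)) _.
apply: eq_Rintegral => w _; rewrite -mulr_sumr (bigD1 (x k w))//= big1 => [|i].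
  by rewrite addr0 indicE mem_set// mulr1.
by move=> /eqP xi; rewrite indicE memNset// => /= e; apply: xi.
Qed.

(** The variables are replaced by their conditional means on bins of width [om],
    which moves the sum by at most [q * om]; the finitely valued variables
    obtained in this way are then made independent one at a time. *)
Lemma mixing_deviation : (0 < q)%N ->
  prob P [set w | 2 * q%:R * om < `|\sum_(j < q) V j w|] <=
  2 * expR (- (q%:R * om ^+ 2 / (2 * B ^+ 2))) +
  q%:R * (36 / 5 * Num.sqrt (bins B om)%:R * a).
Proof.
move=> q0; have qR : 0 < q%:R :> R by rewrite ltr0n.
pose g s := q%:R * om <= `|value_sum v q s|.
apply: (@le_trans _ _ (prob P [set w | g (past x q w)])).
  apply: le_prob.
  - have bS : bounded_rv (fun w => \sum_(j < q) V j w) by exact: bounded_rv_sum.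
    have [mS _] := bounded_rv_norm bS.
    rewrite (_ : [set _ | _] = (fun w => `|\sum_(j < q) V j w|) @^-1` `]2 * q%:R * om, +oo[).
      by rewrite -[_ @^-1` _]setTI; exact: mS.
    by apply/seteqP; split => w /=; rewrite in_itv/= andbT.
  - have mp s : measurable (past x q @^-1` [set s]).
      by apply: measurable_past => j i _.
    exact: (measurable_finite_valued mp (fun s => g (val s))).
  move=> w /=; rewrite /g value_sum_past => h.
  have : `|\sum_(j < q) V j w - \sum_(j < q) v j (x j w)| <= q%:R * om.
    rewrite -sumrB; apply: le_trans (ler_norm_sum _ _ _) _.
    apply: (@le_trans _ _ (\sum_(j < q) om)).
      by apply: ler_sum => j _; exact: v_close.
    by rewrite sumr_const card_ord mulr_natl.
  have := lerB_dist (\sum_(j < q) V j w) (\sum_(j < q) v j (x j w)).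
  by lra.
rewrite -past_mean_indicator//.
apply: (@le_trans _ _ (indep_mean P x q (fun s => (g s)%:R) +
    q%:R * (36 / 5 * Num.sqrt (bins B om)%:R * a))).
  apply: past_mean_le => //.
  - by move=> s; case: (g s); rewrite ?lexx ?ler01.
  - move=> k kq U Y; apply: (mixing kq).
    + have mp s : measurable (past x k @^-1` [set s] : set (g_sigma_algebraType (past_sets k))).
        apply: measurable_past => j i jk; rewrite -[_ @^-1` _]setTI.
        apply: (past_V jk measurableT (Y := bin B om @^-1` [set i])).
        exact: measurable_bin.
      exact: (measurable_finite_valued mp (mem U)).
    + have mxk i : measurable (x k @^-1` [set i] : set (g_sigma_algebraType (future_sets k))).
        rewrite -[_ @^-1` _]setTI.
        exact: (@future_V k measurableT _ (measurable_bin i)).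
      exact: (measurable_finite_valued mxk (mem Y)).
rewrite lerD2r; apply: le_trans (indep_mean_tail _ B_gt0 _ _ _ _) _ => //.
  by rewrite mulr_ge0// ltW.
have -> // : (q%:R * om) ^+ 2 / (2 * q%:R * B ^+ 2) = q%:R * om ^+ 2 / (2 * B ^+ 2).
by field; rewrite (gt_eqF B_gt0) (gt_eqF qR).
Qed.

End mixing_deviation.

(** * Bosq's inequality *)

Lemma sum_ord_mul (V : nmodType) (a n : nat) (f : nat -> V) :
  \sum_(u < a * n) f u = \sum_(j < a) \sum_(i < n) f (j * n + i)%N.
Proof.
elim: a => [|a ih]; first by rewrite mul0n !big_ord0.
by rewrite mulSnr big_split_ord/= ih big_ord_recr.
Qed.

Lemma sum_even_odd (V : nmodType) (q : nat) (f : nat -> V) :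
  \sum_(j < 2 * q) f j = \sum_(j < q) f (2 * j)%N + \sum_(j < q) f (2 * j).+1.
Proof.
elim: q => [|q ih]; first by rewrite muln0 !big_ord0 addr0.
by rewrite mulnSr addnC !big_ord_recr/= ih -!addrA; congr (_ + _); rewrite addrCA.
Qed.

Lemma divn_add_le (x y d : nat) : (x %/ d + y %/ d <= (x + y) %/ d)%N.
Proof.
case: d => [|d]; first by rewrite !divn0.
rewrite leq_divRL// mulnDl.
by apply: leq_add; exact: leq_divM.
Qed.

Section bosq_inequality.
Context {d : measure_display} {T : measurableType d} {R : realType}.
Variables (P : probability T R) (Y : nat -> T -> R) (n q : nat) (b eps a : R).
Variables past_sets future_sets : nat -> set (set T).
Hypotheses (q_gt0 : (0 < q)%N) (n_gt0 : (0 < n)%N).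
Hypotheses (b_gt0 : 0 < b) (eps_gt0 : 0 < eps).
Hypothesis mY : forall t, measurable_fun setT (Y t).
Hypothesis Yb : forall t w, `|Y t w| <= b.
Hypothesis Y_centered : forall t, \int[P]_w Y t w = 0.
Hypothesis past_Y : forall t s, (t + n %/ (2 * q) <= s)%N ->
  measurable_fun setT (Y t : g_sigma_algebraType (past_sets s) -> R).
Hypothesis future_Y : forall t s, (s <= t)%N ->
  measurable_fun setT (Y t : g_sigma_algebraType (future_sets s) -> R).
Hypothesis mixing : forall s A C, <<s past_sets s >> A -> <<s future_sets s >> C ->
  `|prob P (A `&` C) - prob P A * prob P C| <= a.

(** Blocks of the possibly fractional length [n / (2 q)]: the [2 q n] pieces
    obtained by cutting each of the [n] variables into [2 q] equal pieces are
    regrouped into [2 q] runs of [n] consecutive pieces. *)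
Let block j w : R :=
  (2 * q)%:R^-1 * \sum_(i < n) Y ((j * n + i) %/ (2 * q)).+1 w.

Let q2_gt0 : (0 < 2 * q)%N. Proof. by rewrite muln_gt0. Qed.
Let q2R_gt0 : 0 < (2 * q)%:R :> R. Proof. by rewrite ltr0n. Qed.
Let qR_gt0 : 0 < q%:R :> R. Proof. by rewrite ltr0n. Qed.
Let nR_gt0 : 0 < n%:R :> R. Proof. by rewrite ltr0n. Qed.

Let sum_block w : \sum_(j < 2 * q) block j w = \sum_(1 <= t < n.+1) Y t w.
Proof.
rewrite /block -mulr_sumr.
rewrite -(sum_ord_mul (2 * q) n (fun u => Y (u %/ (2 * q)).+1 w)).
rewrite (mulnC (2 * q) n) (sum_ord_mul n (2 * q) (fun u => Y (u %/ (2 * q)).+1 w)).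
rewrite big_add1 big_mkord mulr_sumr; apply: eq_bigr => t _.
rewrite (eq_bigr (fun=> Y t.+1 w)) => [|i _]; last first.
  by rewrite divnMDl// divn_small ?addn0.
by rewrite sumr_const card_ord -[Y _ _ *+ _]mulr_natl mulKf ?gt_eqF.
Qed.

Let block_le j w : `|block j w| <= b * n%:R / (2 * q)%:R.
Proof.
rewrite /block normrM gtr0_norm ?invr_gt0// mulrC ler_pM2r ?invr_gt0//.
apply: le_trans (ler_norm_sum _ _ _) _.
apply: (@le_trans _ _ (\sum_(i < n) b)); first by apply: ler_sum.
by rewrite sumr_const card_ord mulr_natr.
Qed.

Let measurable_block (d' : measure_display) (S : measurableType d') (Z : nat -> S -> R) j :
  (forall i, (i < n)%N -> measurable_fun setT (Z ((j * n + i) %/ (2 * q)).+1)) ->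
  measurable_fun setT
    (fun w => (2 * q)%:R^-1 * \sum_(i < n) Z ((j * n + i) %/ (2 * q)).+1 w).
Proof.
move=> mZ; apply: measurable_funM => //.
have : forall k, (k <= n)%N -> measurable_fun setT
    (fun w => \sum_(i < k) Z ((j * n + i) %/ (2 * q)).+1 w).
  elim=> [|k ih] kn; first by under eq_fun do rewrite big_ord0; exact: measurable_cst.
  under eq_fun do rewrite big_ord_recr/=.
  by apply: measurable_funD; [apply: ih; exact: ltnW|exact: mZ].
exact.
Qed.

Let bY t : bounded_rv (Y t). Proof. by split=> //; exists b. Qed.

Let block_centered j : \int[P]_w block j w = 0.
Proof.
rewrite meanZ; last exact: bounded_rv_sum.
by rewrite mean_sum// big1 ?mulr0.
Qed.

(** Two blocks of the same parity are separated by a whole block, hence by at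
    least the integer part of [n / (2 q)] time steps. *)
Let parity_deviation (r : nat) :
  prob P [set w | n%:R * eps / 2 < `|\sum_(j < q) block (2 * j + r) w|] <=
  2 * expR (- (eps ^+ 2 * q%:R / (8 * b ^+ 2))) +
  11 * q%:R * Num.sqrt (1 + 4 * b / eps) * a.
Proof.
pose B := b * n%:R / (2 * q)%:R; pose om := n%:R * eps / (4 * q%:R).
have B0 : 0 < B by rewrite divr_gt0// mulr_gt0.
have om0 : 0 < om by rewrite divr_gt0 ?mulr_gt0.
have a0 : 0 <= a.
  have [h _ _] := smallest_sigma_algebra setT (past_sets 0).
  have [h' _ _] := smallest_sigma_algebra setT (future_sets 0).
  exact: le_trans (normr_ge0 _) (mixing h h').
have := @mixing_deviation _ _ _ P (fun j => block (2 * j + r)) q B om a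
  (fun k => past_sets (((2 * k + r) * n) %/ (2 * q)).+1)
  (fun k => future_sets (((2 * k + r) * n) %/ (2 * q)).+1) B0 om0.
have -> : 2 * q%:R * om = n%:R * eps / 2 by rewrite /om; field; rewrite gt_eqF.
have -> : q%:R * om ^+ 2 / (2 * B ^+ 2) = eps ^+ 2 * q%:R / (8 * b ^+ 2).
  by rewrite /om /B natrM; field; rewrite (gt_eqF b_gt0) (gt_eqF qR_gt0) (gt_eqF nR_gt0).
move=> h; apply: le_trans (h _ _ _ _ _ _ q_gt0) _ => //.
- by move=> k; apply: measurable_block => i _; exact: mY.
- move=> j k jk; apply: measurable_block => i i_n; apply: past_Y.
  rewrite addSn ltnS; apply: leq_trans (divn_add_le _ _ _) _.
  apply: leq_div2r; apply: (@leq_trans ((2 * j + r).+2 * n)%N).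
    move: (2 * j + r)%N => J; rewrite !mulSn.
    by rewrite addnC leq_add2l addnC leq_add2r ltnW.
  by rewrite leq_mul2r orbC -addn2 addnAC leq_add2r -mulnSr leq_mul2l jk.
- move=> k; apply: measurable_block => i _; apply: future_Y.
  by rewrite ltnS leq_div2r// leq_addr.
- by move=> k A C _; exact: mixing.
rewrite lerD2l; set S := Num.sqrt (1 + _).
have -> : 11 * q%:R * S * a = q%:R * (11 * S * a) by ring.
rewrite ler_wpM2l// ler_wpM2r//.
have : Num.sqrt (bins B om)%:R <= S.
  rewrite ler_wsqrtr//; apply: le_trans (bins_le B0 om0) _.
  rewrite /B /om natrM le_eqVlt; apply/orP; left; apply/eqP.
  by field; rewrite (gt_eqF eps_gt0) (gt_eqF qR_gt0) (gt_eqF nR_gt0).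
have := sqrtr_ge0 ((bins B om)%:R : R).
by move: S (Num.sqrt _) => y x x0 xy; lra.
Qed.

Lemma bosq_inequality :
  prob P [set w | n%:R * eps < `|\sum_(1 <= t < n.+1) Y t w|] <=
  4 * expR (- (eps ^+ 2 * q%:R / (8 * b ^+ 2))) +
  22 * q%:R * Num.sqrt (1 + 4 * b / eps) * a.
Proof.
have mexc (F : T -> R) (l : R) : measurable_fun setT F ->
    measurable [set w | l < `|F w|].
  move=> mF; have mnF : measurable_fun setT (fun w => `|F w|).
    exact: measurableT_comp.
  rewrite (_ : [set _ | _] = (fun w => `|F w|) @^-1` `]l, +oo[).
    by rewrite -[_ @^-1` _]setTI; exact: mnF.
  by apply/seteqP; split => w /=; rewrite in_itv/= andbT.
have mpar r : measurable_fun setT (fun w => \sum_(j < q) block (2 * j + r) w).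
  have bb j : bounded_rv (fun w => block (2 * j + r) w).
    by apply: bounded_rvZ; exact: bounded_rv_sum.
  by have [] := bounded_rv_sum (index_enum 'I_q) bb.
have h0 := parity_deviation 0; have h1 := parity_deviation 1.
apply: le_trans (_ : _ <= prob P
  ([set w | n%:R * eps / 2 < `|\sum_(j < q) block (2 * j + 0) w|] `|`
   [set w | n%:R * eps / 2 < `|\sum_(j < q) block (2 * j + 1) w|])) _.
  apply: le_prob.
  - by apply: mexc; have [] := bounded_rv_sum (index_iota 1 n.+1) bY.
  - by apply: measurableU; exact: mexc.
  move=> w /=; rewrite -sum_block (sum_even_odd q (fun j => block j w)).
  under [X in _ + X]eq_bigr do rewrite -addn1.
  under [in X in _ -> X \/ _]eq_bigr do rewrite addn0.
  set s0 := \sum_(j < q) _; set s1 := \sum_(j < q) _ => h.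
  have := ler_normD s0 s1.
  by have [?|?] := ltP (n%:R * eps / 2) `|s0|; [left|right; lra].
apply: le_trans (probU_le _ _ _) _; try exact: mexc.
by lra.
Qed.

End bosq_inequality.

(** * The top eigenvalue of a positive Hilbert-Schmidt operator *)

Section power_iteration.
Context {R : realType} {K : hilbertType R}.
Variables (L : K -> K) (x0 : K).
Hypothesis linL : linear L.
Hypothesis symL : forall x y, inner (L x) y = inner x (L y).
Hypothesis contL : forall x, `|L x| <= `|x|.

Lemma inner_iter i j : inner (iter i L x0) (iter j L x0) = inner x0 (iter (i + j) L x0).
Proof.
elim: i j => // i ih j; rewrite [iter i.+1 _ _]/= symL.
by rewrite -[L (iter j _ _)]/(iter j.+1 L x0) ih addSnnS.
Qed.

Lemma inner_iter_double i j :
  inner (iter (2 * i) L x0) (iter (2 * j) L x0) = `|iter (i + j) L x0| ^+ 2.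
Proof. by rewrite -inner_norm !inner_iter -mulnDr mul2n addnn. Qed.

Lemma norm_iter_le i j : (i <= j)%N -> `|iter j L x0| <= `|iter i L x0|.
Proof.
move=> /subnK <-; elim: (j - i)%N => // k ih.
by rewrite addSn; apply: le_trans ih; exact: contL.
Qed.

(** The inner product of two even iterates depends only on the sum of the
    indices and decreases with it, so the even iterates form a Cauchy sequence;
    their limit is fixed by the square of [L]. *)
Lemma power_iteration (c : R) : 0 <= c -> (forall k, c <= `|iter k L x0|) ->
  exists2 z, c <= `|z| & L (L z) = z.
Proof.
move=> c0 cL; pose u k := `|iter k L x0| ^+ 2; pose y k := iter (2 * k) L x0.
have u_dec i j : (i <= j)%N -> u j <= u i.
  by move=> ij; rewrite ler_pXn2r ?nnegrE// norm_iter_le.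
have D_inf : has_inf (range u).
  by split; [exists (u 0%N), 0%N|exists 0 => _ [k _ <-]; exact: sqr_ge0].
have y_dist i j : (i <= j)%N -> `|y i - y j| ^+ 2 <= u (2 * i)%N - inf (range u).
  move=> ij; rewrite normB_inner /y inner_iter_double -!inner_norm.
  rewrite !inner_iter_double !addnn -!mul2n inner_norm -!/(u _).
  have : inf (range u) <= u (i + j)%N by apply: ge_inf; [exact: D_inf.2|exists (i + j)%N].
  have : u (2 * j)%N <= u (i + j)%N by apply: u_dec; rewrite mul2n -addnn leq_add2r.
  by lra.
have y_cvg : cvg (y @ \oo).
  apply/cauchy_cvgP/cauchy_exP => e e0.
  have [_ [N _ <-] uN] := inf_adherent (exprn_gt0 2 e0) D_inf.
  exists (y N); exists N => // k /= Nk; rewrite -ball_normE/=.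
  rewrite -(@ltr_pXn2r _ 2) ?nnegrE ?(ltW e0)//.
  apply: le_lt_trans (y_dist _ _ Nk) _.
  have : u (2 * N)%N <= u N by apply: u_dec; rewrite mul2n -addnn leq_addr.
  by move: uN; lra.
pose z := lim (y @ \oo); exists z.
  have : (fun k => `|y k|) @ \oo --> `|z| by exact: cvg_norm.
  by move=> /cvgr_to_ge; apply; apply: nearW => k; exact: cL.
have LB a v : L (a - v) = L a - L v.
  by rewrite addrC -scaleN1r linL scaleN1r addrC.
have yS : (fun k => y k.+1) @ \oo --> L (L z).
  apply/cvgrPdist_le => e e0.
  have /cvgrPdist_le/(_ _ e0) : y @ \oo --> z by exact: y_cvg.
  apply: filterS => k; apply: le_trans.
  have -> : y k.+1 = L (L (y k)) by rewrite /y mulnS.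
  by rewrite -!LB; apply: le_trans (contL _) (contL _).
have yS' : (fun k => y k.+1) @ \oo --> z by rewrite cvg_shiftS.
by rewrite -(cvg_lim _ yS)// (cvg_lim _ yS').
Qed.

End power_iteration.

Section hilbert_schmidt_composition.
Context {R : realType} {H : hilbertType R}.
Implicit Types (A C D : HS H).

Let HS_lin A : {linear H -> H} :=
  HB.pack (HS_fun A) (GRing.isLinear.Build _ _ _ _ (HS_fun A) (HS_linear A)).

Lemma HS_fun0 A : A 0 = 0. Proof. exact: linear0 (HS_lin A). Qed.

Lemma HS_funZ A a x : A (a *: x) = a *: A x.
Proof. by rewrite -[a *: x]addr0 HS_linear HS_fun0 addr0. Qed.

Lemma HS_funB A x y : A (x - y) = A x - A y.
Proof. exact: linearB (HS_lin A) x y. Qed.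

Lemma HS_fun_sum A (I : Type) (s : seq I) (f : I -> H) :
  A (\sum_(i <- s) f i) = \sum_(i <- s) A (f i).
Proof. exact: linear_sum (HS_lin A) _ _ _ _. Qed.

Lemma comp_HS_subproof A C : (fun x => A (C x)) \in @hilbert_schmidt R H.
Proof.
apply/hilbert_schmidtP; split.
- by move=> a x y; rewrite !HS_linear.
- by move=> x; apply: continuous_comp; exact: HS_continuous.
have M0 : 0 <= `|A| ^+ 2 by exact: sqr_ge0.
apply: (@bounded_sums_le _ _ _ _ (`|A| ^+ 2 \*o (fun b => `|C b| ^+ 2))) => [b/=|].
  by rewrite -exprMn ler_pXn2r ?nnegrE ?mulr_ge0//; exact: HS_bound.
apply: bounded_sumsZ => //.
by have /hilbert_schmidtP[] := HS_funP C.
Qed.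

Definition comp_HS A C : HS H := MkHS (comp_HS_subproof A C).

Lemma comp_HS_linear A : linear (comp_HS A).
Proof. by move=> a C D; apply/HS_eqP => x /=; rewrite HS_linear. Qed.

Lemma comp_HS_norm A C (r : R) : 0 <= r -> (forall x, `|A x| <= r * `|x|) ->
  `|comp_HS A C| <= r * `|C|.
Proof.
move=> r0 Ar; rewrite HS_normE; apply: HS_norm_le => [|S SB].
  by rewrite mulr_ge0.
apply: le_trans (_ : _ <= r ^+ 2 * \sum_(b <- S) `|C b| ^+ 2) _; last first.
  by rewrite exprMn ler_wpM2l ?sqr_ge0//; exact: HS_sum_le.
rewrite mulr_sumr; apply: ler_sum => b _.
by rewrite -exprMn ler_pXn2r ?nnegrE ?mulr_ge0//=; exact: Ar.
Qed.

Lemma comp_HS_sym A : (forall x y, inner (A x) y = inner x (A y)) ->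
  forall C D, inner (comp_HS A C) D = inner C (comp_HS A D).
Proof.
by move=> Asym C D; congr (_ - _); apply: eq_rsum => b _ /=; rewrite Asym.
Qed.

End hilbert_schmidt_composition.

Section top_eigenvalue.
Context {R : realType} {H : hilbertType R}.
Variable A : HS H.
Hypothesis symA : forall x y, inner (A x) y = inner x (A y).
Hypothesis posA : forall x, 0 <= inner (A x) x.

Let U : set R := [set `|A x| | x in [set x | `|x| <= 1]].

Let U_sup : has_sup U.
Proof.
split; first by exists `|A 0|, 0; rewrite //= normr0.
exists `|A| => _ [x /= x1 <-]; apply: le_trans (HS_bound _ _) _.
by rewrite -HS_normE ler_piMr.
Qed.

Let r := sup U.

Let r_bound x : `|A x| <= r * `|x|.
Proof.
have [->|x0] := eqVneq x 0; first by rewrite HS_fun0 !normr0 mulr0.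
have nx : 0 < `|x| by rewrite normr_gt0.
have nxV : `| `|x|^-1 | = `|x|^-1 by rewrite ger0_norm ?invr_ge0.
rewrite -ler_pdivrMr// mulrC -nxV -normrZ -HS_funZ.
apply: ub_le_sup; first exact: U_sup.2.
by exists (`|x|^-1 *: x) => //=; rewrite normrZ ger0_norm ?invr_ge0// mulVf ?gt_eqF.
Qed.

(** The iterates of [r^-1 A], as Hilbert-Schmidt operators, have norm at least
    1, because their operator norm is 1; the limit of the power iteration in
    the space of Hilbert-Schmidt operators is therefore not zero. *)
Lemma top_eigenvalue : A <> 0 -> exists r, exists y,
  [/\ 0 < r, y != 0, A y = r *: y & forall x, `|A x| <= r * `|x|].
Proof.
move=> An0.
have r0 : 0 < r.
  rewrite ltNge; apply/negP => r0; apply: An0; apply/HS_eqP => x.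
  apply/eqP; rewrite HS0 -normr_le0; apply: le_trans (r_bound x) _.
  by rewrite mulr_le0_ge0.
have rV : `|r^-1| = r^-1 by rewrite ger0_norm ?invr_ge0 ?ltW.
pose L C := r^-1 *: comp_HS A C; pose x0 := r^-1 *: A.
have linL : linear L.
  move=> a C D; rewrite /L comp_HS_linear scalerDr !scalerA.
  by congr (_ *: _ + _); rewrite mulrC.
have symL C D : inner (L C) D = inner C (L D).
  by rewrite innerZl innerZr comp_HS_sym.
have contL C : `|L C| <= `|C|.
  rewrite normrZ rV ler_pdivrMl//.
  by apply: comp_HS_norm => //; exact: ltW.
pose B x := r^-1 *: A x.
have iterE k x : iter k L x0 x = iter k.+1 B x.
  by elim: k => // k ih; rewrite -[LHS]/(B (iter k L x0 x)) ih.
have symB x y : inner (B x) y = inner x (B y) by rewrite innerZl innerZr symA.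
have iterB k x : `|x| <= 1 -> `|B x| * `|iter k B x| <= `|iter k.+1 B x|.
  move=> x1; elim: k => [|k ih]; first by rewrite /= ler_piMr.
  have [k0|kn0] := eqVneq `|iter k B x| 0.
    have -> : iter k.+1 B x = 0.
      by rewrite /= (normr0_eq0 k0) /B HS_fun0 scaler0.
    by rewrite normr0 mulr0.
  have kp : 0 < `|iter k B x| by rewrite lt_def kn0 normr_ge0.
  have : `|iter k.+1 B x| ^+ 2 <= `|iter k B x| * `|iter k.+2 B x|.
    rewrite -inner_norm [X in inner X _]/= symB.
    exact: le_trans (ler_norm _) (cauchy_schwarz _ _).
  move=> h; rewrite -(ler_pM2l kp); apply: le_trans h.
  by rewrite mulrA (mulrC `|iter k B x|) expr2 ler_wpM2r.
have powB k x : `|x| <= 1 -> `|B x| ^+ k.+1 <= `|iter k.+1 B x|.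
  move=> x1; elim: k => [|k ih]; first by rewrite expr1.
  by rewrite exprS; apply: le_trans (iterB _ _ x1); rewrite ler_wpM2l.
have low k : 1 <= `|iter k L x0|.
  set t := `|iter k L x0|.
  have tB x : `|x| <= 1 -> `|B x| ^+ k.+1 <= t.
    move=> x1; apply: le_trans (powB k x x1) _; rewrite -iterE.
    by apply: le_trans (HS_bound _ _) _; rewrite -HS_normE ler_piMr.
  pose s := t `^ k.+1%:R^-1.
  have sk : s ^+ k.+1 = t.
    by rewrite -powR_mulrn ?powR_ge0// -powRrM mulVf ?pnatr_eq0// powRr1 // normr_ge0.
  have rs : r <= r * s.
    apply: ge_sup; first exact: U_sup.1.
    move=> _ [x /= x1 <-].
    rewrite -ler_pdivrMl// -rV -normrZ -/(B x).
    by rewrite -(@ler_pXn2r _ k.+1) ?nnegrE ?powR_ge0// sk; exact: tB.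
  rewrite -sk exprn_ege1//.
  by move: rs; rewrite -{1}[r]mulr1 ler_pM2l.
have [Z Z1 LZ] := power_iteration linL symL contL ler01 low.
have [x Zx] : exists x, Z x != 0.
  apply: contrapT => /forallNP Z0.
  suff Z00 : Z = 0 by move: Z1; rewrite Z00 normr0 ler10.
  by apply/HS_eqP => x; apply/eqP; have := Z0 x; case: eqP.
pose y := Z x.
have AAy : A (A y) = r ^+ 2 *: y.
  have : L (L Z) x = y by rewrite LZ.
  rewrite -[LHS]/(B (B y)) /B HS_funZ scalerA => {2}<-.
  by rewrite scalerA -expr2 -exprMn divff ?gt_eqF// expr1n scale1r.
exists r, (A y + r *: y); split => //.
  apply/eqP => y0.
  have Ay : A y = - (r *: y) by apply/eqP; rewrite -addr_eq0 y0.
  have := posA y; rewrite Ay innerNl innerZl inner_norm oppr_ge0 leNgt.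
  by rewrite mulr_gt0// exprn_gt0// normr_gt0.
by rewrite addrC HS_linear AAy scalerDr scalerA -expr2 addrC.
Qed.

End top_eigenvalue.

(** * Eigenvectors and deflation *)

Lemma card_seq (T : choiceType) (s : seq T) : uniq s -> ([set` s] #= `I_(size s))%card.
Proof.
move=> us; have -> : [set` s] = [set` [fset x in s]%fset].
  by apply/seteqP; split => x /=; rewrite !inE.
by apply/card_eq_fsetP; rewrite card_fseq undup_id.
Qed.

Section dimension.
Context {R : realType} {K : hilbertType R}.

Lemma left_kernel (m k : nat) (M : 'M[R]_(m, k)) : (k < m)%N ->
  exists2 c : 'rV[R]_m, c != 0 & c *m M = 0.
Proof.
move=> km; have : kermx M != 0.
  rewrite -mxrank_eq0 mxrank_ker subn_eq0 -ltnNge.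
  by apply: leq_ltn_trans km; exact: rank_leq_col.
by move=> /rowV0Pn[c]; rewrite sub_kermx => /eqP ? ?; exists c.
Qed.

Lemma dimension_orthogonal (W : set K) (m k : nat) (f : 'I_k -> K) :
  has_dimension W m -> (k < m)%N ->
  exists w, [/\ W w, w != 0 & forall i, inner w (f i) = 0].
Proof.
move=> [e [-> free_e]] km.
have [c c0 cM] := left_kernel (\matrix_(i < m, j < k) inner (e i) (f j)) km.
exists (\sum_i c 0 i *: e i); split; first by exists (c 0).
  apply: contra c0 => /eqP ce; apply/eqP/rowP => i.
  by rewrite mxE (free_e _ ce).
move=> j; have := congr1 (fun M : 'rV_k => M 0 j) cM; rewrite !mxE => <-.
by rewrite inner_suml; apply: eq_bigr => i _; rewrite innerZl mxE.
Qed.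

Lemma orthogonal_le_dimension (W : set K) (m k : nat) (g : 'I_k -> K) :
  has_dimension W m -> (forall i, W (g i)) -> (forall i, g i != 0) ->
  (forall i j, i != j -> inner (g i) (g j) = 0) -> (k <= m)%N.
Proof.
move=> [e [-> free_e]] Wg g0 og; rewrite leqNgt; apply/negP => mk.
have /choice[a aE] := Wg.
have [c c0 cM] := left_kernel (\matrix_(i < k, j < m) a i j) mk.
case/negP: c0; apply/eqP/rowP => i; rewrite mxE.
have cg : \sum_j c 0 j *: g j = 0.
  under eq_bigr do rewrite aE scaler_sumr.
  rewrite exchange_big/= big1// => l _.
  under eq_bigr do rewrite scalerA.
  rewrite -scaler_suml.
  have := congr1 (fun M : 'rV_m => M 0 l) cM; rewrite !mxE.
  by under eq_bigr do rewrite mxE; move=> ->; rewrite scale0r.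
have := congr1 (inner ^~ (g i)) cg; rewrite inner0l inner_suml (bigD1 i)//=.
rewrite big1 => [|j ji]; last by rewrite innerZl og// mulr0.
rewrite addr0 innerZl inner_norm => /eqP; rewrite mulf_eq0 sqrf_eq0 normr_eq0.
by rewrite (negbTE (g0 i)) orbF => /eqP.
Qed.

End dimension.

Section eigenvectors.
Context {R : realType} {K : hilbertType R}.
Variables (G : HS K) (lam : nat -> R).
Hypothesis symG : forall x y, inner (G x) y = inner x (G y).
Hypothesis posG : forall x, 0 <= inner (G x) x.
Hypothesis lamG : ordered_eigenvalues G lam.

(** The vector attached to a vanishing eigenvalue is zero, so no eigenvector is
    needed in the kernel. *)
Definition eigensystem (N : nat) (e : nat -> K) :=
  (forall i, (i < N)%N -> G (e i) = lam i *: e i) /\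
  (forall i j, (i < N)%N -> (j < N)%N ->
     inner (e i) (e j) = ((i == j) && (lam i != 0))%:R).

Let indices (mu : R) N := [seq j <- iota 0 N | lam j == mu].

Let mem_indices mu N j : (j \in indices mu N) = (j < N)%N && (lam j == mu).
Proof. by rewrite mem_filter mem_iota andbC. Qed.

Let uniq_indices mu N : uniq (indices mu N).
Proof. by rewrite filter_uniq// iota_uniq. Qed.

(** The earlier indices with the same eigenvalue are fewer than the dimension of
    its eigenspace, which therefore contains a vector orthogonal to those already
    chosen there; eigenvectors for other eigenvalues are orthogonal anyway. *)
Lemma eigensystem_exists N : exists e, eigensystem N e.
Proof.
have [lam0 lam_dec lam_dim] := lamG.
elim: N => [|N [e [eG eo]]]; first by exists (fun=> 0).
suff [w [wG wn wo]] : exists w, [/\ G w = lam N *: w,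
    inner w w = (lam N != 0)%:R & forall j, (j < N)%N -> inner w (e j) = 0].
  have lt j : (j < N.+1)%N -> j = N \/ (j < N)%N /\ j != N.
    rewrite ltnS leq_eqVlt => /orP[/eqP|jN]; [by left|right].
    by rewrite jN ltn_eqF.
  exists (fun j => if j == N then w else e j); split.
    by move=> i /lt[->|[iN /negbTE ->]]; [rewrite eqxx|exact: eG].
  move=> i j /lt[->|[iN ineq]] /lt[->|[jN jneq]].
  - by rewrite !eqxx.
  - by rewrite eqxx (negbTE jneq) wo// eq_sym (negbTE jneq).
  - by rewrite eqxx (negbTE ineq) innerC wo.
  - by rewrite (negbTE ineq) (negbTE jneq) eo.
have [mu0|mu_neq0] := eqVneq (lam N) 0.
  exists 0; split; last by move=> j _; rewrite inner0l.
  - by rewrite mu0 scaler0 HS_fun0.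
  - by rewrite inner0l.
have [m [dimW cardW]] := lam_dim _ mu_neq0.
have km : (size (indices (lam N) N) < m)%N.
  have us : uniq (N :: indices (lam N) N).
    by rewrite /= uniq_indices mem_indices ltnn.
  rewrite -[X in (X <= _)%N]/(size (N :: indices (lam N) N)) -card_le_II.
  have /card_eqPle[_ c1] := card_seq us.
  have /card_eqPle[c3 _] := cardW.
  have c2 : ([set` N :: indices (lam N) N] #<= [set j | lam j = lam N])%card.
    apply: subset_card_le => j /=.
    by rewrite inE mem_indices => /orP[/eqP ->|/andP[_ /eqP]].
  exact: card_le_trans c1 (card_le_trans c2 c3).
have [w [Ww w0 wo]] := dimension_orthogonal
  (fun i : 'I_(size (indices (lam N) N)) => e (nth 0%N (indices (lam N) N) i)) dimW km.
have nw : `|w| != 0 by rewrite normr_eq0.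
have Gw : G (`|w|^-1 *: w) = lam N *: (`|w|^-1 *: w).
  by rewrite HS_funZ Ww !scalerA mulrC.
exists (`|w|^-1 *: w); split => //.
  by rewrite innerZl innerZr inner_norm/=; field.
move=> j jN; have [jmu|jmu] := eqVneq (lam j) (lam N).
  have jI : j \in indices (lam N) N by rewrite mem_indices jN jmu eqxx.
  have jlt : (index j (indices (lam N) N) < size (indices (lam N) N))%N.
    by rewrite index_mem.
  by rewrite innerZl -[j](nth_index 0%N jI) (wo (Ordinal jlt)) mulr0.
have := symG (`|w|^-1 *: w) (e j); rewrite Gw eG// innerZl innerZr.
move/eqP; rewrite -subr_eq0 -mulrBl mulf_eq0 subr_eq0 eq_sym (negbTE jmu)/=.
by move/eqP.
Qed.

Definition residual N (e : nat -> K) x : K := x - \sum_(i < N) inner x (e i) *: e i.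

Section deflation.
Variables (N : nat) (e : nat -> K).
Hypothesis eP : eigensystem N e.

Let eG (i : 'I_N) : G (e i) = lam i *: e i. Proof. exact: eP.1. Qed.

Lemma inner_eigensystem_sum (a : nat -> R) (i : 'I_N) :
  inner (\sum_(j < N) a j *: e j) (e i) = a i * (lam i != 0)%:R.
Proof.
rewrite inner_suml (bigD1 i)//= big1 ?addr0 => [|j ji].
  by rewrite innerZl eP.2// eqxx.
by rewrite innerZl eP.2// -val_eqE in ji *; rewrite (negbTE ji) mulr0.
Qed.

Let e_eq0 (i : 'I_N) : lam i = 0 -> e i = 0.
Proof.
move=> l0; apply/eqP; rewrite -normr_eq0 -sqrf_eq0 -inner_norm eP.2//.
by rewrite l0 !eqxx.
Qed.

Lemma inner_residual x (i : 'I_N) : inner (residual N e x) (e i) = 0.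
Proof.
rewrite /residual innerDl innerNl (inner_eigensystem_sum (fun j => inner x (e j))).
have [l0|_] := eqVneq (lam i) 0; last by rewrite mulr1 subrr.
by rewrite e_eq0// innerC inner0l mul0r subr0.
Qed.

Lemma inner_residual_residual x y :
  inner (residual N e x) (residual N e y) = inner (residual N e x) y.
Proof.
rewrite [in X in inner _ X]/residual innerDr innerNr.
rewrite [X in _ - X](_ : _ = 0) ?subr0// innerC inner_suml big1// => i _.
by rewrite innerZl (innerC (e i)) inner_residual mulr0.
Qed.

Lemma residual_sym x y : inner (residual N e x) y = inner x (residual N e y).
Proof.
by rewrite -inner_residual_residual innerC inner_residual_residual innerC.
Qed.

Lemma norm_residual x : `|residual N e x| ^+ 2 =
  `|x| ^+ 2 - \sum_(i < N) inner x (e i) ^+ 2.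
Proof.
rewrite -inner_norm inner_residual_residual /residual innerDl innerNl inner_norm inner_suml.
by congr (_ - _); apply: eq_bigr => i _; rewrite innerZl expr2 (innerC (e i)).
Qed.

Let inner_G_residual x (i : 'I_N) : inner (G (residual N e x)) (e i) = 0.
Proof. by rewrite symG eG innerZr inner_residual mulr0. Qed.

Let deflated : HS K := G - \sum_(i < N) lam i *: rank_one (e i) (e i).

Let deflatedE x : deflated x = G (residual N e x).
Proof.
have sumE (r : seq 'I_N) : (\sum_(i <- r) lam i *: rank_one (e i) (e i) : HS K) x =
    \sum_(i <- r) inner x (e i) *: (lam i *: e i).
  elim: r => [|i r ih]; first by rewrite !big_nil HS0.
  by rewrite !big_cons HSD -ih HSZ/= !scalerA mulrC.
rewrite /deflated HSD HSN sumE /residual HS_funB HS_fun_sum; congr (_ - _).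
by apply: eq_bigr => i _; rewrite HS_funZ eG.
Qed.

Let inner_deflated x y :
  inner (deflated x) y = inner (G (residual N e x)) (residual N e y).
Proof.
rewrite deflatedE {2}/residual innerDr innerNr [X in _ - X]innerC inner_suml.
rewrite [X in _ - X]big1 ?subr0// => i _.
by rewrite innerZl (innerC (e i)) inner_G_residual mulr0.
Qed.

(** The operator norm of the deflated operator, if positive, is an eigenvalue
    of [G] with an eigenvector orthogonal to the [N] first ones; as the [lam j]
    exhaust the multiplicities, it is [lam j] for some [j >= N]. *)
Lemma inner_residual_le x :
  inner (G (residual N e x)) (residual N e x) <= lam N * `|x| ^+ 2.
Proof.
have [lam0 lam_dec lam_dim] := lamG.
rewrite -inner_deflated.
have [->|defl0] := pselect (deflated = 0); first by rewrite HS0 inner0l mulr_ge0 ?sqr_ge0.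
have symD u v : inner (deflated u) v = inner u (deflated v).
  by rewrite (innerC u) !inner_deflated symG innerC.
have posD u : 0 <= inner (deflated u) u by rewrite inner_deflated.
have [r [y [r0 y0 yE rb]]] := top_eigenvalue symD posD defl0.
have yo (i : 'I_N) : inner y (e i) = 0.
  have := inner_G_residual y i; rewrite -deflatedE yE innerZl.
  by move/eqP; rewrite mulf_eq0 gt_eqF//= => /eqP.
have Gy : G y = r *: y.
  by rewrite -yE deflatedE /residual big1 ?subr0// => i _; rewrite yo scale0r.
have rN : r <= lam N.
  rewrite leNgt; apply/negP => Nr.
  have [m [dimW cardW]] := lam_dim r (lt0r_neq0 r0).
  have setE : [set j | lam j = r] = [set` indices r N].
    apply/seteqP; split => j /=; rewrite mem_indices; last by case/andP => _ /eqP.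
    move=> jr; rewrite jr eqxx andbT ltnNge; apply/negP => Nj.
    by have := lam_dec _ _ Nj; rewrite jr leNgt Nr.
  have mE : m = size (indices r N).
    apply/eqP; rewrite eqn_leq -!card_le_II.
    have := card_seq (uniq_indices r N); rewrite -setE => c1.
    have := card_eq_trans (card_esym cardW) c1 => /card_eqPle[-> c2].
    by rewrite c2.
  pose g (i : 'I_(size (indices r N)).+1) :=
    if unlift ord0 i is Some j then e (nth 0%N (indices r N) j) else y.
  have nthP (j : 'I_(size (indices r N))) :
      (nth 0%N (indices r N) j < N)%N /\ lam (nth 0%N (indices r N) j) = r.
    have : nth 0%N (indices r N) j \in indices r N by exact: mem_nth.
    by rewrite mem_indices => /andP[? /eqP].
  have := orthogonal_le_dimension (g := g) dimW; rewrite mE ltnn.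
  have gcase (i : 'I_(size (indices r N)).+1) : i = ord0 /\ g i = y \/
      exists2 j, i = lift ord0 j & g i = e (nth 0%N (indices r N) j).
    by rewrite /g; case: unliftP => [j ->|->]; [right; exists j|left].
  move=> h; suff : false by []; apply: h.
  - move=> i; case: (gcase i) => [[_ ->]//|[j _ ->]].
    by have [jN jr] := nthP j; rewrite /op_eigenspace/= eP.1// jr.
  - move=> i; case: (gcase i) => [[_ ->]//|[j _ ->]].
    have [jN jr] := nthP j; rewrite -normr_eq0 -sqrf_eq0 -inner_norm eP.2//.
    by rewrite jr eqxx (lt0r_neq0 r0) oner_eq0.
  move=> i i'; case: (gcase i) => [[-> ->]|[j -> ->]];
    case: (gcase i') => [[-> ->]|[j' -> ->]]; rewrite ?eqxx//.
  - by have [jN _] := nthP j' => _; exact: (yo (Ordinal jN)).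
  - by have [jN _] := nthP j => _; rewrite innerC; exact: (yo (Ordinal jN)).
  rewrite (inj_eq lift_inj) => jj'.
  have [jN _] := nthP j; have [jN' _] := nthP j'; rewrite eP.2//.
  by rewrite nth_uniq// ?(inj_eq val_inj) (negbTE jj').
apply: le_trans (ler_norm _) _; apply: le_trans (cauchy_schwarz _ _) _.
rewrite expr2 mulrA ler_wpM2r//; apply: le_trans (rb x) _.
by rewrite ler_wpM2r.
Qed.

End deflation.
End eigenvectors.

(** * Simple functions and strong measurability *)

Section simple_functions.
Context {d : measure_display} {T : measurableType d} {R : realType}.
Implicit Types U V W : normedModType R.

Lemma vsimple_cst V (v : V) : vsimple (fun _ : T => v).
Proof.
split=> [|u]; first exact: finite_image_cst.
have [->|/eqP vu] := eqVneq v u.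
  by rewrite (_ : _ @^-1` _ = setT)//; apply/seteqP.
by rewrite (_ : _ @^-1` _ = set0)//; apply/seteqP; split.
Qed.

Lemma vsimple_preimage V (s : T -> V) (A : set V) :
  vsimple s -> measurable (s @^-1` A).
Proof.
move=> [fs ms]; have -> : s @^-1` A = \bigcup_(v in range s `&` A) (s @^-1` [set v]).
  apply/seteqP; split => [w Aw|w [v [_ Av] /= ->]//].
  by exists (s w) => //; split => //; exists w.
apply: fin_bigcup_measurable => //; apply: sub_finite_set fs.
exact: subIsetl.
Qed.

Lemma vsimple2 U V W (F : U -> V -> W) (s : T -> U) (s' : T -> V) :
  vsimple s -> vsimple s' -> vsimple (fun w => F (s w) (s' w)).
Proof.
move=> hs hs'; split=> [|z]; first exact: (finite_image11 _ hs.1 hs'.1).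
have -> : (fun w => F (s w) (s' w)) @^-1` [set z] =
    \bigcup_(v in range s') ((s @^-1` [set u | F u v = z]) `&` (s' @^-1` [set v])).
  apply/seteqP; split => [w Fw|w [v _ [/= + ->]]//].
  by exists (s' w) => //; exists w.
apply: fin_bigcup_measurable => [|v _]; first exact: hs'.1.
by apply: measurableI; exact: vsimple_preimage.
Qed.

Lemma vsimple1 U W (F : U -> W) (s : T -> U) :
  vsimple s -> vsimple (fun w => F (s w)).
Proof. by move=> hs; exact: (vsimple2 (fun u _ => F u) hs hs). Qed.

Lemma vsimple_if V (p : pred T) (s s' : T -> V) : measurable [set w | p w] ->
  vsimple s -> vsimple s' -> vsimple (fun w => if p w then s w else s' w).
Proof.
move=> mp hs hs'; split=> [|v].
  apply: sub_finite_set (_ : _ `<=` range s `|` range s') _; last first.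
    by rewrite finite_setU; split; [exact: hs.1|exact: hs'.1].
  by move=> _ [w _ <-]; case: (p w); [left|right]; exists w.
have -> : (fun w => if p w then s w else s' w) @^-1` [set v] =
    ([set w | p w] `&` (s @^-1` [set v])) `|` (~` [set w | p w] `&` (s' @^-1` [set v])).
  apply/seteqP; split => w /=.
    by case: ifPn => pw sv; [left|right]; split => //; exact/negP.
  by move=> [[-> //]|[/negP/negbTE -> //]].
apply: measurableU; apply: measurableI => //; last exact: vsimple_preimage.
  exact: vsimple_preimage.
exact: measurableC.
Qed.

Lemma vsimple_bounded V (s : T -> V) : vsimple s -> exists M : R, forall w, `|s w| <= M.
Proof.
move=> [fs _]; exists (\sum_(v <- fset_set (range s)) `|v|) => w.
have sw : s w \in fset_set (range s) by rewrite in_fset_set// inE; exists w.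
by rewrite (big_fsetD1 (s w))//= lerDl sumr_ge0.
Qed.

Lemma vsimple_bounded_rv V (s : T -> V) (F : V -> R) :
  vsimple s -> bounded_rv (fun w => F (s w)).
Proof.
move=> hs; split.
  by move=> _ Y _; rewrite setTI; exact: (vsimple_preimage (F @^-1` Y) hs).
exact: (vsimple_bounded (vsimple1 (F : V -> R^o) hs)).
Qed.

(** Convergence is required everywhere and not only almost everywhere, so that
    the notion depends on the sigma-algebra alone and can be used for the one
    generated by the past of a process. *)
Definition approximable V (f : T -> V) := exists2 s : nat -> T -> V,
  forall n, vsimple (s n) & forall w, s n w @[n --> \oo] --> f w.

Definition seq_continuous2 U V W (F : U -> V -> W) :=
  forall (u : nat -> U) (v : nat -> V) a b, u @ \oo --> a -> v @ \oo --> b ->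
    (fun n => F (u n) (v n)) @ \oo --> F a b.

Lemma approximable_cst V (v : V) : approximable (fun=> v).
Proof. by exists (fun _ _ => v) => [n|w]; [exact: vsimple_cst|exact: cvg_cst]. Qed.

Lemma approximable_vsimple V (s : T -> V) : vsimple s -> approximable s.
Proof. by exists (fun=> s) => // w; exact: cvg_cst. Qed.

Lemma approximable2 U V W (F : U -> V -> W) (f : T -> U) (g : T -> V) :
  seq_continuous2 F -> approximable f -> approximable g ->
  approximable (fun w => F (f w) (g w)).
Proof.
move=> cF [s hs sf] [s' hs' s'g].
exists (fun n w => F (s n w) (s' n w)) => [n|w]; first exact: vsimple2.
exact: cF.
Qed.

Lemma approximableD V (f g : T -> V) :
  approximable f -> approximable g -> approximable (fun w => f w + g w).
Proof. by apply: approximable2 => u v a b ua vb; exact: cvgD. Qed.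

Lemma approximableB V (f g : T -> V) :
  approximable f -> approximable g -> approximable (fun w => f w - g w).
Proof. by apply: (@approximable2 _ _ _ (fun x y => x - y)) => u v a b ua vb; exact: cvgB. Qed.

Lemma approximableZ V (a : R) (f : T -> V) :
  approximable f -> approximable (fun w => a *: f w).
Proof.
move=> hf; apply: (@approximable2 _ _ _ (fun x (_ : V) => a *: x) f f _ hf hf).
by move=> u v x y ux _; exact: cvgZr.
Qed.

Lemma approximable_sum V (I : Type) (r : seq I) (f : I -> T -> V) :
  (forall i, approximable (f i)) -> approximable (fun w => \sum_(i <- r) f i w).
Proof.
move=> hf; elim: r => [|i r ih].
  by under eq_fun do rewrite big_nil; exact: approximable_cst.
by under eq_fun do rewrite big_cons; exact: approximableD.
Qed.

Lemma approximable_measurable V (f : T -> V) (F : V -> R) : continuous F ->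
  approximable f -> measurable_fun setT (fun w => F (f w)).
Proof.
move=> cF [s hs sf].
apply: (@measurable_fun_cvg _ _ _ _ (fun n w => F (s n w))) => [n|w _].
  by have [] := vsimple_bounded_rv F (hs n).
by apply: continuous_cvg => //; exact: cF.
Qed.

(** Truncation: the approximations can be dominated by a constant. *)
Lemma approximable_bounded V (f : T -> V) (M : R) :
  approximable f -> (forall w, `|f w| <= M) ->
  exists s : nat -> T -> V, [/\ forall n, vsimple (s n),
    forall w, s n w @[n --> \oo] --> f w & forall n w, `|s n w| <= `|M| + 1].
Proof.
move=> [s hs sf] fM.
exists (fun n w => if `|s n w| <= `|M| + 1 then s n w else 0); split.
- by move=> n; exact: (vsimple1 (fun v => if `|v| <= `|M| + 1 then v else 0) (hs n)).
- move=> w; apply: cvg_trans (sf w); apply: near_eq_cvg.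
  have /cvgrPdist_lt/(_ _ ltr01) := sf w; apply: filterS => n h.
  case: ifPn => // /negP[]; rewrite -[s n w](subrK (f w)) addrC.
  apply: le_trans (ler_normD _ _) _; apply: lerD.
    by rewrite (le_trans (fM w))// ler_norm.
  by rewrite distrC ltW.
by move=> n w; case: ifPn => //; rewrite normr0 addr_ge0.
Qed.

Lemma continuous_norm V : continuous (fun v : V => `|v|).
Proof. by move=> v; apply: cvg_norm. Qed.

Lemma approximable_norm_bounded_rv V (f : T -> V) (M : R) :
  approximable f -> (forall w, `|f w| <= M) -> bounded_rv (fun w => `|f w|).
Proof.
move=> hf fM; split; first exact: (approximable_measurable (@continuous_norm V)).
by exists M => w; rewrite normr_id.
Qed.

Lemma bounded_linear_continuous V (l : V -> R) (C : R) :
  (forall a u v, l (a *: u + v) = a * l u + l v) -> (forall v, `|l v| <= C * `|v|) ->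
  continuous l.
Proof.
move=> ll lC v; apply/cvgrPdist_le => e e0.
have lB x y : l (x - y) = l x - l y.
  by rewrite addrC -scaleN1r ll mulN1r addrC.
have C1 : 0 < `|C| + 1 by rewrite ltr_wpDl.
have e1 : 0 < e / (`|C| + 1) by rewrite divr_gt0.
have /cvgrPdist_le/(_ _ e1) : u @[u --> v] --> v by exact: cvg_id.
apply: filterS => u vu.
rewrite -lB; apply: le_trans (lC _) _.
apply: (@le_trans _ _ ((`|C| + 1) * `|v - u|)).
  by rewrite ler_wpM2r// (le_trans (ler_norm C))// lerDl.
by rewrite mulrC -ler_pdivlMr.
Qed.

Lemma bounded_linear_bounded_rv V (f : T -> V) (l : V -> R) (C M : R) :
  (forall a u v, l (a *: u + v) = a * l u + l v) -> (forall v, `|l v| <= C * `|v|) ->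
  approximable f -> (forall w, `|f w| <= M) -> bounded_rv (fun w => l (f w)).
Proof.
move=> ll lC hf fM.
split; first exact: approximable_measurable (bounded_linear_continuous ll lC) hf.
exists (`|C| * M) => w; apply: le_trans (lC _) _.
apply: (@le_trans _ _ (`|C| * `|f w|)); first by rewrite ler_wpM2r ?ler_norm.
by rewrite ler_wpM2l.
Qed.

End simple_functions.

Section separable_approximation.
Context {d : measure_display} {T : measurableType d} {R : realType}.
Variables (V : normedModType R) (g : T -> borel V).
Hypothesis sepV : separable V.
Hypothesis mg : measurable_fun setT g.

Lemma borel_continuous_measurable (F : V -> R) : continuous F ->
  measurable_fun setT (F : borel V -> R).
Proof.
move=> cF; apply: (measurability _ (RGenOInfty.measurableE R)) => //.
move=> _ [_ [a ->] <-]; rewrite setTI; apply: sub_sigma_algebra.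
have Fo : open (F @^-1` `]a, +oo[).
  by apply: open_comp => [x _|]; [exact: cF|exact: interval_open].
exact: Fo.
Qed.

Lemma measurable_dist (v : V) : measurable_fun setT (fun w => `|g w - v| : R).
Proof.
have cF : continuous (fun u : V => `|u - v|).
  by move=> u; apply: cvg_norm; apply: cvgB; [exact: cvg_id|exact: cvg_cst].
exact: (measurableT_comp (borel_continuous_measurable cF) mg).
Qed.

(** Take the nearest among the first [n] points of a dense sequence. *)
Lemma separable_approximable : approximable (g : T -> V).
Proof.
have [D [cD dD]] := sepV.
have [x0 Dx0] : D !=set0.
  by have [x [_ Dx]] := dD setT (ex_intro _ 0 I) openT; exists x.
have [e eD] : exists e : nat -> V, D `<=` range e.
  move: cD => /pfcard_geP[D0|[e]]; first by move: Dx0; rewrite D0.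
  by exists e => x Dx; have [n _ <-] := 'surj_e Dx; exists n.
pose s := fix s n w := if n is n'.+1 then
  (if `|g w - e n| < `|g w - s n' w| then e n else s n' w) else e 0%N.
have sE n w : s n.+1 w =
    if `|g w - e n.+1| < `|g w - s n w| then e n.+1 else s n w by [].
have hs n : vsimple (s n : T -> V) /\ measurable_fun setT (fun w => `|g w - s n w| : R).
  elim: n => [|n [ih1 ih2]].
    by split; [exact: vsimple_cst|exact: measurable_dist].
  split.
    apply: (vsimple_if (p := fun w => `|g w - e n.+1| < `|g w - s n w|)) => //.
      rewrite -[X in measurable X]setTI.
      exact: (measurable_fun_ltr (measurable_dist _) ih2 measurableT (Y := [set true])).
    exact: vsimple_cst.
  rewrite (_ : (fun _ => _) = (fun w => `|g w - e n.+1|) \min (fun w => `|g w - s n w|)).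
    by apply: measurable_minr => //; exact: measurable_dist.
  by apply/funext => w; rewrite sE /= minEle; case: ltgtP => // ->.
have s_le k n w : (k <= n)%N -> `|g w - s n w| <= `|g w - e k|.
  elim: n => [|n ih]; first by rewrite leqn0 => /eqP ->.
  rewrite leq_eqVlt => /orP[/eqP ->|]; rewrite sE.
    by case: ltP => // /ltW.
  by rewrite ltnS => /ih h; case: ltP => // /ltW lt; exact: le_trans lt h.
exists s => [n|w]; first by have [] := hs n.
apply/cvgrPdist_lt => r r0.
have [x [gx Dx]] : (ball (g w : V) r) `&` D !=set0.
  apply: dD; last exact: ball_open.
  by exists (g w); exact: ballxx.
have [k _ kx] := eD x Dx.
exists k => // n /= kn; apply: le_lt_trans (s_le _ _ _ kn) _.
by rewrite kx; move: gx; rewrite -ball_normE.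
Qed.

End separable_approximation.

(** * The Bochner integral of bounded functions *)

Section bochner_integral.
Context {d : measure_display} {T : measurableType d} {R : realType}.
Variable P : probability T R.

Lemma simple_integral_linear (V : normedModType R) (s : T -> V) (l : V -> R) :
  (forall a u v, l (a *: u + v) = a * l u + l v) -> vsimple s ->
  l (vsimple_integral P s) = \int[P]_w l (s w).
Proof.
move=> ll hs; have [fs ms] := hs.
have l0 : l 0 = 0.
  by have := ll (-1) 0 0; rewrite scaler0 addr0 mulN1r addNr.
have ind v := bounded_rv_indic (R := R) (ms v).
rewrite /vsimple_integral fsbig_finite//=.
have -> : l (\sum_(v <- fset_set (range s)) fine (P (s @^-1` [set v])) *: v) =
    \sum_(v <- fset_set (range s)) l v * prob P (s @^-1` [set v]).
  by elim/big_rec2 : _ => // v y x _ <-; rewrite ll mulrC.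
under [LHS]eq_bigr do rewrite -mean_indic// -meanZ//.
rewrite -mean_sum => [|v]; last exact: bounded_rvZ.
apply: eq_Rintegral => w _.
have sw : s w \in fset_set (range s) by rewrite in_fset_set// inE; exists w.
rewrite (big_fsetD1 (s w))//= indicE mem_set// mulr1 big_seq big1 ?addr0// => v.
rewrite !inE => /andP[/eqP vs _]; rewrite indicE memNset ?mulr0//.
by move=> /= sv; apply: vs.
Qed.

Variable V : hilbertType R.
Implicit Types (f : T -> V) (s : nat -> T -> V) (l : V -> R).

Lemma inner_linear (h : V) a u v : inner (a *: u + v) h = a * inner u h + inner v h.
Proof. by rewrite innerDl innerZl. Qed.

Lemma inner_bound (h u : V) : `|inner u h| <= `|h| * `|u|.
Proof. by rewrite mulrC cauchy_schwarz. Qed.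

Lemma approximable_dist_bounded_rv f (s : T -> V) (M : R) : approximable f ->
  (forall w, `|f w| <= M) -> vsimple s -> bounded_rv (fun w => `|f w - s w|).
Proof.
move=> af fM hs; have [N sN] := vsimple_bounded hs.
apply: (approximable_norm_bounded_rv (M := M + N)).
  by apply: approximableB => //; exact: approximable_vsimple.
by move=> w; rewrite (le_trans (ler_normB _ _))// lerD.
Qed.

Lemma approximable_L1 f (M : R) : approximable f -> (forall w, `|f w| <= M) ->
  exists s, [/\ forall n, vsimple (s n), forall w, s n w @[n --> \oo] --> f w &
    \int[P]_w `|f w - s n w| @[n --> \oo] --> (0 : R)].
Proof.
move=> af fM; have [s [hs sf sM]] := approximable_bounded af fM.
exists s; split=> //.
have bD n := approximable_dist_bounded_rv af fM (hs n).
pose N := M + (`|M| + 1).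
have DN n w : `|f w - s n w| <= N.
  by rewrite (le_trans (ler_normB _ _))// lerD.
have := @dominated_cvg _ _ _ P setT measurableT
  (fun n w => (`|f w - s n w|)%:E) (cst 0%E) (cst N%:E).
have i0 : (\int[P]_(x in setT) cst 0%E x)%E = 0%:E by rewrite integral_cst// mul0e.
rewrite i0 => h; apply: fine_cvg; apply: h => //.
- by move=> n; apply/measurable_EFinP; have [] := bD n.
- move=> w _; apply/fine_cvgP; split; first by apply: nearW.
  have -> : (fine \o (fun n => (`|f w - s n w|)%:E)) = (fun n => `|f w - s n w|) by [].
  rewrite -(normr0 V) -(subrr (f w)); apply: cvg_norm; apply: cvgB => //.
  exact: cvg_cst.
- by apply: bounded_rv_integrable; exact: (bounded_rv_cst (T := T) N).
- by move=> n w _; rewrite /= lee_fin normr_id.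
Qed.

(** Testing the difference of the integrals of two simple functions against
    itself bounds it by their distance in mean, so these integrals converge. *)
Lemma bochner_integral_exists f (M : R) : approximable f ->
  (forall w, `|f w| <= M) -> exists v, is_bochner_integral P f v.
Proof.
move=> af fM; have [s [hs sf sL1]] := approximable_L1 af fM.
have bD n := approximable_dist_bounded_rv af fM (hs n).
pose D n : R := \int[P]_w `|f w - s n w|.
have I_dist n m :
    `|vsimple_integral P (s n) - vsimple_integral P (s m)| <= D n + D m.
  set h := _ - _; have [->|h0] := eqVneq h 0.
    by rewrite normr0 addr_ge0//; apply: Rintegral_ge0.
  have hp : 0 < `|h| by rewrite normr_gt0.
  rewrite -(ler_pM2r hp) -expr2 -inner_norm {1}/h innerDl innerNl.
  have lin := inner_linear h.
  rewrite !(simple_integral_linear lin)// -meanB; try exact: (vsimple_bounded_rv (inner ^~ h)).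
  rewrite mulrC -meanD// -meanZ; last exact: bounded_rvD.
  apply: mean_le.
  - by apply: bounded_rvB; exact: (vsimple_bounded_rv (inner ^~ h)).
  - by apply: bounded_rvZ; exact: bounded_rvD.
  move=> w; rewrite -innerNl -innerDl; apply: le_trans (ler_norm _) _.
  apply: le_trans (inner_bound _ _) _; rewrite ler_wpM2l//.
  have -> : s n w - s m w = (f w - s m w) - (f w - s n w).
    by rewrite opprB [RHS]addrC addrA subrK.
  by rewrite [leRHS]addrC; exact: ler_normB.
have I_cvg : cvg (vsimple_integral P (s n) @[n --> \oo]).
  apply/cauchy_cvgP/cauchy_exP => e e0.
  have e2 : 0 < e / 2 by rewrite divr_gt0.
  have /cvgrPdist_lt/(_ _ e2)[N _ DN] := sL1.
  have {}DN n : (N <= n)%N -> D n < e / 2.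
    move=> /DN /=; rewrite sub0r normrN; apply: le_lt_trans; exact: ler_norm.
  exists (vsimple_integral P (s N)); exists N => // n /= Nn.
  rewrite -ball_normE/=; apply: le_lt_trans (I_dist _ _) _.
  by rewrite (splitr e) ltrD// DN.
exists (lim (vsimple_integral P (s n) @[n --> \oo])); exists s; split=> //.
  by apply: aeW.
have -> : (fun n => (\int[P]_w (`|f w - s n w|)%:E)%E) = (fun n => (D n)%:E).
  by apply/funext => n; rewrite ge0_meanE.
exact: (cvg_EFin (f := fun n => (D n)%:E) (nearW _ (fun n => erefl)) sL1).
Qed.

Lemma is_bochner_integral_linear f (M : R) v l (C : R) :
  (forall a u w, l (a *: u + w) = a * l u + l w) -> (forall u, `|l u| <= C * `|u|) ->
  approximable f -> (forall w, `|f w| <= M) -> is_bochner_integral P f v ->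
  l v = \int[P]_w l (f w).
Proof.
move=> ll lC af fM [s [hs _ sL1 sv]].
have C0 : 0 <= `|C| by [].
have lC' u : `|l u| <= `|C| * `|u|.
  by apply: le_trans (lC u) _; rewrite ler_wpM2r ?ler_norm.
have lB x y : l (x - y) = l x - l y.
  by rewrite addrC -scaleN1r ll mulN1r addrC.
have bD n := approximable_dist_bounded_rv af fM (hs n).
pose D n : R := \int[P]_w `|f w - s n w|.
have D0 : D n @[n --> \oo] --> (0 : R).
  by apply: fine_cvg.
have lf := bounded_linear_bounded_rv ll lC af fM.
have ls n : bounded_rv (fun w => l (s n w)) := vsimple_bounded_rv l (hs n).
have dist n : `|l v - \int[P]_w l (f w)| <=
    `|C| * `|v - vsimple_integral P (s n)| + `|C| * D n.
  have -> : l v - \int[P]_w l (f w) = l (v - vsimple_integral P (s n)) +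
      \int[P]_w (l (s n w) - l (f w)).
    by rewrite meanB// lB (simple_integral_linear ll)// addrA subrK.
  apply: le_trans (ler_normD _ _) _; apply: lerD => //.
  apply: le_trans (norm_mean_le P _) _; first exact: bounded_rvB.
  rewrite /D -meanZ//; apply: mean_le.
  - by apply: bounded_rv_norm; exact: bounded_rvB.
  - exact: bounded_rvZ.
  by move=> w; rewrite -lB distrC; exact: lC'.
apply/eqP; rewrite -subr_eq0 -normr_le0.
have lim0 : `|C| * `|v - vsimple_integral P (s n)| + `|C| * D n @[n --> \oo] -->
    `|C| * `|v - v| + `|C| * 0.
  apply: cvgD; apply: cvgMl_tmp => //.
  by apply: cvg_norm; apply: cvgB => //; exact: cvg_cst.
rewrite subrr normr0 mulr0 addr0 in lim0.
by apply: (cvgr_to_ge lim0); apply: nearW.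
Qed.

(** This property determines the integral of a bounded strongly measurable
    function; whatever is said below of Bochner integrals follows from it. *)
Lemma bochner_expectation_linear f (M : R) l (C : R) :
  (forall a u w, l (a *: u + w) = a * l u + l w) -> (forall u, `|l u| <= C * `|u|) ->
  approximable f -> (forall w, `|f w| <= M) ->
  l (bochner_expectation P f) = \int[P]_w l (f w).
Proof.
move=> ll lC af fM; have [v fv] := bochner_integral_exists af fM.
apply: (is_bochner_integral_linear ll lC af fM).
exact: (xgetPex _ (ex_intro _ v fv)).
Qed.

Lemma norm_bochner_expectation f (M : R) : approximable f ->
  (forall w, `|f w| <= M) -> `|bochner_expectation P f| <= M.
Proof.
move=> af fM; set v := bochner_expectation P f.
have [->|v0] := eqVneq v 0.
  by rewrite normr0 (le_trans _ (fM point)).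
have vp : 0 < `|v| by rewrite normr_gt0.
rewrite -(ler_pM2r vp) -expr2 -inner_norm.
rewrite (bochner_expectation_linear (inner_linear v) (inner_bound v) af fM).
rewrite -[leRHS](mean_cst P); apply: mean_le; last 1 first.
- move=> w; apply: le_trans (ler_norm _) _; apply: le_trans (cauchy_schwarz _ _) _.
  by rewrite ler_wpM2r.
- exact: bounded_linear_bounded_rv (inner_linear v) (inner_bound v) af fM.
- exact: bounded_rv_cst.
Qed.

End bochner_integral.

(** * The trace of a covariance operator *)

Section rank_one_continuity.
Context {R : realType} {H : hilbertType R}.
Implicit Types u v : H.

Lemma norm_rank_one u v : `|rank_one u v| <= `|u| * `|v|.
Proof.
rewrite HS_normE; apply: HS_norm_le => [|S SB]; first exact: mulr_ge0.
rewrite exprMn /=; under eq_bigr do rewrite normrZ exprMn real_normK ?num_real// mulrC.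
by rewrite -mulr_sumr ler_wpM2l ?sqr_ge0// (bessel (onbP H).1).
Qed.

Lemma rank_oneB u u' v v' :
  rank_one u v - rank_one u' v' = rank_one (u - u') v + rank_one u' (v - v').
Proof.
apply/HS_eqP => x; rewrite !HSD HSN /= innerDr innerNr scalerBl scalerBr.
by rewrite addrA subrK.
Qed.

Lemma rank_one_seq_continuous : seq_continuous2 (@rank_one R H).
Proof.
move=> u v a b ua vb; apply/cvgrPdist_lt => e e0.
have : `|a - u n| * `|b| + `|u n| * `|b - v n| @[n --> \oo] -->
    `|a - a| * `|b| + `|a| * `|b - b|.
  apply: cvgD; apply: cvgM; try exact: cvg_cst; try exact: cvg_norm.
    by apply: cvg_norm; apply: cvgB => //; exact: cvg_cst.
  by apply: cvg_norm; apply: cvgB => //; exact: cvg_cst.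
rewrite !subrr normr0 mul0r mulr0 addr0 => /cvgrPdist_lt/(_ _ e0).
apply: filterS => n; rewrite sub0r normrN; apply: le_lt_trans.
rewrite rank_oneB; apply: le_trans (ler_normD _ _) _.
apply: le_trans (ler_norm _); apply: lerD; exact: norm_rank_one.
Qed.

End rank_one_continuity.

Lemma bounded_rv_residual (d : measure_display) (T : measurableType d) (R : realType)
    (K : hilbertType R) (U : T -> K) (M : R) (G : HS K) (lam : nat -> R) N (e : nat -> K) :
  approximable U -> (forall w, `|U w| <= M) -> eigensystem G lam N e ->
  bounded_rv (fun w => `|residual N e (U w)| ^+ 2).
Proof.
move=> aU UM eP; under eq_fun do rewrite (norm_residual eP).
apply: bounded_rvB; first exact: bounded_rvX (approximable_norm_bounded_rv aU UM).
apply: bounded_rv_sum => i; apply: bounded_rvX.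
exact: bounded_linear_bounded_rv (inner_linear (e i)) (inner_bound (e i)) aU UM.
Qed.

Section covariance_trace.
Context {d : measure_display} {T : measurableType d} {R : realType}.
Variables (P : probability T R) (K : hilbertType R) (Z : T -> K) (M : R).
Hypothesis aZ : approximable Z.
Hypothesis ZM : forall w, `|Z w| <= M.

Let G : HS K := bochner_expectation P (fun w => rank_one (Z w) (Z w)).

Let M0 : 0 <= M. Proof. exact: le_trans (normr_ge0 _) (ZM point). Qed.

(** For fixed [x] and [y], [A |-> <A x, y>] is a bounded linear functional. *)
Lemma inner_covariance x y :
  inner (G x) y = \int[P]_w (inner (Z w) x * inner (Z w) y).
Proof.
pose l (A : HS K) := inner (A x) y.
have ll a A C : l (a *: A + C) = a * l A + l C by rewrite /l HSD HSZ innerDl innerZl.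
have lb A : `|l A| <= (`|x| * `|y|) * `|A|.
  apply: le_trans (cauchy_schwarz _ _) _; rewrite mulrAC ler_wpM2r// mulrC.
  exact: HS_bound.
have aZZ := approximable2 (@rank_one_seq_continuous R K) aZ aZ.
have ZZM w : `|rank_one (Z w) (Z w)| <= M * M.
  by apply: le_trans (norm_rank_one _ _) _; exact: ler_pM.
rewrite -[LHS]/(l G) (bochner_expectation_linear P ll lb aZZ ZZM).
by apply: eq_Rintegral => w _; rewrite /l/= innerZl (innerC x).
Qed.

Lemma covariance_sym x y : inner (G x) y = inner x (G y).
Proof.
rewrite (innerC x) !inner_covariance.
by apply: eq_Rintegral => w _; rewrite mulrC.
Qed.

Lemma covariance_ge0 x : 0 <= inner (G x) x.
Proof. by rewrite inner_covariance; apply: Rintegral_ge0 => w _; rewrite -expr2 sqr_ge0. Qed.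

Let b_inner x : bounded_rv (fun w => inner (Z w) x).
Proof. exact: bounded_linear_bounded_rv (inner_linear x) (inner_bound x) aZ ZM. Qed.

Let b_norm : bounded_rv (fun w => `|Z w|).
Proof. exact: approximable_norm_bounded_rv aZ ZM. Qed.

Variable lam : nat -> R.
Hypothesis lamG : ordered_eigenvalues G lam.

Lemma mean_residual N (e : nat -> K) : eigensystem G lam N e ->
  \int[P]_w `|residual N e (Z w)| ^+ 2 = \int[P]_w `|Z w| ^+ 2 - \sum_(i < N) lam i.
Proof.
move=> eP; under eq_Rintegral do rewrite (norm_residual eP).
have b2 i : bounded_rv (fun w => inner (Z w) (e i) ^+ 2) by exact: bounded_rvX.
rewrite meanB; [|exact: bounded_rvX|exact: bounded_rv_sum].
rewrite mean_sum//; congr (_ - _); apply: eq_bigr => i _.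
rewrite (_ : \int[P]_w _ = inner (G (e i)) (e i)); last first.
  by rewrite inner_covariance; apply: eq_Rintegral => w _; rewrite expr2.
rewrite eP.1// innerZl eP.2// eqxx /=.
by case: eqVneq => [->|_]; rewrite ?mulr1 ?mul0r.
Qed.

(** Approximate [Z] by a simple function. In the direction of each of its
    finitely many values the residual of [Z] tends to zero in mean square, because
    the deflated operators have norm at most [lam N]; so the mean square of the
    whole residual, which is the trace minus the first eigenvalues, tends to
    zero when the eigenvalues are summable. *)
Lemma trace_le_eigenvalues :
  ((\int[P]_w `|Z w| ^+ 2)%:E <= \sum_(0 <= j <oo) (lam j)%:E)%E.
Proof.
have [lam0 lam_dec _] := lamG.
have [sum_fin|] := boolP (\sum_(0 <= j <oo) (lam j)%:E < +oo)%E; last first.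
  by rewrite -leNgt leye_eq => /eqP ->; rewrite leey.
set S := (\sum_(0 <= j <oo) _)%E in sum_fin *.
have S0 : (0 <= S)%E by apply: nneseries_ge0 => j _ _; rewrite lee_fin.
have SE : S = (fine S)%:E by rewrite fineK// ge0_fin_numE.
have partial N : \sum_(i < N) lam i <= fine S.
  rewrite -lee_fin -SE -sumEFin -(big_mkord xpredT (fun i => (lam i)%:E)).
  by apply: nneseries_lim_ge => j _ _; rewrite lee_fin.
rewrite SE lee_fin; apply/ler_addgt0Pr => eps eps0.
have [s [hs _ sL1]] := approximable_L1 P aZ ZM.
have e3 : 0 < eps / 3 by rewrite divr_gt0.
have e3M : 0 < eps / 3 / (M + 1) by rewrite divr_gt0// ltr_wpDl.
have /cvgrPdist_lt/(_ _ e3M)[n _ /(_ n (leqnn n))] := sL1.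
rewrite /= sub0r normrN => sn.
have bD := approximable_dist_bounded_rv aZ ZM (hs n).
have {}sn : M * \int[P]_w `|Z w - s n w| <= eps / 3.
  have := lt_le_trans (le_lt_trans (ler_norm _) sn) (lexx _).
  rewrite ltr_pdivlMr ?ltr_wpDl// => h.
  have : 0 <= \int[P]_w `|Z w - s n w| by apply: Rintegral_ge0.
  by nra.
pose F := fset_set (range (s n)).
have [fs _] := hs n.
pose kap := eps / 3 / (\sum_(v <- F) 1 + 1).
have kap0 : 0 < kap by rewrite divr_gt0// ltr_wpDl// sumr_ge0.
pose A := \sum_(v <- F) `|v| ^+ 2.
have A0 : 0 <= A by apply: sumr_ge0 => v _; exact: sqr_ge0.
have [N lamN] : exists N, lam N * A / kap <= eps / 3.
  (* The partial sums give [m * lam m <= S], as the sequence is nonincreasing. *)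
  pose m := (Num.truncn (fine S * (A + 1) / (kap * (eps / 3)))).+1.
  exists m; have := partial m.
  have : \sum_(i < m) lam m <= \sum_(i < m) lam i.
    by apply: ler_sum => i _; apply: lam_dec; exact: ltnW.
  rewrite sumr_const card_ord -[_ *+ m]mulr_natl => h1 h2.
  have h3 : fine S * (A + 1) / (kap * (eps / 3)) < m%:R by exact: truncnS_gt.
  have ke : 0 < kap * (eps / 3) by exact: mulr_gt0.
  rewrite ler_pdivrMr// mulrC; rewrite (ltr_pdivrMr _ _ ke) in h3.
  have m0 : 0 < m%:R :> R by rewrite ltr0n.
  have h4 : m%:R * lam m <= fine S by exact: le_trans h1 h2.
  rewrite -(ler_pM2l m0).
  have : m%:R * lam m * (A + 1) <= fine S * (A + 1).
    by rewrite ler_wpM2r// addr_ge0.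
  have := mulr_ge0 (ltW m0) (lam0 m).
  by nra.
have [e eP] := eigensystem_exists covariance_sym lamG N.
rewrite -lerBlDl; apply: (@le_trans _ _ (\int[P]_w `|residual N e (Z w)| ^+ 2)).
  by rewrite (mean_residual eP) lerD2l lerN2.
pose Q := residual N e.
have bq v : bounded_rv (fun w => inner (Z w) (Q v) ^+ 2) by exact: bounded_rvX.
have bqk v : bounded_rv (fun w => kap + kap^-1 * inner (Z w) (Q v) ^+ 2).
  by apply: bounded_rvD; [exact: bounded_rv_cst|exact: bounded_rvZ].
apply: (@le_trans _ _ (\int[P]_w
    (\sum_(v <- F) (kap + kap^-1 * inner (Z w) (Q v) ^+ 2) + M * `|Z w - s n w|))).
  apply: mean_le; first exact: (bounded_rv_residual aZ ZM eP).
    by apply: bounded_rvD; [exact: bounded_rv_sum|exact: bounded_rvZ].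
  move=> w; rewrite -inner_norm (inner_residual_residual eP).
  rewrite -[X in inner _ X](subrK (s n w)) innerDr addrC; apply: lerD.
    have sF : s n w \in F by rewrite in_fset_set// inE; exists w.
    rewrite (residual_sym eP) (big_fsetD1 (s n w))//= -[leLHS]addr0; apply: lerD.
      set y := inner _ _; apply: (@le_trans _ _ `|y|); first exact: ler_norm.
      rewrite -/(Q _) -/y -real_normK ?num_real//.
      (* The bound [t <= kap + t ^ 2 / kap] stands in for Cauchy-Schwarz. *)
      have kE (k z : R) : k != 0 -> k * (k + k^-1 * z) = k ^+ 2 + z.
        by move=> ?; field.
      rewrite -(ler_pM2l kap0) kE ?gt_eqF//.
      by have := sqr_ge0 (kap - `|y|); have := normr_ge0 y; nra.
    apply: sumr_ge0 => v _; rewrite addr_ge0 ?(ltW kap0)// mulr_ge0 ?sqr_ge0//.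
    by rewrite invr_ge0 ltW.
  apply: le_trans (ler_norm _) _; apply: le_trans (cauchy_schwarz _ _) _.
  rewrite ler_wpM2r//; apply: le_trans (ZM w).
  rewrite -(@ler_pXn2r _ 2) ?nnegrE// (norm_residual eP) gerBl.
  by apply: sumr_ge0 => i _; exact: sqr_ge0.
rewrite meanD; [|exact: bounded_rv_sum|exact: bounded_rvZ].
rewrite mean_sum// meanZ//.
have sumE : \sum_(v <- F) \int[P]_w (kap + kap^-1 * inner (Z w) (Q v) ^+ 2) <=
    \sum_(v <- F) (kap * 1 + kap^-1 * lam N * `|v| ^+ 2).
  apply: ler_sum => v _; rewrite meanD; [|exact: bounded_rv_cst|exact: bounded_rvZ].
  rewrite (mean_cst P kap) meanZ// mulr1 lerD2l -mulrA ler_wpM2l ?invr_ge0 ?(ltW kap0)//.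
  apply: le_trans (inner_residual_le covariance_sym covariance_ge0 lamG eP v).
  rewrite inner_covariance.
  by under eq_Rintegral do rewrite expr2.
have : \sum_(v <- F) (kap * 1 + kap^-1 * lam N * `|v| ^+ 2) <= eps / 3 + eps / 3.
  rewrite big_split/= -!mulr_sumr; apply: lerD.
    rewrite /kap mulrAC ler_pdivrMr ?ltr_wpDl// ?sumr_ge0//.
    by rewrite ler_wpM2l ?(ltW e3)// lerDl.
  by rewrite -/A -mulrA mulrC.
by move: sumE sn; lra.
Qed.

Lemma residual_le_eigenvalues N (e : nat -> K) : eigensystem G lam N e ->
  ((\int[P]_w `|residual N e (Z w)| ^+ 2)%:E <= \sum_(N <= j <oo) (lam j)%:E)%E.
Proof.
move=> eP; have [lam0 _ _] := lamG.
rewrite (mean_residual eP) EFinB leeBlDl//.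
apply: le_trans trace_le_eigenvalues _.
rewrite (nneseries_split _ N) => [|j _]; last by rewrite lee_fin.
by rewrite add0n -sumEFin -(big_mkord xpredT (fun i => (lam i)%:E)).
Qed.

End covariance_trace.

(** * Laws and mixing coefficients *)

Section laws_and_mixing.
Context {d : measure_display} {T : measurableType d} {R : realType}.
Variable P : probability T R.

Lemma mean_eq_law (d' : measure_display) (S : measurableType d') (tau sigma : T -> S)
    (h : S -> R) :
  measurable_fun setT tau -> measurable_fun setT sigma ->
  (forall B, measurable B -> P (tau @^-1` B) = P (sigma @^-1` B)) ->
  bounded_rv h -> \int[P]_w h (tau w) = \int[P]_w h (sigma w).
Proof.
move=> mt ms law bh.
have pf f (mf : measurable_fun setT f) :
    (\int[P]_w (h (f w))%:E = \int[pushforward P f]_y (h y)%:E)%E.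
  rewrite integral_pushforward//; first by apply/measurable_EFinP; exact: bh.1.
  apply: (bounded_rv_integrable P (f := fun w => h (f w))); split.
    exact: (measurableT_comp bh.1 mf).
  by have [_ [M hM]] := bh; exists M.
rewrite /Rintegral pf// pf//; congr fine; apply: eq_measure_integral => A mA _.
exact: law.
Qed.

Lemma prob_dependence_le_quarter A C : measurable A -> measurable C ->
  `|prob P (A `&` C) - prob P A * prob P C| <= 4^-1.
Proof.
move=> mA mC; have mAC := measurableI _ _ mA mC.
have pA : prob P (A `&` C) <= prob P A by exact: le_prob.
have pC : prob P (A `&` C) <= prob P C by exact: le_prob.
have p0 := prob_ge0 P (A `&` C).
have a0 := prob_ge0 P A; have c0 := prob_ge0 P C.
have a1 := prob_le1 P mA; have c1 := prob_le1 P mC.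
have pU : prob P A + prob P C <= 1 + prob P (A `&` C).
  have ind B mB := @bounded_rv_indic _ T R B mB.
  rewrite -!mean_indic// -meanD; try exact: ind.
  rewrite -[X in _ <= X + _](mean_cst P 1) -meanD; try exact: ind; last exact: bounded_rv_cst.
  apply: mean_le; try by apply: bounded_rvD; try exact: ind; exact: bounded_rv_cst.
  move=> w; rewrite !indicE in_setI.
  by case: (w \in A); case: (w \in C); rewrite /=; lra.
move: (prob P (A `&` C)) (prob P A) (prob P C) pA pC p0 a0 c0 a1 c1 pU => p a c.
move=> pa pc p0 a0 c0 a1 c1 pU; rewrite ler_norml.
have := sqr_ge0 (a - 2^-1); have := sqr_ge0 (c - 2^-1).
have := sqr_ge0 (a - c); have := sqr_ge0 (1 - a - c); have := sqr_ge0 (a + c - 1).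
move=> s1 s2 s3 s4 s5; apply/andP; split; last first.
  by have [ac|ca] := leP a c; nra.
by have [ac|ca] := leP (a + c) 1; nra.
Qed.

Variables (d' : measure_display) (E : measurableType d') (X : int -> T -> E).
Hypothesis measX : forall t, measurable_fun setT (X t).

Lemma process_sigma_measurable (I : set int) A : process_sigma X I A -> measurable A.
Proof.
move=> IA; apply: (smallest_sub (sigma_algebra_measurable T) _ IA).
move=> B [t _ [C mC <-]]; exact: measX.
Qed.

Lemma measurable_process_sigma (I : set int) t : I t ->
  measurable_fun setT (X t : g_sigma_algebraType
    (\bigcup_(u in I) preimage_set_system setT (X u) measurable) -> E).
Proof.
move=> It _ B mB; apply: sub_sigma_algebra; exists t => //.
by exists B.
Qed.

Lemma alpha_coef_ge (I J : set int) A C : process_sigma X I A -> process_sigma X J C ->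
  `|prob P (A `&` C) - prob P A * prob P C| <=
  alpha_coef P (process_sigma X I) (process_sigma X J).
Proof.
move=> IA JC; apply: ub_le_sup; last by exists A, C.
exists 4^-1 => _ [A' [C' [IA' JC' ->]]].
by apply: prob_dependence_le_quarter; apply: process_sigma_measurable;
    [exact: IA'|exact: JC'].
Qed.

(** For a lag smaller than 1 the coefficient is 1/4 by convention, which is a
    bound for any two events. *)
Lemma alpha_mixing_ge (j k : int) A C :
  process_sigma X [set t | t <= j] A -> process_sigma X [set t | j + k <= t] C ->
  `|prob P (A `&` C) - prob P A * prob P C| <= alpha_mixing P X k.
Proof.
move=> jA kC; rewrite /alpha_mixing; case: ifPn => _.
  by apply: prob_dependence_le_quarter; apply: process_sigma_measurable;
    [exact: jA|exact: kC].
apply: le_trans (alpha_coef_ge jA kC) _; apply: ub_le_sup; last by exists j.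
exists 4^-1 => _ [i _ <-]; apply: ge_sup.
  exists `|prob P (set0 `&` set0) - prob P set0 * prob P set0|.
  exists set0, set0; split => //.
    by have [h _ _] := smallest_sigma_algebra setT
      (\bigcup_(u in [set t | t <= i]) preimage_set_system setT (X u) measurable).
  by have [h _ _] := smallest_sigma_algebra setT
    (\bigcup_(u in [set t | i + k <= t]) preimage_set_system setT (X u) measurable).
move=> _ [A' [C' [IA' JC' ->]]].
by apply: prob_dependence_le_quarter; apply: process_sigma_measurable;
    [exact: IA'|exact: JC'].
Qed.

Lemma alpha_mixing_ge0 (k : int) : 0 <= alpha_mixing P X k.
Proof.
have [h0 _ _] := smallest_sigma_algebra setT
  (\bigcup_(u in [set t | t <= 0]) preimage_set_system setT (X u) measurable).
have [hk _ _] := smallest_sigma_algebra setT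
  (\bigcup_(u in [set t | 0 + k <= t]) preimage_set_system setT (X u) measurable).
exact: le_trans (normr_ge0 _) (alpha_mixing_ge h0 hk).
Qed.

Lemma prob_exists_le (nu : nat) (A : nat -> set T) :
  (forall i, measurable (A i)) ->
  prob P [set w | exists2 i, (i < nu)%N & A i w] <= \sum_(i < nu) prob P (A i).
Proof.
move=> mA.
have -> : [set w | exists2 i, (i < nu)%N & A i w] = \big[setU/set0]_(i < nu) A i.
  apply/seteqP; split => [w [i inu Aw]|w].
    by rewrite -bigcup_mkord; exists i.
  by rewrite -bigcup_mkord => -[i inu Aw]; exists i.
elim: nu => [|k ih].
  by rewrite !big_ord0 /prob measure0.
rewrite !big_ord_recr/=; apply: le_trans (probU_le _ _ _) _ => //.
  by apply: bigsetU_measurable.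
by rewrite lerD2r.
Qed.

Lemma prob_markov (f : T -> R) (r : R) : 0 < r -> bounded_rv f ->
  (forall w, 0 <= f w) -> prob P [set w | r < f w] <= r^-1 * \int[P]_w f w.
Proof.
move=> r0 bf f0.
have mr : measurable [set w | r < f w].
  rewrite (_ : [set _ | _] = f @^-1` `]r, +oo[).
    by rewrite -[_ @^-1` _]setTI; exact: bf.1.
  by apply/seteqP; split => w /=; rewrite in_itv/= andbT.
rewrite -mean_indic// -meanZ//; apply: mean_le.
- exact: bounded_rv_indic.
- exact: bounded_rvZ.
move=> w; rewrite indicE; case: (boolP (w \in _)) => [|_].
  by rewrite inE /= => /ltW rf; rewrite ler_pdivlMl// mulr1.
by rewrite mulr_ge0// invr_ge0 ltW.
Qed.

End laws_and_mixing.

(** * Concentration of the empirical autocovariance operator *)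

Section averages.
Context {R : realType} {K : hilbertType R}.

Lemma residual_average N (e : nat -> K) (a : R) (I : Type) (r : seq I) (x : I -> K) :
  residual N e (a *: \sum_(i <- r) x i) = a *: \sum_(i <- r) residual N e (x i).
Proof.
rewrite /residual sumrB scalerBr; congr (_ - _).
rewrite exchange_big [RHS]scaler_sumr; apply: eq_bigr => j _ /=.
by rewrite innerZl inner_suml -scalerA -scaler_suml.
Qed.

(** Convexity of the squared norm. *)
Lemma norm_average_sqr_le (I : Type) (r : seq I) (x : I -> K) :
  `|(size r)%:R^-1 *: \sum_(i <- r) x i| ^+ 2 <=
  (size r)%:R^-1 * \sum_(i <- r) `|x i| ^+ 2.
Proof.
have [r0|r0] := posnP (size r).
  by rewrite r0 invr0 scale0r mul0r normr0 expr0n.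
have rR : 0 < (size r)%:R :> R by rewrite ltr0n.
rewrite normrZ exprMn gtr0_norm ?invr_gt0// expr2 -mulrA ler_pM2l ?invr_gt0//.
rewrite ler_pdivrMl//; have := finite_cauchy_schwarz r (fun=> 1) (fun i => `|x i|).
rewrite (eq_bigr (fun i => `|x i|)) => [|i _]; last by rewrite mul1r.
rewrite [X in _ <= X * _ -> _](eq_bigr (fun=> 1)) => [|i _]; last by rewrite expr1n.
rewrite big_const_seq count_predT iter_addr_0; apply: le_trans.
by rewrite ler_pXn2r ?nnegrE ?sumr_ge0// ler_norm_sum.
Qed.

Lemma inner_sub_continuous (a v : K) : continuous (fun x => inner (x - a) v).
Proof.
have cl : continuous (fun x : K => inner x v).
  exact: bounded_linear_continuous (inner_linear v) (inner_bound v).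
rewrite (_ : (fun _ => _) = (fun x => inner x v - inner a v)); last first.
  by apply/funext => x; rewrite innerDl innerNl.
by move=> x; apply: cvgB; [exact: cl|exact: cvg_cst].
Qed.

Lemma norm_residual_continuous N (e : nat -> K) (a : K) :
  continuous (fun x => `|residual N e (x - a)| ^+ 2).
Proof.
have cont : continuous (fun x => residual N e (x - a)).
  move=> x; apply: cvgB; first by apply: cvgB; [exact: cvg_id|exact: cvg_cst].
  apply: cvg_big => [|i _]; first exact: add_continuous.
  by apply: cvgZ; [exact: inner_sub_continuous|exact: cvg_cst].
under eq_fun do rewrite expr2.
by move=> x; apply: cvgM; apply: cvg_norm; exact: cont.
Qed.

End averages.

Lemma bounded_rv_average (d : measure_display) (T : measurableType d) (R : realType)
    (F : nat -> T -> R) (n : nat) : (forall t, bounded_rv (F t)) ->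
  bounded_rv (fun w => n%:R^-1 * \sum_(1 <= t < n.+1) F t w).
Proof. by move=> bF; apply: bounded_rvZ; exact: bounded_rv_sum. Qed.

Lemma mean_average (d : measure_display) (T : measurableType d) (R : realType)
    (P : probability T R) (F : nat -> T -> R) (n : nat) (m : R) : (0 < n)%N ->
  (forall t, bounded_rv (F t)) -> (forall t, \int[P]_w F t w = m) ->
  \int[P]_w (n%:R^-1 * \sum_(1 <= t < n.+1) F t w) = m.
Proof.
move=> n0 bF Fm; rewrite meanZ; last exact: bounded_rv_sum.
rewrite mean_sum// (eq_bigr (fun=> m)) => [|t _]; last exact: Fm.
rewrite big_const_nat subn1/= iter_addr_0 -[X in _ * X = _]mulr_natl.
by rewrite mulKf// pnatr_eq0 -lt0n.
Qed.

Section concentration.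
Context (R : realType) (d : measure_display) (Omega : measurableType d).
Variables (P : probability Omega R) (E : ptopologicalType).
Variables (X : int -> Omega -> borel E) (H : rkhs R E) (c : R).
Hypothesis measX : forall t, measurable_fun setT (X t).
Hypothesis statX : strictly_stationary P X.
Hypothesis sepH : separable H.
Hypothesis measphi : measurable_fun setT (rkhs_feature H : borel E -> borel H).
Hypothesis supk : ereal_sup [set (rkhs_kernel H x x)%:E | x in setT] = c%:E.
Variable eta : nat.

Let phi := rkhs_feature H.
Let Y t w : HS H := lagged_product H X eta t w.
Let C : HS H := autocovariance P H X eta.
Let Z t w : HS H := Y t w - C.

Lemma norm_feature x : `|phi x| ^+ 2 <= c.
Proof.
rewrite -inner_norm -rkhs_reproducing rkhs_eval_feature -lee_fin -supk.
by apply: ereal_sup_ubound; exists x.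
Qed.

Lemma kernel_bound_ge0 : 0 <= c.
Proof. exact: le_trans (sqr_ge0 _) (norm_feature point). Qed.

Lemma norm_feature_product x y : `|rank_one (phi x) (phi y)| <= c.
Proof.
apply: le_trans (norm_rank_one _ _) _.
have := norm_feature x; have := norm_feature y.
by have := sqr_ge0 (`|phi x| - `|phi y|); nra.
Qed.

Lemma approximable_feature_product (d' : measure_display) (S : measurableType d')
    (U V : S -> borel E) :
  measurable_fun setT U -> measurable_fun setT V ->
  approximable (fun w => rank_one (phi (U w)) (phi (V w))).
Proof.
move=> mU mV; apply: (approximable2 (@rank_one_seq_continuous R H)).
- exact: (separable_approximable sepH (measurableT_comp measphi mU)).
- exact: (separable_approximable sepH (measurableT_comp measphi mV)).
Qed.

Let aY t : approximable (Y t).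
Proof. exact: approximable_feature_product. Qed.

Let Yc t w : `|Y t w| <= c.
Proof. exact: norm_feature_product. Qed.

Let aZ t : approximable (Z t).
Proof. by apply: approximableB => //; exact: approximable_cst. Qed.

Let Zc t w : `|Z t w| <= 2 * c.
Proof.
rewrite (mulr_natl c 2) mulr2n; apply: le_trans (ler_normB _ _) _; apply: lerD => //.
exact: norm_bochner_expectation.
Qed.

(** The lagged product is a function of the pair formed by the values of the
    process at times [t + eta] and [t], whose law does not depend on [t]. *)
Lemma stationary_mean (F : HS H -> R) (M : R) (t : int) : continuous F ->
  (forall A, `|A| <= c -> `|F A| <= M) ->
  \int[P]_w F (Y t w) = \int[P]_w F (Y 0 w).
Proof.
move=> cF FM; pose ti (i : 'I_2) : int := if i == ord0 then eta%:Z else 0.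
pose tau s w := [tuple X (ti i + s) w | i < 2].
have mtau s : measurable_fun setT (tau s).
  apply/measurable_fun_tnthP => i.
  rewrite (_ : _ \o _ = X (ti i + s)); first exact: measX.
  by apply/funext => w; rewrite /= tnth_mktuple.
pose h (p : 2.-tuple (borel E)) := F (rank_one (phi (tnth p ord0)) (phi (tnth p ord_max))).
have bh : bounded_rv h.
  split; last by exists M => p; apply: FM; exact: norm_feature_product.
  apply: (approximable_measurable cF).
  by apply: approximable_feature_product; exact: measurable_tnth.
have hE s : (fun w => F (Y s w)) = (fun w => h (tau s w)).
  apply/funext => w; rewrite /h /tau !tnth_mktuple /ti/=.
  by rewrite /Y /lagged_product addrC add0r.
rewrite !hE; apply: mean_eq_law bh => // B mB.
rewrite -[LHS]/(P [set w | B [tuple X (ti i + t) w | i < 2]]).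
rewrite -[RHS]/(P [set w | B [tuple X (ti i + 0) w | i < 2]]).
by rewrite -!statX.
Qed.

Let inner_le (v A : HS H) : `|A| <= c -> `|inner (A - C) v| <= 2 * c * `|v|.
Proof.
move=> Ac; apply: le_trans (cauchy_schwarz _ _) _; rewrite ler_wpM2r//.
rewrite (mulr_natl c 2) mulr2n; apply: le_trans (ler_normB _ _) _; apply: lerD => //.
exact: norm_bochner_expectation.
Qed.

Lemma mean_inner_centered t v : \int[P]_w inner (Z t w) v = 0.
Proof.
rewrite (stationary_mean t (@inner_sub_continuous R _ C v) (@inner_le v)).
have lin := inner_linear v; have bnd := inner_bound v.
have bY := bounded_linear_bounded_rv lin bnd (aY 0) (Yc 0).
under eq_Rintegral do rewrite innerDl innerNl.
rewrite meanB//; last exact: bounded_rv_cst.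
by rewrite (mean_cst P (inner C v)) -(bochner_expectation_linear P lin bnd (aY 0) (Yc 0)) subrr.
Qed.

Lemma stationary_residual N (e : nat -> HS H) t :
  \int[P]_w `|residual N e (Z t w)| ^+ 2 = \int[P]_w `|residual N e (Z 0 w)| ^+ 2.
Proof.
have c0 := kernel_bound_ge0.
pose F (A : HS H) := `|residual N e (A - C)| ^+ 2.
apply: (@stationary_mean F ((2 * c + \sum_(i < N) 2 * c * `|e i| * `|e i|) ^+ 2)).
  exact: norm_residual_continuous.
move=> A Ac; rewrite /F normrX normr_id ler_pXn2r ?nnegrE//; last first.
  by rewrite addr_ge0 ?sumr_ge0 ?mulr_ge0// => i _; rewrite !mulr_ge0.
apply: le_trans (ler_normB _ _) _; apply: lerD.
  rewrite (mulr_natl c 2) mulr2n; apply: le_trans (ler_normB _ _) _; apply: lerD => //.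
  exact: norm_bochner_expectation.
apply: le_trans (ler_norm_sum _ _ _) _; apply: ler_sum => i _.
by rewrite normrZ ler_wpM2r// inner_le.
Qed.

Variables (n q : nat) (q_gt0 : (0 < q)%N) (n_gt0 : (0 < n)%N).

Let lag : int := (n %/ (2 * q))%N%:Z - eta%:Z.

(** Each coordinate of the centered lagged products is an alpha-mixing sequence
    whose coefficients are at most those of the process at a lag shortened by [eta]. *)
Lemma coordinate_deviation (v : HS H) (eps : R) : 0 < c -> 0 < eps -> `|v| <= 1 ->
  prob P [set w | n%:R * eps < `|\sum_(1 <= t < n.+1) inner (Z t%:Z w) v|] <=
  4 * expR (- (eps ^+ 2 * q%:R / (8 * (2 * c) ^+ 2))) +
  22 * q%:R * Num.sqrt (1 + 4 * (2 * c) / eps) * alpha_mixing P X lag.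
Proof.
move=> c0 eps0 v1.
have lin := inner_linear v; have bnd := inner_bound v.
pose past_times (s : nat) : set int := [set u | u <= s%:Z - lag].
pose future_times (s : nat) : set int := [set u | s%:Z <= u].
have meas_coord (I : set int) (t : nat) : I t%:Z -> I (t%:Z + eta%:Z) ->
    measurable_fun setT ((fun w => inner (Z t%:Z w) v) : g_sigma_algebraType
      (\bigcup_(u in I) preimage_set_system setT (X u) measurable) -> R).
  move=> It Iteta.
  apply: (approximable_measurable (@inner_sub_continuous R _ C v)).
  by apply: approximable_feature_product; exact: measurable_process_sigma.
apply: (@bosq_inequality _ _ _ P (fun t w => inner (Z t%:Z w) v) n q (2 * c) eps
  (alpha_mixing P X lag)
  (fun s => \bigcup_(u in past_times s) preimage_set_system setT (X u) measurable)
  (fun s => \bigcup_(u in future_times s) preimage_set_system setT (X u) measurable)) => //.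
- by rewrite mulr_gt0.
- by move=> t; have [] := bounded_linear_bounded_rv lin bnd (aZ t%:Z) (Zc t%:Z).
- move=> t w; apply: le_trans (inner_le _ (Yc t%:Z w)) _.
  by rewrite ler_piMr// mulr_ge0// ltW.
- by move=> t; exact: mean_inner_centered.
- move=> t s ts; apply: meas_coord; rewrite /past_times/= /lag; lia.
- move=> t s ts; apply: meas_coord; rewrite /future_times/=; lia.
move=> s A D pA fD.
apply: (@alpha_mixing_ge _ _ _ P _ _ X measX (s%:Z - lag) lag) => //.
by rewrite subrK.
Qed.

Variables (eps : R) (nu : nat) (delta : R) (lam : nat -> R).
Hypotheses (eps_gt0 : 0 < eps) (nu_gt0 : (0 < nu)%N).
Hypotheses (delta_gt0 : 0 < delta) (delta_lt1 : delta < 1).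
Hypothesis lamE : ordered_eigenvalues (covariance_operator P H X eta) lam.

Let average w : HS H := n%:R^-1 *: \sum_(1 <= t < n.+1) Z t%:Z w.

Let averageE w : empirical_autocovariance H X eta n w - C = average w.
Proof.
rewrite /average sumrB big_const_nat subn1/= iter_addr_0 scalerBr -[C *+ n]scaler_nat.
by rewrite scalerA mulVf ?scale1r// pnatr_eq0 -lt0n.
Qed.

Let aaverage : approximable average.
Proof. by apply: approximableZ; apply: approximable_sum => t; exact: aZ. Qed.

Let size_range : size (index_iota 1 n.+1) = n.
Proof. by rewrite size_iota subn1. Qed.

Let nR : 0 < n%:R :> R. Proof. by rewrite ltr0n. Qed.

Let average_le w : `|average w| <= 2 * c.
Proof.
rewrite normrZ gtr0_norm ?invr_gt0// ler_pdivrMl//.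
apply: le_trans (ler_norm_sum _ _ _) _.
apply: (@le_trans _ _ (\sum_(1 <= t < n.+1) (2 * c))); first exact: ler_sum.
by rewrite big_const_nat subn1/= iter_addr_0 -[_ *+ n]mulr_natl.
Qed.

Lemma empirical_autocovariance_sub_le w :
  `|empirical_autocovariance H X eta n w - autocovariance P H X eta| <= 2 * c.
Proof. by rewrite averageE. Qed.

(** Markov's inequality; convexity of the squared norm and stationarity replace
    the average by [Z 0]. *)
Lemma residual_average_deviation (e : nat -> HS H) :
  eigensystem (covariance_operator P H X eta) lam nu e ->
  prob P [set w | delta * eps ^+ 2 < `|residual nu e (average w)| ^+ 2] <=
  1 / (delta * eps ^+ 2) * \int[P]_w `|residual nu e (Z 0 w)| ^+ 2.
Proof.
move=> eP; have r0 : 0 < delta * eps ^+ 2 by rewrite mulr_gt0// exprn_gt0.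
have bav := bounded_rv_residual aaverage average_le eP.
have bZ t := bounded_rv_residual (aZ t) (Zc t) eP.
apply: le_trans (prob_markov P r0 bav (fun w => sqr_ge0 _)) _.
rewrite div1r; apply: ler_wpM2l; first by rewrite invr_ge0 ltW.
apply: (@le_trans _ _ (\int[P]_w
    (n%:R^-1 * \sum_(1 <= t < n.+1) `|residual nu e (Z t%:Z w)| ^+ 2))).
  apply: mean_le; first exact: bav.
    exact: (bounded_rv_average n (fun t => bZ t%:Z)).
  move=> w; rewrite residual_average.
  have := norm_average_sqr_le (index_iota 1 n.+1) (fun t => residual nu e (Z t%:Z w)).
  by rewrite size_range.
by rewrite (mean_average n_gt0 (fun t => bZ t%:Z)
  (fun t => stationary_residual nu e t%:Z)).
Qed.

(** If the [nu] coordinates of the average are at most [eps'] and its squared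
    residual is at most [delta * eps ^ 2], then its squared norm is at most
    [nu * eps' ^ 2 + delta * eps ^ 2 = eps ^ 2]. *)
Lemma empirical_autocovariance_deviation : 0 < c ->
  (P [set w | (eps < `|empirical_autocovariance H X eta n w
                       - autocovariance P H X eta|)%R] <=
   (4 * nu%:R * expR (- ((1 - delta) * eps ^+ 2 * q%:R / (32 * nu%:R * c ^+ 2)))
    + 22 * nu%:R * q%:R
      * Num.sqrt (1 + 8 * c * Num.sqrt nu%:R / (eps * Num.sqrt (1 - delta)))
      * alpha_mixing P X lag)%:E
   + (1 / (delta * eps ^+ 2))%:E * \sum_(nu <= j <oo) (lam j)%:E)%E.
Proof.
move=> c0.
have [e eP] := eigensystem_exists
  (covariance_sym P (aZ 0) (Zc 0)) lamE nu.
have nuR : 0 < nu%:R :> R by rewrite ltr0n.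
have d1 : 0 < 1 - delta by rewrite subr_gt0.
have sd : Num.sqrt (1 - delta) ^+ 2 = 1 - delta by rewrite sqr_sqrtr// ltW.
have sn : Num.sqrt nu%:R ^+ 2 = nu%:R :> R by rewrite sqr_sqrtr// ltW.
have sd0 : 0 < Num.sqrt (1 - delta) by rewrite sqrtr_gt0.
have sn0 : 0 < Num.sqrt nu%:R :> R by rewrite sqrtr_gt0.
pose eps' := eps * Num.sqrt (1 - delta) / Num.sqrt nu%:R.
have eps'0 : 0 < eps' by rewrite divr_gt0// mulr_gt0.
have eps'2 : eps' ^+ 2 = (1 - delta) * eps ^+ 2 / nu%:R.
  by rewrite /eps' expr_div_n exprMn sd sn mulrC (mulrC (1 - delta)) mulrC.
pose A i := [set w | n%:R * eps' < `|\sum_(1 <= t < n.+1) inner (Z t%:Z w) (e i)|].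
pose B := [set w | delta * eps ^+ 2 < `|residual nu e (average w)| ^+ 2].
have mexc (f : Omega -> R) (r : R) : measurable_fun setT f -> measurable [set w | r < f w].
  move=> mf; rewrite (_ : [set _ | _] = f @^-1` `]r, +oo[).
    by rewrite -[_ @^-1` _]setTI; exact: mf.
  by apply/seteqP; split => w /=; rewrite in_itv/= andbT.
have b_inner i t : bounded_rv (fun w => inner (Z t w) (e i)).
  exact: bounded_linear_bounded_rv (inner_linear (e i)) (inner_bound (e i)) (aZ t) (Zc t).
have mA i : measurable (A i).
  apply: (mexc (fun w => `|\sum_(1 <= t < n.+1) inner (Z t%:Z w) (e i)|)).
  by apply: (bounded_rv_norm _).1; exact: bounded_rv_sum.
have mB : measurable B.
  apply: (mexc (fun w => `|residual nu e (average w)| ^+ 2)).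
  exact: (bounded_rv_residual aaverage average_le eP).1.
have mexA : measurable [set w | exists2 i, (i < nu)%N & A i w].
  rewrite (_ : [set _ | _] = \bigcup_(i in [set i | (i < nu)%N]) A i)//.
  exact: bigcup_measurable.
have mdev : measurable [set w | (eps < `|empirical_autocovariance H X eta n w
    - autocovariance P H X eta|)%R].
  under eq_set do rewrite averageE.
  by apply: mexc; exact: (approximable_measurable (@continuous_norm R _) aaverage).
have sub : [set w | (eps < `|empirical_autocovariance H X eta n w
    - autocovariance P H X eta|)%R] `<=` [set w | exists2 i, (i < nu)%N & A i w] `|` B.
  move=> w /=; rewrite averageE => ew.
  apply: contrapT => /not_orP[nA /negP]; rewrite -leNgt => nB.
  have coord i : (i < nu)%N -> inner (average w) (e i) ^+ 2 <= (1 - delta) * eps ^+ 2 / nu%:R.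
    move=> inu; rewrite -eps'2 -real_normK ?num_real// ler_pXn2r ?nnegrE ?(ltW eps'0)//.
    rewrite leNgt; apply/negP => h; apply: nA; exists i => //; rewrite /A/=.
    rewrite /average innerZl inner_suml normrM gtr0_norm ?invr_gt0// in h.
    by rewrite -ltr_pdivlMl.
  have : \sum_(i < nu) inner (average w) (e i) ^+ 2 <= (1 - delta) * eps ^+ 2.
    apply: (@le_trans _ _ (\sum_(i < nu) (1 - delta) * eps ^+ 2 / nu%:R)).
      by apply: ler_sum => i _; exact: coord.
    by rewrite sumr_const card_ord -[_ *+ nu]mulr_natl mulrC divfK ?gt_eqF.
  have := norm_residual eP (average w).
  have : eps ^+ 2 < `|average w| ^+ 2 by rewrite ltr_pXn2r ?nnegrE ?(ltW eps_gt0).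
  by move: nB; lra.
have le1 i : (i < nu)%N -> `|e i| <= 1.
  move=> inu; rewrite -(@ler_pXn2r _ 2) ?nnegrE// expr1n -inner_norm eP.2// eqxx/=.
  by case: (_ != 0).
rewrite (probE P mdev).
apply: le_trans (_ : _ <= (\sum_(i < nu) prob P (A i) + prob P B)%:E)%E _.
  rewrite lee_fin; apply: le_trans (le_prob P _ _ sub) _ => //; first exact: measurableU.
  apply: le_trans (probU_le _ _ _) _ => //.
  by rewrite lerD2r; exact: prob_exists_le.
rewrite EFinD; apply: leeD.
  rewrite lee_fin.
  apply: (@le_trans _ _ (\sum_(i < nu) (4 * expR (- (eps' ^+ 2 * q%:R / (8 * (2 * c) ^+ 2))) +
    22 * q%:R * Num.sqrt (1 + 4 * (2 * c) / eps') * alpha_mixing P X lag))).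
    by apply: ler_sum => i _; apply: coordinate_deviation => //; exact: le1.
  rewrite sumr_const card_ord -[_ *+ nu]mulr_natl mulrDr.
  have -> : eps' ^+ 2 * q%:R / (8 * (2 * c) ^+ 2) =
      (1 - delta) * eps ^+ 2 * q%:R / (32 * nu%:R * c ^+ 2).
    by rewrite eps'2; field; rewrite (gt_eqF c0) (gt_eqF nuR).
  have -> : 4 * (2 * c) / eps' = 8 * c * Num.sqrt nu%:R / (eps * Num.sqrt (1 - delta)).
    by rewrite /eps'; field; rewrite (gt_eqF eps_gt0) (gt_eqF sn0) (gt_eqF sd0).
  by rewrite le_eqVlt; apply/orP; left; apply/eqP; ring.
apply: (@le_trans _ _ ((1 / (delta * eps ^+ 2))%:E *
    (\int[P]_w `|residual nu e (Z 0 w)| ^+ 2)%:E)%E).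
  by rewrite -EFinM lee_fin; exact: residual_average_deviation.
apply: lee_wpmul2l; first by rewrite lee_fin divr_ge0// mulr_ge0 ?(ltW delta_gt0)// sqr_ge0.
exact: (residual_le_eigenvalues (aZ 0) (Zc 0) lamE eP).
Qed.

End concentration.

Theorem theorem21 (R : realType) (d : measure_display)
    (Omega : measurableType d) (P : probability Omega R)
    (E : ptopologicalType) (X : int -> Omega -> borel E) (H : rkhs R E)
    (c : R)
    (polishE : polish_space R E)
    (measX : forall t, measurable_fun setT (X t))
    (statX : strictly_stationary P X)
    (sepH : separable H)
    (measphi : measurable_fun setT (rkhs_feature H : borel E -> borel H))
    (sqintX : bochner_square_integrable P (fun w => rkhs_feature H (X 0 w)))
    (centered : bochner_expectation P (fun w => rkhs_feature H (X 0 w)) = 0)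
    (supk : ereal_sup [set (rkhs_kernel H x x)%:E | x in setT] = c%:E)
    (eta : nat) (eps : R) (nu n q : nat) (delta : R)
    (eps_gt0 : 0 < eps) (nu_gt0 : (0 < nu)%N) (n_ge2 : (2 <= n)%N)
    (q_ge1 : (1 <= q)%N) (q_le : (q <= n %/ 2)%N)
    (delta_gt0 : 0 < delta) (delta_lt1 : delta < 1)
    (lam : nat -> R)
    (lamE : ordered_eigenvalues (covariance_operator P H X eta) lam) :
  (P [set w | (eps < `|empirical_autocovariance H X eta n w
                       - autocovariance P H X eta|)%R] <=
   (4 * nu%:R * expR (- ((1 - delta) * eps ^+ 2 * q%:R / (32 * nu%:R * c ^+ 2)))
    + 22 * nu%:R * q%:R
      * Num.sqrt (1 + 8 * c * Num.sqrt nu%:R / (eps * Num.sqrt (1 - delta)))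
      * alpha_mixing P X ((n %/ (2 * q))%N%:Z - eta%:Z))%:E
   + (1 / (delta * eps ^+ 2))%:E * \sum_(nu <= j <oo) (lam j)%:E)%E.
Proof.
have n_gt0 : (0 < n)%N by exact: ltn_trans n_ge2.
have := kernel_bound_ge0 supk; rewrite le_eqVlt => /orP[/eqP c0|c_gt0]; last first.
  exact: (empirical_autocovariance_deviation measX statX sepH measphi supk).
(* If [c = 0] then the feature map vanishes and so does the deviation. *)
rewrite (_ : [set w | _] = set0); last first.
  apply/seteqP; split => // w /=; apply/negP; rewrite -leNgt.
  apply: le_trans (empirical_autocovariance_sub_le P measX sepH measphi supk eta n_gt0 w) _.
  by rewrite -c0 mulr0 ltW.
have [lam0 _ _] := lamE.
rewrite measure0; apply: adde_ge0.
  rewrite lee_fin addr_ge0// mulr_ge0 ?expR_ge0// ?mulr_ge0 ?sqrtr_ge0//.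
  exact: alpha_mixing_ge0.
apply: mule_ge0; first by rewrite lee_fin divr_ge0// mulr_ge0 ?sqr_ge0// ltW.
by apply: nneseries_ge0 => j _ _; rewrite lee_fin.
Qed.
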